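(* Consider the CTMDP model and the associated DTMDP model described in the context, and suppose Condition 1 holds. Let $\pi=(\pi_n)\in\Pi$ be a feasible policy with a finite value for the CTMDP problem such that $\pi_{n+1}(da|x_0,\theta_1,\dots,x_n,s)=\delta_{f^\ast(x_n)}(da)$ whenever $x_n\in S_2$. Then there is a Markov policy $\sigma=(\sigma_n)$ for the DTMDP $\{S_\infty,A,p,\gamma\}$ such that for each $n=0,1,\dots$, $\sigma_{n+1}(da|x)=\delta_{f^\ast(x)}(da)$ for each $x\in S_2$ (if $S_2\neq\emptyset$), and $$M^{n,\pi}_\gamma(\Gamma_S\times\Gamma_A)=\mathbf P^\sigma_\gamma(X_n\in\Gamma_S,\ A_{n+1}\in\Gamma_A)\quad\forall\,\Gamma_S\in\mathcal B(S\setminus S_2),\ \Gamma_A\in\mathcal B(A).$$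
   Context: CTMDP model. $S$ and $A$ are nonempty Borel spaces, $\gamma$ is a probability measure on $\mathcal B(S)$, and $q(dy|x,a)$ is a signed kernel on $\mathcal B(S)$ given $(x,a)\in S\times A$ such that $\tilde q(\Gamma|x,a):=q(\Gamma\setminus\{x\}|x,a)\ge0$ for all $\Gamma\in\mathcal B(S)$, $q(S|x,a)=0$, and, with $q_x(a):=-q(\{x\}|x,a)\ge0$, $\sup_{a\in A}q_x(a)<\infty$ for each $x\in S$. Conventions: $0/0:=0$, $0\cdot\infty:=0$, $c/0:=+\infty$ for $c>0$. Let $x_\infty\notin S$ be an isolated point, $S_\infty:=S\cup\{x_\infty\}$. The sample space $\Omega$ consists of sequences $\omega=(x_0,\theta_1,x_1,\theta_2,\dots)$ with $x_n\in S$, $\theta_n\in(0,\infty)$, together with sequences $(x_0,\theta_1,\dots,\theta_n,x_n,\infty,x_\infty,\infty,x_\infty,\dots)$; $t_0:=0$, $t_n:=t_{n-1}+\theta_n$, $t_\infty:=\lim_n t_n$, $\xi_t:=\sum_{n\ge0}I\{t_n\le t<t_{n+1}\}x_n+I\{t_\infty\le t\}x_\infty$. A policy $\pi=(\pi_n)_{n\ge1}$ is a sequence of stochastic kernels $\pi_n(da|x_0,\theta_1,\dots,x_{n-1},s)$ on $A$ ($s>0$ is the time since the last jump), and $\pi(da|\omega,t):=\sum_{n\ge0}I\{t_n<t\le t_{n+1}\}\pi_{n+1}(da|x_0,\theta_1,\dots,x_n,t-t_n)$ for $t<t_\infty$ (after $t_\infty$ a dummy action at which all rates and costs vanish is used).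 $\Pi$ is the set of all policies. Under $\pi$, $P^\pi_\gamma$ is the unique probability on $\Omega$ with $x_0\sim\gamma$, $P^\pi_\gamma(\theta_{n+1}\ge t|x_0,\theta_1,\dots,x_n)=\exp(-\int_0^t\int_A q_{x_n}(a)\pi_{n+1}(da|x_0,\dots,x_n,s)ds)$, and $P^\pi_\gamma(x_{n+1}\in\Gamma|x_0,\dots,x_n,\theta_{n+1})=\frac{\int_A\tilde q(\Gamma|x_n,a)\pi_{n+1}(da|x_0,\dots,x_n,\theta_{n+1})}{\int_A q_{x_n}(a)\pi_{n+1}(da|x_0,\dots,x_n,\theta_{n+1})}$ for $\Gamma\in\mathcal B(S)$, the remaining probability going to $x_\infty$; $E^\pi_\gamma$ is its expectation. Costs: measurable $c_0,\dots,c_N:S\times A\to[0,\infty)$, $c_i(x_\infty,\cdot):=0$; constants $d_1,\dots,d_N\in[0,\infty)$. $\pi$ is feasible if $E^\pi_\gamma[\int_0^\infty\int_A c_j(\xi_t,a)\pi(da|\omega,t)dt]\le d_j$ for $j=1,\dots,N$, and feasible with a finite value if moreover the same expression with $c_0$ is finite. Occupancy measures: $M^{n,\pi}_\gamma(\Gamma_S\times\Gamma_A):=E^\pi_\gamma[\int_{t_n}^{t_{n+1}}I\{\xi_t\in\Gamma_S\}\int_{\Gamma_A}q_{\xi_t}(a)\pi(da|\omega,t)dt]$, $n=0,1,\dots$. DTMDP model $\{S_\infty,A,p,\gamma\}$: state space $S_\infty$, action space $A$, initial distribution $\gamma$, transition probability $p(\Gamma|x,a):=\tilde q(\Gamma|x,a)/q_x(a)$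 for $x\in S$, $\Gamma\in\mathcal B(S)$, with $p(\{x_\infty\}|x,a):=1-p(S|x,a)$, and $p(\cdot|x_\infty,a):=\delta_{x_\infty}$. Its policies $\sigma=(\sigma_n)$ are stochastic kernels $\sigma_n(da|X_0,A_1,\dots,X_{n-1})$ (Markov if $\sigma_n=\sigma_n(da|X_{n-1})$), with strategic measure $\mathbf P^\sigma_\gamma$ on trajectories $(X_0,A_1,X_1,A_2,\dots)$. Condition 1: (a) $A$ is compact; (b) for each bounded continuous $f$ on $S$, $(x,a)\mapsto\int_S f(y)\tilde q(dy|x,a)/q_x(a)$ is continuous; (c) $(x,a)\mapsto q_x(a)$ is continuous; (d) each $c_i$ is lower semicontinuous. $S_2:=\{x\in S:\inf_{a\in A}(q_x(a)+\sum_{i=0}^Nc_i(x,a))=0\}$, and $f^\ast:S\to A$ is a fixed measurable map with $\sum_{i=0}^Nc_i(x,f^\ast(x))+q_x(f^\ast(x))=0$ for all $x\in S_2$ (it exists under Condition 1). *)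

(* Defs.v *)
From HB Require Import structures.
From mathcomp Require Import all_boot all_order all_algebra.
From mathcomp Require Import all_classical all_reals all_analysis.
From mathcomp Require Import measurable_realfun.
Set Implicit Arguments. Unset Strict Implicit. Unset Printing Implicit Defensive.
Import Order.TTheory GRing.Theory Num.Theory.
Import numFieldNormedType.Exports.
Local Open Scope classical_set_scope.
Local Open Scope ring_scope.

Definition borel (T : ptopologicalType) := g_sigma_algebraType (@open T).

Definition BorelSpace (R : realType) (T : ptopologicalType) : Prop :=
  exists (M : completePseudoMetricType R) (f : T -> M),
    [/\ hausdorff_space M,
        (exists D : set M, countable D /\ closure D = setT),
        injective f, continuous f &
        (forall U : set T, open U ->
            exists V : set M, open V /\ f @` U = range f `&` V) ]
    /\ <<s @open M >> (range f).

(* the state x_oo is represented by None; measurable sets are generated by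
   the measurable subsets of S and the singleton {x_oo} *)
Definition Sinf_gen d (S : measurableType d) : set (set (option S)) :=
  [set G | exists2 B : set S, measurable B & G = Some @` B] `|` [set [set None]].
Definition Sinf d (S : measurableType d) := g_sigma_algebraType (@Sinf_gen d S).

(* histories (x_0, theta_1, x_1, ..., theta_n, x_n) with all x_k in S *)
Notation hist R S n := (borel S * n.-tuple (R * borel S))%type.

Definition hlast (R : realType) (S : ptopologicalType) n (h : hist R S n) : S :=
  last h.1 [seq p.2 | p <- (h.2 : seq _)].

Notation dhist S A n := (Sinf (borel S) * n.-tuple (borel A * Sinf (borel S)))%type.

Notation ctpolicy R S A := (forall n : nat, R.-pker (hist R S n * R)%type ~> borel A).

Section model.
Context (R : realType) (S A : ptopologicalType).
Local Open Scope ereal_scope.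

(* the transition rate q is given as a signed kernel (charge-valued) *)
Definition qx (q : S * A -> {charge set borel S -> \bar R}) (x : S) (a : A) : R :=
  (- fine (q (x, a) [set x]))%R.

Definition S2 (q : S * A -> {charge set borel S -> \bar R}) (c : nat -> S * A -> R) (N : nat) : set S :=
  [set x | ereal_inf [set ((qx q x a + \sum_(i < N.+1) c i (x, a))%R)%:E | a in [set: A]] = 0].

(* p(G|x,a) = qtilde(G|x,a)/q_x(a) on subsets of S (0/0 := 0; c/0 never occurs) *)
Definition pS (q : S * A -> {charge set borel S -> \bar R}) (qtm : S * A -> {measure set borel S -> \bar R}) (x : S) (a : A)
   (G : set S) : R := (fine (qtm (x, a) G) / qx q x a)%R.

Definition ptrans (q : S * A -> {charge set borel S -> \bar R})
  (qtm : S * A -> {measure set borel S -> \bar R}) (y : option S) (a : A) (G : set (option S)) : \bar R :=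
  match y with
  | Some x => (pS q qtm x a [set z | G (Some z)])%:E
              + ((1 - pS q qtm x a setT) * \1_G None)%:E
  | None => (\1_G None)%:E
  end.

Section ctmdp_paths.
Context (dO : measure_display) (O : measurableType dO).
Variables (x : nat -> O -> Sinf (borel S)) (th : nat -> O -> \bar R).

Definition tn (n : nat) (w : O) : \bar R := \sum_(1 <= k < n.+1) th k w.

Definition alive (n : nat) : set O := [set w | x n w <> None].

Definition hist_of (n : nat) (w : O) : hist R S n :=
  (odflt point (x 0 w),
   [tuple (fine (th i.+1 w), odflt point (x i.+1 w)) | i < n]).

(* For F : S -> A -> [0,oo], the value  int_A F(xi_t, a) pi(da|w,t), where
   xi_t = sum_n I{t_n <= t < t_{n+1}} x_n  and
   pi(da|w,t) = sum_m I{t_m < t <= t_{m+1}} pi_{m+1}(da|h_m, t - t_m)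
   (the term is 0 when xi_t = x_oo, i.e. t >= t_oo, and for t < 0). *)
Definition path_int (pol : ctpolicy R S A) (F : S -> A -> \bar R) (w : O) (t : R)
  : \bar R :=
  \sum_(n <oo) \sum_(m <oo)
    ((\1_[set s : R | (tn n w <= s%:E < tn n.+1 w)%E] t)%:E *
     (\1_[set s : R | (tn m w < s%:E <= tn m.+1 w)%E] t)%:E *
     \int[pol m (hist_of m w, (t - fine (tn m w))%R)]_a F (odflt point (x n w)) a).

Definition ct_cost (P : probability O R) (pol : ctpolicy R S A)
  (F : S -> A -> \bar R) : \bar R :=
  \int[P]_w \int[lebesgue_measure]_(t in [set t : R | (0 <= t)%R])
     path_int pol F w t.

Definition ct_occ (P : probability O R)
  (q : S * A -> {charge set borel S -> \bar R}) (pol : ctpolicy R S A) (n : nat)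
  (GS : set S) (GA : set A) : \bar R :=
  \int[P]_w \int[lebesgue_measure]_(t in [set t : R | (tn n w <= t%:E < tn n.+1 w)%E])
     path_int pol (fun y a => (\1_GS y * \1_GA a * qx q y a)%:E) w t.

(* P is the law P^pi_gamma of the CTMDP under policy pi: the sample path
   (x_0, theta_1, x_1, ...) takes values in the sample space Omega, x_0 ~ gamma,
   and the conditional laws of theta_{n+1} and x_{n+1} are as prescribed. *)
Definition ct_law (gamma : probability (borel S) R)
  (q : S * A -> {charge set borel S -> \bar R})
  (qtm : S * A -> {measure set borel S -> \bar R})
  (pol : ctpolicy R S A) (P : probability O R) : Prop :=
  [/\ (forall n, measurable_fun setT (x n)) /\ (forall n, measurable_fun setT (th n : O -> \bar R)),
      (forall w, x 0 w <> None) /\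
      (forall n w, [/\ 0 < th n.+1 w,
                      th n.+1 w = +oo <-> x n.+1 w = None &
                      x n w = None -> th n.+1 w = +oo]),
      (forall G : set (borel S), measurable G -> P (x 0 @^-1` (Some @` G)) = gamma G),
      (forall n (H : set (hist R S n)) (t : R), measurable H -> (0 <= t)%R ->
        P (alive n `&` hist_of n @^-1` H `&` [set w | (t%:E <= th n.+1 w)%E]) =
        \int[P]_(w in alive n `&` hist_of n @^-1` H)
           expeR (- \int[lebesgue_measure]_(s in [set s : R | (0 <= s <= t)%R])
                      \int[pol n (hist_of n w, s)]_a
                          (qx q (odflt point (x n w)) a)%:E)) &
      (forall n (H : set (hist R S n)) (C : set R) (G : set (borel S)),
        measurable H -> measurable C -> measurable G ->
        P (alive n `&` hist_of n @^-1` H `&` th n.+1 @^-1` (EFin @` C)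
             `&` x n.+1 @^-1` (Some @` G)) =
        \int[P]_(w in alive n `&` hist_of n @^-1` H `&` th n.+1 @^-1` (EFin @` C))
           ((fine (\int[pol n (hist_of n w, fine (th n.+1 w))]_a
                      qtm (odflt point (x n w), a) G)
             / fine (\int[pol n (hist_of n w, fine (th n.+1 w))]_a
                      (qx q (odflt point (x n w)) a)%:E))%R)%:E)].

End ctmdp_paths.

Section dtmdp.
Context (dO : measure_display) (O : measurableType dO).
Variables (X : nat -> O -> Sinf (borel S)) (Ac : nat -> O -> borel A).

Definition dhist_of (n : nat) (w : O) : dhist S A n :=
  (X 0 w, [tuple (Ac i.+1 w, X i.+1 w) | i < n]).

(* Q is the strategic measure P^sigma_gamma of the DTMDP {S_oo, A, p, gamma}
   under the Markov policy sigma (sigma n = sigma_{n+1}), by its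
   Ionescu-Tulcea characterization. *)
Definition dt_law (gamma : probability (borel S) R)
  (q : S * A -> {charge set borel S -> \bar R})
  (qtm : S * A -> {measure set borel S -> \bar R})
  (sig : nat -> R.-pker Sinf (borel S) ~> borel A) (Q : probability O R) : Prop :=
  [/\ (forall n, measurable_fun setT (X n)) /\ (forall n, measurable_fun setT (Ac n)),
      (forall G : set (Sinf (borel S)), measurable G ->
         Q (X 0 @^-1` G) = gamma [set y | G (Some y)]),
      (forall n (H : set (dhist S A n)) (C : set (borel A)),
         measurable H -> measurable C ->
         Q (dhist_of n @^-1` H `&` Ac n.+1 @^-1` C) =
         \int[Q]_(w in dhist_of n @^-1` H) sig n (X n w) C) &
      (forall n (H : set (dhist S A n)) (C : set (borel A)) (G : set (Sinf (borel S))),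
         measurable H -> measurable C -> measurable G ->
         Q (dhist_of n @^-1` H `&` Ac n.+1 @^-1` C `&` X n.+1 @^-1` G) =
         \int[Q]_(w in dhist_of n @^-1` H `&` Ac n.+1 @^-1` C)
            ptrans q qtm (X n w) (Ac n.+1 w) G)].

End dtmdp.
End model.

(* Main.v *)
(** Integrating out the holding time through its survival function e^{-L}, with L the
    integral of the averaged rate l, writes M^n as the law of (x_0, ..., theta_n, x_n)
    followed by e^{-L(s)} q_{x_n}(a) pi_{n+1}(da|...,s) ds.  As theta_{n+1} has density
    l e^{-L}, two consequences follow: P(x_{n+1} in G) is the integral of p(G|x,a) against
    M^n, and M^n(E x A) = P(x_n in E, theta_{n+1} < oo).  Off S_2 the holding time is almost
    surely finite: in each such state rate plus total cost is bounded away from 0, so an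
    infinite holding time of positive probability would bring an infinite cost.  Hence M^n
    and the law of x_n have the same S-marginal off S_2, while M^n does not charge S_2 x A
    because f* has zero rate there.

    The Markov policy sigma_{n+1} disintegrates M^n with respect to its S-marginal, and is
    changed to f* on S_2.  The disintegration is built from conditional quantile functions
    on the real line, transported to A by a measurable retraction of R onto A.  By
    induction X_n and x_n have the same law on S, the action f* contributing nothing on S_2
    since p(S|x,f*(x)) = 0 there; the occupancy measures then agree off S_2. *)

(* The law of theta_{n+1} is known only through its survival function, and the averaged rate l is
   merely measurable in time, bounded state by state. The density l e^{-L} is therefore found
   without differentiating L: increments of the two candidate distribution functions differ by
   O((t-s)^2). Identities between iterated integrals are reduced to indicators of rectangles and
   half-lines.

   Whether theta_{n+1} is finite must be decided path by path, before the holding time is integrated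
   out: finite expected costs make the cost of stage n finite almost surely, and histories are then
   split according to whether the total hazard is infinite.

   The kernel in the disintegration is the law of G(y,U), with U uniform on [0,1] and G jointly
   measurable. It is a probability for every y, so no exceptional null set has to be repaired, and
   passing to [fstar] on S_2 only changes G. The retraction exists because A embeds as a Borel
   subset of a complete separable space: the set of reals whose decoded sequence of centres
   converges to a point of that subset is then measurable. *)
Require Import Defs.
From HB Require Import structures.
From mathcomp Require Import all_boot all_order all_algebra.
From mathcomp Require Import all_classical all_reals all_analysis.
From mathcomp Require Import measurable_realfun ring lra.
Import Order.TTheory GRing.Theory Num.Theory.
Import numFieldNormedType.Exports.
Set Implicit Arguments. Unset Strict Implicit. Unset Printing Implicit Defensive.
Local Open Scope classical_set_scope.
Local Open Scope ring_scope.

(** * Integral functionals *)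

Section integral_functionals.
Local Open Scope ereal_scope.
Context {R : realType}.

Definition nnmeas d (T : measurableType d) (f : T -> \bar R) :=
  measurable_fun setT f /\ forall x, 0 <= f x.

(* Iterated integrals against kernels are handled as functionals on nonnegative measurable
   functions; by [integral_functional_measure] these are the integrals against measures. *)
Definition integral_functional d (T : measurableType d)
    (I : (T -> \bar R) -> \bar R) : Prop :=
  [/\ forall f g, nnmeas f -> nnmeas g -> (forall x, f x <= g x) -> I f <= I g,
      forall f g, nnmeas f -> nnmeas g -> I (fun x => f x + g x) = I f + I g,
      forall (c : R) f, (0 <= c)%R -> nnmeas f ->
        I (fun x => c%:E * f x) = c%:E * I f &
      forall F : (T -> \bar R)^nat, (forall n, nnmeas (F n)) ->
        (forall x, {homo (fun n => F n x) : m n / (m <= n)%N >-> m <= n}) ->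
        I (F n) @[n --> \oo] --> I (fun x => limn (fun n => F n x))].

Lemma nnmeasM d (T : measurableType d) (f g : T -> \bar R) :
  nnmeas f -> nnmeas g -> nnmeas (fun x => f x * g x).
Proof.
move=> [mf f0] [mg g0]; split; first exact: emeasurable_funM.
by move=> x; rewrite mule_ge0.
Qed.

Lemma nnmeas_cst d (T : measurableType d) (c : \bar R) :
  0 <= c -> nnmeas (fun _ : T => c).
Proof. by move=> c0; split. Qed.

Lemma nnmeas_indic d (T : measurableType d) (E : set T) :
  measurable E -> nnmeas (fun x => (\1_E x)%:E).
Proof.
move=> mE; split; last by move=> x; rewrite lee_fin.
exact/measurable_EFinP/measurable_indic.
Qed.

Lemma nnmeas_comp d d' (T : measurableType d) (Y : measurableType d')
  (f : T -> \bar R) (phi : Y -> T) :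
  nnmeas f -> measurable_fun setT phi -> nnmeas (f \o phi).
Proof.
by move=> [mf f0] mphi; split; [exact: measurableT_comp|move=> y /=].
Qed.

Lemma integral_functional_integral d (T : measurableType d)
  (mu : {measure set T -> \bar R}) (D : set T) : measurable D ->
  integral_functional (fun f => \int[mu]_(x in D) f x).
Proof.
have mS f : nnmeas f -> measurable_fun D f.
  by case=> mf _; exact: measurable_funTS.
have n0 f : nnmeas f -> forall x, D x -> 0 <= f x by case=> _ f0 x _; exact: f0.
move=> mD; split.
- by move=> f g nf ng fg; apply: ge0_le_integral; auto.
- by move=> f g nf ng; apply: ge0_integralD; auto.
- by move=> c f c0 nf; apply: ge0_integralZl_EFin; auto.
- by move=> F nF ndF; apply: cvg_monotone_convergence; auto.
Qed.

Lemma integral_functional_eval d (T : measurableType d) (t : T) :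
  integral_functional (fun f => f t).
Proof.
split => // F nF ndF; exact: ereal_nondecreasing_is_cvgn.
Qed.

Lemma integral_functional0 d (T : measurableType d) (I : (T -> \bar R) -> \bar R) :
  integral_functional I -> I (fun=> 0) = 0.
Proof.
case=> _ _ IZ _; rewrite -[RHS](mul0e (I (fun=> 0))) -IZ//.
by congr I; apply/funext => x; rewrite mule0.
Qed.

Lemma integral_functional_ge0 d (T : measurableType d)
    (I : (T -> \bar R) -> \bar R) f :
  integral_functional I -> nnmeas f -> 0 <= I f.
Proof.
move=> HI nf; rewrite -(integral_functional0 HI); have [Ile _ _ _] := HI.
by apply: Ile => //; case: nf.
Qed.

Lemma integral_functional_comp d d' (T : measurableType d) (Y : measurableType d')
    (I : (Y -> \bar R) -> \bar R) (K : (T -> \bar R) -> Y -> \bar R) :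
  integral_functional I -> (forall y, integral_functional (fun f => K f y)) ->
  (forall f, nnmeas f -> measurable_fun setT (K f)) ->
  integral_functional (fun f => I (K f)).
Proof.
move=> [Ile ID IZ Ilim] HK mK.
have nK f : nnmeas f -> nnmeas (K f).
  move=> nf; split; first exact: mK.
  by move=> y; exact: (integral_functional_ge0 (HK y) nf).
split.
- move=> f g nf ng fg; apply: Ile => [||y]; [exact: nK..|].
  by have [Kle _ _ _] := HK y; exact: Kle.
- move=> f g nf ng; rewrite -ID; [|exact: nK..].
  congr I; apply/funext => y.
  by have [_ KD _ _] := HK y; exact: KD.
- move=> c f c0 nf; rewrite -IZ//; last exact: nK.
  congr I; apply/funext => y.
  by have [_ _ KZ _] := HK y; exact: KZ.
- move=> F nF ndF.
  have -> : K (fun x => limn (fun n => F n x)) =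
            fun y => limn (fun n => K (F n) y).
    apply/funext => y; have [_ _ _ Klim] := HK y.
    by apply/esym/cvg_lim => //; exact: Klim.
  apply: Ilim => [n|y m n mn]; first exact: nK.
  by have [Kle _ _ _] := HK y; apply: Kle => // x; exact: ndF.
Qed.

Lemma integral_functionalZ d (T : measurableType d) (c : R)
    (I : (T -> \bar R) -> \bar R) : (0 <= c)%R ->
  integral_functional I -> integral_functional (fun f => c%:E * I f).
Proof.
move=> c0 HI.
have [Ile ID IZ Ilim] := HI.
have I0 := integral_functional0 HI.
have Ige f : nnmeas f -> 0 <= I f by exact: integral_functional_ge0.
split.
- by move=> f g nf ng fg; apply: lee_wpmul2l => //; exact: Ile.
- by move=> f g nf ng; rewrite ID// ge0_muleDr//; exact: Ige.
- by move=> r f r0 nf; rewrite IZ// muleCA.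
- by move=> F nF ndF; apply: cvgeZl => //; exact: Ilim.
Qed.

Import HBNNSimple.

(** Monotone limits reduce [f] to simple functions, and additivity with nonnegative homogeneity
    reduces these to indicators. *)
Lemma integral_functional_ext d (T : measurableType d)
    (I J : (T -> \bar R) -> \bar R) :
  integral_functional I -> integral_functional J ->
  (forall E, measurable E -> I (fun x => (\1_E x)%:E) = J (fun x => (\1_E x)%:E)) ->
  forall f, nnmeas f -> I f = J f.
Proof.
move=> HI HJ IJ f nf; have [mf f0] := nf.
pose F n x := (nnsfun_approx measurableT mf n x)%:E.
have nF n : nnmeas (F n).
  split; last by move=> x; rewrite lee_fin.
  exact/measurable_EFinP.
have ndF x : {homo (fun n => F n x) : m n / (m <= n)%N >-> m <= n}.
  by move=> m n mn; rewrite lee_fin; exact/lefP/nd_nnsfun_approx.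
have -> : f = (fun x => limn (fun n => F n x)).
  apply/funext => x; apply/esym/cvg_lim => //.
  by apply: cvg_nnsfun_approx.
have [_ _ _ Il] := HI; have [_ _ _ Jl] := HJ.
have e n : I (F n) = J (F n).
  rewrite /F; move: (nnsfun_approx _ _ n) => h.
  have eh : (fun x => (h x)%:E) = fun x =>
     \sum_(y <- finmap.enum_fset (fset_set (range h))) (y%:E * (\1_(h @^-1` [set y]) x)%:E).
    apply/funext => x; rewrite [in LHS](fimfunE h) (fsbig_finite _ _ (fimfunP h))/=.
    by rewrite sumEFin.
  (* Homogeneity is available only for nonnegative scalars, so nonnegativity of the values is
     carried along the induction over the list of values. *)
  have ge0 y : y \in finmap.enum_fset (fset_set (range h)) -> (0 <= y)%R.
    by rewrite in_fset_set//= inE => -[x _ <-].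
  rewrite eh; move: ge0; elim: (finmap.enum_fset _) => [_|y s IH ge0].
    have -> : (fun x => \sum_(y <- [::]) (y%:E * (\1_(h @^-1` [set y]) x)%:E)) =
              fun=> 0 by apply/funext => x; rewrite big_nil.
    by rewrite !integral_functional0.
  have y0 : (0 <= y)%R by apply: ge0; rewrite inE eqxx.
  have nE : nnmeas (fun x => (\1_(h @^-1` [set y]) x)%:E) by exact: nnmeas_indic.
  have nE' : nnmeas (fun x => y%:E * (\1_(h @^-1` [set y]) x)%:E).
    by apply: nnmeasM => //; exact: nnmeas_cst.
  have nS : nnmeas (fun x => \sum_(y <- s) (y%:E * (\1_(h @^-1` [set y]) x)%:E)).
    split; last first.
      move=> x; rewrite big_seq; apply: sume_ge0 => z zs; rewrite mule_ge0// lee_fin//.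
      by apply: ge0; rewrite inE zs orbT.
    apply: emeasurable_sum => z.
    by apply: emeasurable_funM => //; exact/measurable_EFinP/measurable_indic.
  have -> : (fun x => \sum_(j <- y :: s) (j%:E * (\1_(h @^-1` [set j]) x)%:E)) =
      fun x => y%:E * (\1_(h @^-1` [set y]) x)%:E +
        \sum_(j <- s) (j%:E * (\1_(h @^-1` [set j]) x)%:E).
    by apply/funext => x; rewrite big_cons.
  have [_ ID IZ _] := HI; have [_ JD JZ _] := HJ.
  rewrite ID// JD// IZ// JZ// IJ//; congr (_ + _).
  by apply: IH => z zs; apply: ge0; rewrite inE zs orbT.
have := Il F nF ndF.
have -> : (fun n => I (F n)) = fun n => J (F n) by apply/funext.
move=> cI; have cJ := Jl F nF ndF.
exact: cvg_unique cI cJ.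
Qed.

(** The measure is E |-> I(1_E); its sigma-additivity is the monotone limit property applied to the
    indicators of finite partial unions. *)
Lemma integral_functional_measure d (T : measurableType d)
    (I : (T -> \bar R) -> \bar R) : integral_functional I ->
  exists nu : {measure set T -> \bar R},
    forall f, nnmeas f -> I f = \int[nu]_x f x.
Proof.
move=> HI; have [Ile ID IZ Ilim] := HI.
have I0 := integral_functional0 HI.
have Ige f : nnmeas f -> 0 <= I f by exact: integral_functional_ge0.
(* Off the measurable sets [I] is unconstrained, so the value is set to 0 there to keep [m]
   nonnegative on every set. *)
pose m (E : set T) : \bar R :=
  if pselect (measurable E) then I (fun x => (\1_E x)%:E) else 0.
have mE E : measurable E -> m E = I (fun x => (\1_E x)%:E).
  by rewrite /m; case: pselect.
have m0 : m set0 = 0.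
  by rewrite mE// -[RHS]I0; congr I; apply/funext => x; rewrite indic0.
have mge E : 0 <= m E.
  by rewrite /m; case: pselect => // a; apply: Ige; exact: nnmeas_indic.
have msig : semi_sigma_additive m.
  move=> F mF tF mUF.
  pose G n x : \bar R := (\1_(\big[setU/set0]_(i < n) F i) x)%:E.
  have nG n : nnmeas (G n).
    by apply: nnmeas_indic; exact: bigsetU_measurable.
  have ndG x : {homo (fun n => G n x) : m n / (m <= n)%N >-> m <= n}.
    move=> p n pn; rewrite lee_fin; rewrite !indicE ler_nat.
    case: (boolP (x \in _)) => // xp; rewrite mem_set//.
    by move: xp; rewrite inE; exact: subset_bigsetU.
  have GS n : I (G n) = \sum_(0 <= i < n) m (F i).
    elim: n => [|n IH].
      rewrite big_geq// -[RHS]I0; congr I; apply/funext => x.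
      by rewrite /G big_ord0 indic0.
    rewrite big_nat_recr//= -IH mE// -ID//; last exact: nnmeas_indic.
    congr I; apply/funext => x; rewrite /G big_ord_recr/= -EFinD; congr EFin.
    rewrite !indicE in_setU; case: (boolP (x \in F n)) => xFn; last by rewrite orbF addr0.
    rewrite orbT (_ : x \in _ = false) ?add0r//; apply/negbTE/negP.
    move/set_mem : xFn => xFn /set_mem; rewrite -bigcup_mkord => -[i /= ilt Fi].
    by move/trivIsetP : tF => /(_ i n Logic.I Logic.I (negbT (ltn_eqF ilt))) /seteqP[/(_ x) + _]; apply.
  have {}GS : (fun n => I (G n)) = (fun n => \sum_(0 <= i < n) m (F i)).
    exact/funext.
  rewrite mE// -GS.
  suff -> : (fun x : T => (\1_(\bigcup_n F n) x)%:E) = fun x => limn (fun n => G n x).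
    exact: Ilim.
  apply/funext => x; apply/esym/cvg_lim => //.
  have [[k _ Fk]|nF] := pselect ((\bigcup_n F n) x).
    rewrite indicE mem_set; last by exists k.
    apply: cvg_near_cst; exists k.+1 => // n /= kn.
    by rewrite /G indicE mem_set// -bigcup_mkord; exists k.
  rewrite indicE memNset//; apply: cvg_near_cst; apply: nearW => n.
  by rewrite /G indicE memNset// -bigcup_mkord => -[i _ Fi]; apply: nF; exists i.
pose mu : {measure set T -> \bar R} :=
  HB.pack m (isMeasure.Build _ _ _ m m0 mge msig).
exists mu; apply: integral_functional_ext => //.
  exact: integral_functional_integral.
move=> E mE'; rewrite integral_indic// setIT -mE//.
Qed.

(** Rectangles form a pi-system generating the product sigma-algebra, and finiteness on the constant
    1 lets a measure be determined by it. *)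
Lemma integral_functional_ext_prod d1 d2 (T1 : measurableType d1)
    (T2 : measurableType d2) (I J : (T1 * T2 -> \bar R) -> \bar R) :
  integral_functional I -> integral_functional J -> I (fun=> 1) < +oo ->
  (forall E F, measurable E -> measurable F ->
    I (fun z => (\1_(E `*` F) z)%:E) = J (fun z => (\1_(E `*` F) z)%:E)) ->
  forall f, nnmeas f -> I f = J f.
Proof.
move=> HI HJ Ioo IJ; apply: integral_functional_ext => //.
have [mI hI] := integral_functional_measure HI.
have [mJ hJ] := integral_functional_measure HJ.
move=> E mE; rewrite hI ?hJ; [|exact: nnmeas_indic..].
rewrite !integral_indic// !setIT.
apply: (measure_unique [set A `*` B | A in measurable & B in measurable]
  (fun=> setT)) => //.
- exact: measurable_prod_measurableType.
- move=> _ _ [A mA [B mB <-]] [A' mA' [B' mB' <-]]; rewrite -setXI.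
  by exists (A `&` A'); [exact: measurableI|exists (B `&` B') => //; exact: measurableI].
- by move=> _; exists setT => //; exists setT => //; rewrite setXTT.
- by rewrite bigcup_const//; exists 0%N.
- move=> _ [A mA [B mB <-]]; have := IJ _ _ mA mB.
  have mAB := measurableX mA mB.
  by rewrite hI ?hJ; [rewrite !integral_indic// !setIT|exact: nnmeas_indic..].
- move=> _; move: Ioo; rewrite hI; last exact: nnmeas_cst.
  by rewrite integral_cst// mul1e.
Qed.

(** Half-lines form a generating pi-system, and they are the sets on which a survival function or a
    quantile function gives direct information. *)
Lemma integral_functional_ext_ray (I J : (R -> \bar R) -> \bar R) :
  integral_functional I -> integral_functional J -> I (fun=> 1) < +oo ->
  (forall v, I (fun z => (\1_(`]-oo, v[%classic) z)%:E) =
             J (fun z => (\1_(`]-oo, v[%classic) z)%:E)) ->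
  forall f, nnmeas f -> I f = J f.
Proof.
move=> HI HJ Ioo IJ; apply: integral_functional_ext => //.
have [mI hI] := integral_functional_measure HI.
have [mJ hJ] := integral_functional_measure HJ.
move=> E mE; rewrite hI ?hJ; [|exact: nnmeas_indic..].
rewrite !integral_indic// !setIT.
apply: (measure_unique (@RGenInftyO.G R) (fun k => `]-oo, k%:R[%classic)) => //.
- exact: RGenInftyO.measurableE.
- move=> _ _ [u ->] [v ->]; exists (Num.min u v).
  by apply/seteqP; split => x /=; rewrite !in_itv/= lt_min => /andP.
- by move=> k; exists k%:R.
- apply/seteqP; split => // x _; exists (Num.trunc `|x|).+1 => //=.
  by rewrite in_itv/= (le_lt_trans (ler_norm x))// truncnS_gt.
- move=> _ [v ->]; have := IJ v.
  by rewrite hI ?hJ; [rewrite !integral_indic// !setIT|exact: nnmeas_indic..].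
- move=> k; move: Ioo; rewrite hI; last exact: nnmeas_cst.
  rewrite integral_cst// mul1e; apply: le_lt_trans.
  by apply: le_measure => //; rewrite inE.
Qed.

(** Holds without measurability, by the description of the integral as a supremum over simple
    functions. Costs defined by [path_int] are compared through it, without establishing their
    measurability in the path. *)
Lemma le_ge0_integral d (T : measurableType d) (mu : {measure set T -> \bar R})
    (D : set T) (f g : T -> \bar R) : (forall x, D x -> 0 <= f x) ->
  (forall x, D x -> f x <= g x) ->
  \int[mu]_(x in D) f x <= \int[mu]_(x in D) g x.
Proof.
move=> f0 fg; have g0 x : D x -> 0 <= g x.
  by move=> Dx; exact: le_trans (f0 _ Dx) (fg _ Dx).
rewrite !ge0_integralE//; apply: ereal_sup_le => _ [h hf <-].
exists h => // x; apply: le_trans (hf x) _.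
by rewrite /patch; case: ifPn => // /set_mem; exact: fg.
Qed.

End integral_functionals.

(** * Exponential holding times *)

Section exponential_hazard.
Context {R : realType}.

(** A substitute for a zero derivative: cutting [0,t] into n+1 equal pieces gives |D t| <= C
    t^2/(n+1). *)
Lemma quadratic_increment_eq0 (D : R -> R) (C : R) :
  (forall s t, 0 <= s <= t -> `|D t - D s| <= C * (t - s) ^+ 2) ->
  D 0 = 0 -> forall t, 0 <= t -> D t = 0.
Proof.
move=> HD D0 t t0.
have step n i : (i <= n.+1)%N ->
    `|D (t * i%:R / n.+1%:R)| <= i%:R * (C * (t / n.+1%:R) ^+ 2).
  elim: i => [_|i IH lei]; first by rewrite mulr0 mul0r D0 normr0 mul0r.
  rewrite -[X in `|X|](subrK (D (t * i%:R / n.+1%:R))).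
  apply: le_trans (ler_normD _ _) _.
  rewrite -[i.+1%:R]natr1 mulrDl mul1r addrC lerD//; first exact/IH/ltnW.
  apply: le_trans (HD _ _ _) _.
    rewrite divr_ge0 ?mulr_ge0//= ler_wpM2r ?invr_ge0// ler_wpM2l// lerDl.
    exact: ler01.
  by rewrite -mulrBl -mulrBr addrAC subrr add0r mulr1.
have bd n : `|D t| * n.+1%:R <= C * t ^+ 2.
  have := step n n.+1 (leqnn _); rewrite mulfK ?pnatr_eq0// => h.
  rewrite -ler_pdivlMr// (le_trans h)//.
  by rewrite le_eqVlt; apply/orP; left; apply/eqP; field; rewrite ?addn1 -?natrD ?pnatr_eq0 ?natr1 ?nat1r ?pnatr_eq0.
apply/normr0_eq0/eqP; rewrite eq_le normr_ge0 andbT leNgt; apply/negP => Dt.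
(* This index makes n+1 exceed C t^2 / |D t|, which contradicts [bd]. *)
have := bd (Num.trunc (`|C * t ^+ 2 / `|D t| |)).
rewrite leNgt => /negP; apply.
rewrite [ltRHS]mulrC -ltr_pdivrMr//; apply: le_lt_trans (ler_norm _) _.
exact: truncnS_gt.
Qed.

Local Open Scope ereal_scope.
Notation mu := (@lebesgue_measure R).

Lemma integral_itv_bound (f : R -> R) (K s t : R) (k : R) :
  measurable_fun setT f -> (forall u, s < u <= t -> k <= f u <= K)%R ->
  (0 <= k)%R -> (s <= t)%R ->
  (k * (t - s))%:E <= \int[mu]_(u in `]s, t]) (f u)%:E <= (K * (t - s))%:E.
Proof.
move=> mf fb k0 st.
have mE : mu `]s, t] = (t - s)%:E.
  by rewrite lebesgue_measure_itv/= lte_fin; case: ltgtP st => // <-; rewrite subrr.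
rewrite !EFinM -!mE -!integral_cst//=; apply/andP; split.
- apply: ge0_le_integral => //=.
  + exact/measurable_EFinP/measurable_funTS.
  + by move=> u; rewrite in_itv/= lee_fin => /fb/andP[].
- apply: ge0_le_integral => //=.
  + by move=> u; rewrite in_itv/= lee_fin => /fb/andP[+ _]; exact: le_trans.
  + exact/measurable_EFinP/measurable_funTS.
  + by move=> u; rewrite in_itv/= lee_fin => /fb/andP[].
Qed.

Lemma integral_itv_split (f : R -> R) (s t : R) :
  measurable_fun setT f -> (forall u, 0 <= f u)%R -> (0 <= s <= t)%R ->
  \int[mu]_(u in `[0%R, t]) (f u)%:E =
  \int[mu]_(u in `[0%R, s]) (f u)%:E + \int[mu]_(u in `]s, t]) (f u)%:E.
Proof.
move=> mf f0 /andP[s0 st]; rewrite -ge0_integral_setU//=.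
- by rewrite -itv_bndbnd_setU// bnd_simp.
- exact/measurable_EFinP/measurable_funTS.
- by move=> u _; rewrite lee_fin.
- by apply/disj_setPS => u []/=; rewrite !in_itv/= => /andP[_ us] /andP[]; rewrite ltNge us.
Qed.

Definition cumulative_hazard (lam : R -> R) (t : R) : R :=
  fine (\int[mu]_(u in `[0%R, t]) (lam u)%:E).

Lemma integral_itv_fin_num (f : R -> R) (K t : R) :
  measurable_fun setT f -> (forall u, 0 <= f u <= K)%R -> (0 <= t)%R ->
  \int[mu]_(u in `[0%R, t]) (f u)%:E \is a fin_num.
Proof.
move=> mf fb t0; rewrite -integral_itv_obnd_cbnd; last exact/measurable_EFinP/measurable_funTS.
have /andP[h1 h2] := @integral_itv_bound f K 0 t 0 mf (fun u _ => fb u) (lexx _) t0.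
rewrite ge0_fin_numE ?(le_lt_trans h2) ?ltry//.
by rewrite (le_trans _ h1)// mul0r.
Qed.

(* Both [1 - e^{-L}] and the integral of [lam e^{-L}] increase over []s,t]] by an
   amount between [e^{-L t} (L t - L s)] and [e^{-L s} (L t - L s)]. *)
Lemma integral_hazard_density (lam : R -> R) (K t : R) :
  measurable_fun setT lam -> (forall u, 0 <= lam u <= K)%R ->
  measurable_fun setT (cumulative_hazard lam) -> (0 <= t)%R ->
  \int[mu]_(u in `]0%R, t[) (lam u * expR (- cumulative_hazard lam u))%:E =
  (1 - expR (- cumulative_hazard lam t))%:E.
Proof.
move=> ml lb; have [L LE] : exists L, cumulative_hazard lam = L by eexists.
rewrite LE => mL t0.
pose g u := (lam u * expR (- L u))%R.
have mg : measurable_fun setT g.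
  apply: measurable_funM => //; apply: measurableT_comp => //.
  exact: measurable_funN.
have l0 u : (0 <= lam u)%R by have /andP[] := lb u.
have L0 u : (0 <= L u)%R by rewrite -LE fine_ge0// integral_ge0// => v _; rewrite lee_fin.
have gb u : (0 <= g u <= K)%R.
  have /andP[u0 uK] := lb u; rewrite mulr_ge0 ?expR_ge0//=.
  by rewrite -[leRHS]mulr1 ler_pM ?expR_ge0// -expR0 ler_expR oppr_le0.
have incr (f : R -> R) (s u : R) : measurable_fun setT f -> (forall u, 0 <= f u <= K)%R ->
    (0 <= s <= u)%R ->
    (cumulative_hazard f u - cumulative_hazard f s)%:E = \int[mu]_(v in `]s, u]) (f v)%:E.
  move=> mf fb /andP[s0 su].
  have sfin := integral_itv_fin_num mf fb s0.
  have ufin := integral_itv_fin_num mf fb (le_trans s0 su).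
  rewrite EFinB /cumulative_hazard !fineK// (@integral_itv_split f s u)//.
  + by rewrite addeAC subee// add0e.
  + by move=> v; have /andP[] := fb v.
  + by rewrite s0.
have incrL (s u : R) : (0 <= s <= u)%R ->
    (L u - L s)%:E = \int[mu]_(v in `]s, u]) (lam v)%:E.
  by rewrite -LE; exact: incr.
have [G GE] : exists G, cumulative_hazard g = G by eexists.
have incrG (s u : R) : (0 <= s <= u)%R ->
    (G u - G s)%:E = \int[mu]_(v in `]s, u]) (g v)%:E.
  by rewrite -GE; exact: incr.
have Lnd (s u : R) : (0 <= s <= u)%R -> (L s <= L u)%R.
  move=> su; rewrite -subr_ge0 -lee_fin incrL// integral_ge0// => v _.
  by rewrite lee_fin.
(* Both increments lie between e^{-L u} d and e^{-L s} d, so they differ by at most (e^{-L s} -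
   e^{-L u}) d <= d^2, and d <= K (u - s). *)
have key : forall s u, (0 <= s <= u)%R ->
  (`|(1 - expR (- L u) - G u) -
     (1 - expR (- L s) - G s)| <= K ^+ 2 * (u - s) ^+ 2)%R.
  move=> s u /andP[s0 su].
  have su' : (0 <= s <= u)%R by rewrite s0.
  set d := (L u - L s)%R.
  have d0 : (0 <= d)%R by rewrite subr_ge0 Lnd.
  have dK : (d <= K * (u - s))%R.
    rewrite -lee_fin incrL//.
    by have /andP[] := @integral_itv_bound lam K s u 0 ml (fun v _ => lb v) (lexx _) su.
  have eu : (expR (- L u) <= expR (- L s))%R by rewrite ler_expR lerN2 Lnd.
  have e1 : (expR (- L s) <= 1)%R by rewrite -expR0 ler_expR oppr_le0.
  have Gb : (expR (- L u) * d <= G u - G s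
             <= expR (- L s) * d)%R.
    rewrite -!lee_fin incrG// !EFinM /d incrL//.
    have msc (c : R) : (0 <= c)%R -> c%:E * \int[mu]_(v in `]s, u]) (lam v)%:E =
        \int[mu]_(v in `]s, u]) (c * lam v)%:E.
      move=> c0; under [RHS]eq_integral do rewrite EFinM.
      rewrite ge0_integralZl_EFin//.
      - by move=> v _; rewrite lee_fin.
      - exact/measurable_EFinP/measurable_funTS.
    rewrite !msc ?expR_ge0//; apply/andP; split; apply: ge0_le_integral => //=.
    - by move=> v _; rewrite lee_fin mulr_ge0 ?expR_ge0.
    - by apply/measurable_EFinP/measurable_funTS; apply: measurable_funM => //; exact: measurable_cst.
    - exact/measurable_EFinP/measurable_funTS.
    - move=> v; rewrite in_itv/= => /andP[sv vu].
      rewrite lee_fin mulrC ler_wpM2l// ler_expR lerN2 Lnd//.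
      by rewrite (le_trans s0 (ltW sv)).
    - by move=> v _; rewrite lee_fin; have /andP[] := gb v.
    - exact/measurable_EFinP/measurable_funTS.
    - by apply/measurable_EFinP/measurable_funTS; apply: measurable_funM => //; exact: measurable_cst.
    - move=> v; rewrite in_itv/= => /andP[sv vu].
      by rewrite lee_fin /g mulrC ler_wpM2r// ler_expR lerN2 Lnd// s0 ltW.
  (* Both inequalities are 1 + y <= e^y, at y = d and at y = -d. *)
  have Eb : (expR (- L u) * d <= expR (- L s) - expR (- L u) <= expR (- L s) * d)%R.
    apply/andP; split.
      rewrite (_ : (- L s) = - L u + d)%R; last by rewrite /d addrA addNr add0r.
      rewrite expRD -[X in (_ <= _ - X)%R]mulr1 -mulrBr ler_wpM2l ?expR_ge0//.
      by rewrite lerBrDl (le_trans _ (expR_ge1Dx _)).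
    rewrite (_ : (- L u) = - L s - d)%R; last by rewrite /d; ring.
    rewrite expRD -[X in (X - _ <= _)%R]mulr1 -mulrBr ler_wpM2l ?expR_ge0//.
    by rewrite lerBlDr -lerBlDl (le_trans _ (expR_ge1Dx _)).
  apply: (@le_trans _ _ ((expR (- L s) - expR (- L u)) * d)%R).
    rewrite mulrBl; move/andP: Gb => [G1 G2]; move/andP: Eb => [E1 E2].
    move: G1 G2 E1 E2; move: (G u) (G s).
    move: (expR (- L u)) (expR (- L s)) => a b x y; move: (a * d)%R (b * d)%R.
    by move=> p r ? ? ? ?; rewrite ler_norml; apply/andP; split; lra.
  apply: (@le_trans _ _ (d * d)%R).
    rewrite ler_wpM2r//; move/andP: Eb => [_ /le_trans]; apply.
    by rewrite -[leRHS]mul1r ler_wpM2r.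
  by rewrite -exprMn expr2 ler_pM.
have L00 f : cumulative_hazard f 0 = 0%R.
  by rewrite /cumulative_hazard set_itv1 integral_set1.
have key0 : (1 - expR (- L 0) - G 0 = 0)%R.
  by rewrite -LE -GE !L00 oppr0 expR0 subrr addr0.
have /eqP := quadratic_increment_eq0 key key0 t0; rewrite subr_eq0 => /eqP ->; rewrite -GE /cumulative_hazard fineK; last first.
  exact: integral_itv_fin_num gb t0.
rewrite integral_itv_bndo_bndc; last exact/measurable_EFinP/measurable_funTS.
by rewrite integral_itv_obnd_cbnd//; exact/measurable_EFinP/measurable_funTS.
Qed.

End exponential_hazard.

(** * One holding time with a given conditional survival function *)

Section one_step.
Local Open Scope ereal_scope.
Context {R : realType}.
Notation mu := (@lebesgue_measure R).

Lemma indic_setX (T1 T2 : Type) (E : set T1) (F : set T2) z :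
  (\1_(E `*` F) z = \1_E z.1 * \1_F z.2 :> R)%R.
Proof. by rewrite !indicE in_setX -natrM mulnb. Qed.

Lemma integral_indicl d (T : measurableType d) (m : {measure set T -> \bar R})
    (D : set T) (f : T -> \bar R) :
  \int[m]_(x in D) f x = \int[m]_x ((\1_D x)%:E * f x).
Proof.
rewrite integral_mkcond epatch_indic; apply: eq_integral => x _.
by rewrite muleC.
Qed.

Lemma integral_functional_lebesgue (B : set R) : measurable B ->
  integral_functional (fun f : R -> \bar R => \int[mu]_(x in B) f x).
Proof. by move=> mB; exact: (integral_functional_integral mu mB). Qed.

Lemma measurable_integral_snd d (Y : measurableType d) (B : set R)
    (f : Y * R -> \bar R) : measurable B -> nnmeas f ->
  measurable_fun setT (fun y => \int[mu]_(s in B) f (y, s)).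
Proof.
move=> mB [mf f0].
under eq_fun do rewrite integral_indicl.
apply: (@measurable_fun_fubini_tonelli_F _ _ _ _ _ mu (fun z => (\1_B z.2)%:E * f z)).
- apply: emeasurable_funM => //; apply/measurable_EFinP.
  by apply: measurableT_comp => //; exact: measurable_indic.
- by move=> z; rewrite mule_ge0// lee_fin.
Qed.

Lemma nnmeas_pair d d' (Y : measurableType d) (Z : measurableType d')
    (f : Y * Z -> \bar R) (y : Y) : nnmeas f -> nnmeas (fun z => f (y, z)).
Proof.
by move=> [mf f0]; split => //; exact: measurable_fun_pair2.
Qed.

Lemma integral_functional_path d d' (O : measurableType d) (Y : measurableType d')
    (P : {measure set O -> \bar R}) (D : set O) (h : O -> Y) (B : set R)
    (g : Y * R -> R) :
  measurable D -> measurable_fun setT h -> measurable B ->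
  measurable_fun setT g -> (forall z, 0 <= g z)%R ->
  integral_functional (fun f : Y * R -> \bar R => \int[P]_(w in D)
     \int[mu]_(s in B) ((g (h w, s))%:E * f (h w, s))).
Proof.
move=> mD mh mB mg g0.
apply: (@integral_functional_comp _ _ _ _ _ _
  (fun (f : Y * R -> \bar R) w =>
     \int[mu]_(s in B) ((g (h w, s))%:E * f (h w, s)))).
- exact: integral_functional_integral.
- move=> w; apply: (@integral_functional_comp _ _ _ _ _ _
    (fun (f : Y * R -> \bar R) s => (g (h w, s))%:E * f (h w, s))).
  + exact: integral_functional_lebesgue.
  + by move=> s; apply: integral_functionalZ => //; exact: integral_functional_eval.
  + move=> f [mf f0]; apply: emeasurable_funM.
      apply/measurable_EFinP; exact: measurable_fun_pair2.
    exact: measurable_fun_pair2.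
- move=> f [mf f0].
  apply: (@measurable_integral_snd _ _ B
    (fun z => (g (h z.1, z.2))%:E * f (h z.1, z.2))) => //.
  have mp : measurable_fun [set: O * R] (fun z => (h z.1, z.2)).
    by apply: measurable_fun_pair => //; exact: measurableT_comp.
  apply: nnmeasM.
    split; last by move=> z; rewrite lee_fin.
    by apply/measurable_EFinP; apply: (measurableT_comp mg mp).
  by split => //; exact: (measurableT_comp mf mp).
Qed.

(** In the application [D] is the event that stage n is reached, [h] the history, [th] the next
    holding time and [lam] the averaged rate. The bound [K] depends on the history because rates are
    bounded only for each fixed state. *)
Context d d' (O : measurableType d) (Y : measurableType d')
  (P : probability O R) (D : set O) (h : O -> Y) (th : O -> \bar R)
  (lam : Y * R -> R) (K : Y -> R).
Hypothesis (mD : measurable D) (mh : measurable_fun setT h)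
  (mth : measurable_fun setT th) (th0 : forall w, 0 < th w)
  (mlam : measurable_fun setT lam) (lamK : forall y s, (0 <= lam (y, s) <= K y)%R).

Definition hazard (z : Y * R) : R := cumulative_hazard (fun s => lam (z.1, s)) z.2.
Definition survival (z : Y * R) : R := expR (- hazard z).

Hypothesis law : forall (H : set Y) (t : R), measurable H -> (0 <= t)%R ->
  P (D `&` h @^-1` H `&` [set w | t%:E <= th w]) =
  \int[P]_(w in D `&` h @^-1` H) (survival (h w, t))%:E.

Lemma lam_ge0 z : (0 <= lam z)%R.
Proof. by case: z => y s; have /andP[] := lamK y s. Qed.

Lemma mlam1 y : measurable_fun setT (fun s => lam (y, s)).
Proof. exact: measurable_fun_pair2. Qed.

(** The upper limit of integration varies with the argument; it is turned into an indicator on a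
    product so that Tonelli applies. *)
Lemma measurable_hazard : measurable_fun setT hazard.
Proof.
apply: (measurableT_comp (fine_measurable measurableT)).
under eq_fun do rewrite integral_indicl.
apply: (@measurable_fun_fubini_tonelli_F _ _ _ _ _ mu
  (fun z : (Y * R) * R => (\1_`[0%R, z.1.2] z.2)%:E * (lam (z.1.1, z.2))%:E)).
- apply: emeasurable_funM; apply/measurable_EFinP.
    pose B : set ((Y * R) * R) := [set z | (0 <= z.2 <= z.1.2)%R].
    have mB : measurable B.
      rewrite (_ : B = [set z | (0 <= z.2)%R] `&` [set z | (z.2 <= z.1.2)%R]); last first.
        by apply/seteqP; split => z /= /andP.
      apply: measurableI; rewrite -[X in measurable X]setTI.
        by apply: measurable_fun_ler => //; exact: measurable_cst.
      by apply: measurable_fun_ler => //; exact: measurableT_comp.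
    rewrite (_ : (fun _ => _) = \1_B); first exact: measurable_indic.
    by apply/funext => z; rewrite !indicE; congr (_%:R : R); congr nat_of_bool.
  apply: (measurableT_comp mlam); apply: measurable_fun_pair => //.
  exact: measurableT_comp.
- by move=> z; rewrite mule_ge0// lee_fin// lam_ge0.
Qed.

Lemma measurable_survival : measurable_fun setT survival.
Proof.
apply: measurableT_comp => //; exact: (measurable_funN measurable_hazard).
Qed.

Lemma survival_ge0 z : (0 <= survival z)%R.
Proof. exact: expR_ge0. Qed.

Lemma survival_le1 z : (survival z <= 1)%R.
Proof.
rewrite -expR0 ler_expR oppr_le0 fine_ge0// integral_ge0// => s _.
by rewrite lee_fin lam_ge0.
Qed.

Lemma measurable_gets s : measurable [set w | s%:E <= th w].
Proof.
by rewrite -[X in measurable X]setTI; exact: emeasurable_fun_c_infty.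
Qed.

(** The hypothesis [law] is the case where [f] is an indicator. *)
Lemma survival_integral (f : Y -> \bar R) (s : R) : nnmeas f -> (0 <= s)%R ->
  \int[P]_(w in D `&` [set w | s%:E <= th w]) f (h w) =
  \int[P]_(w in D) ((survival (h w, s))%:E * f (h w)).
Proof.
move=> nf s0.
have mDs : measurable (D `&` [set w | s%:E <= th w]).
  by apply: measurableI => //; exact: measurable_gets.
apply: (@integral_functional_ext _ _ _
  (fun f => \int[P]_(w in D `&` [set w | s%:E <= th w]) f (h w))
  (fun f => \int[P]_(w in D) ((survival (h w, s))%:E * f (h w)))) => //.
- apply: (@integral_functional_comp _ _ _ _ _ _ (fun (f : Y -> \bar R) w => f (h w))).
  + exact: integral_functional_integral.
  + by move=> w; exact: integral_functional_eval.
  + by move=> g [mg _]; exact: measurableT_comp.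
- apply: (@integral_functional_comp _ _ _ _ _ _
    (fun (f : Y -> \bar R) w => (survival (h w, s))%:E * f (h w))).
  + exact: integral_functional_integral.
  + move=> w; apply: integral_functionalZ; first exact: survival_ge0.
    exact: integral_functional_eval.
  + move=> g [mg _]; apply: emeasurable_funM; last exact: measurableT_comp.
    apply/measurable_EFinP; apply: (measurableT_comp measurable_survival).
    exact: measurable_fun_pair.
- move=> H mH; have mhH : measurable (h @^-1` H) by rewrite -[X in measurable X]setTI; exact: mh.
  rewrite (_ : (fun x => _) = fun w => (\1_(h @^-1` H) w)%:E)//.
  transitivity (P (D `&` h @^-1` H `&` [set w | s%:E <= th w])).
    by rewrite integral_indic//; congr (P _); rewrite setIA (setIC _ D).
  rewrite law//.
  rewrite integral_mkcondr; apply: eq_integral => w _.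
  by rewrite epatch_indic.
Qed.

(** Tonelli reduces the claim to a fixed s > 0, where it is [survival_integral]. *)
Lemma occupation_survival (f : Y * R -> \bar R) : nnmeas f ->
  \int[P]_(w in D) \int[mu]_(s in `]0%R, +oo[)
     ((\1_[set s : R | (s%:E <= th w)%E] s)%:E * f (h w, s)) =
  \int[P]_(w in D) \int[mu]_(s in `]0%R, +oo[) ((survival (h w, s))%:E * f (h w, s)).
Proof.
move=> [mf f0].
have mp : measurable_fun [set: O * R] (fun z => (h z.1, z.2)).
  by apply: measurable_fun_pair => //; exact: measurableT_comp.
have swap (g : O * R -> R) : measurable_fun setT g -> (forall z, 0 <= g z)%R ->
  \int[P]_(w in D) \int[mu]_(s in `]0%R, +oo[) ((g (w, s))%:E * f (h w, s)) =
  \int[mu]_(s in `]0%R, +oo[) \int[P]_(w in D) ((g (w, s))%:E * f (h w, s)).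
  move=> mg g0.
  pose F (z : O * R) := (\1_D z.1)%:E * (\1_(`]0%R, +oo[%classic) z.2)%:E *
    ((g z)%:E * f (h z.1, z.2)).
  transitivity (\int[P]_w \int[mu]_s F (w, s)).
    rewrite integral_indicl; apply: eq_integral => w _.
    rewrite integral_indicl -ge0_integralZl_EFin//=.
    - by apply: eq_integral => s _; rewrite /F/= muleA.
    - by move=> s _; rewrite !mule_ge0// lee_fin.
    - apply: emeasurable_funM; first exact/measurable_EFinP/measurable_indic.
      apply: emeasurable_funM; first by apply/measurable_EFinP; exact: measurable_fun_pair2.
      exact: (measurable_fun_pair2 _ mf).
  rewrite (@fubini_tonelli _ _ _ _ _ P mu)//=; first last.
  - by move=> z; rewrite /F !mule_ge0// lee_fin.
  - apply: emeasurable_funM.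
      apply: emeasurable_funM; apply/measurable_EFinP.
        by apply: (measurableT_comp (measurable_indic mD)).
      by apply: measurableT_comp => //; exact: measurable_indic.
    apply: emeasurable_funM; first exact/measurable_EFinP.
    exact: (measurableT_comp mf mp).
  rewrite [RHS]integral_indicl; apply: eq_integral => s _.
  rewrite [in RHS]integral_indicl -ge0_integralZl_EFin//=.
  - by apply: eq_integral => w _; rewrite /F/= [in RHS]muleA [in RHS](muleC _ (\1_D w)%:E).
  - by move=> w _; rewrite !mule_ge0// lee_fin.
  - apply: emeasurable_funM; first exact/measurable_EFinP/measurable_indic.
    apply: emeasurable_funM; first by apply/measurable_EFinP; exact: measurable_fun_pair1.
    apply: (measurableT_comp mf); exact: measurable_fun_pair.
pose g1 (z : O * R) : R := \1_[set z : O * R | (z.2%:E <= th z.1)%E] z.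
pose g2 (z : O * R) : R := survival (h z.1, z.2).
have mg1 : measurable_fun setT g1.
  apply: measurable_indic; rewrite -[X in measurable X]setTI.
  apply: measurable_lee => //; first exact/measurable_EFinP.
  exact: measurableT_comp.
rewrite (swap g1)// (swap g2); [|exact: (measurableT_comp measurable_survival mp)
  |by move=> z; exact: survival_ge0].
apply: eq_integral => s; rewrite inE/= in_itv/= andbT => s0.
rewrite /g2/= -(@survival_integral (fun y => f (y, s)))//; last exact: ltW.
  rewrite integral_mkcondr; apply: eq_integral => w _.
  by rewrite epatch_indic muleC.
by split => //; exact: (measurable_fun_pair1 s mf).
Qed.

(** Conditionally on [h], the finite part of [th] has density [lam] times [survival]. With a set E
    of histories fixed, both sides become functionals of a function of time alone and are compared
    on half-lines. *)
Lemma integral_jump (f : Y * R -> \bar R) : nnmeas f ->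
  \int[P]_(w in D `&` [set w | th w < +oo]) f (h w, fine (th w)) =
  \int[P]_(w in D) \int[mu]_(s in `]0%R, +oo[)
     ((lam (h w, s) * survival (h w, s))%:E * f (h w, s)).
Proof.
move=> nf.
have mDoo : measurable (D `&` [set w | th w < +oo]).
  apply: measurableI => //; rewrite -[X in measurable X]setTI.
  exact: measurable_lte.
have mfth : measurable_fun setT (fun w => fine (th w)).
  exact: (measurableT_comp (fine_measurable measurableT)).
pose g z := (lam z * survival z)%R.
have mg : measurable_fun setT g by exact: measurable_funM measurable_survival.
have g0 z : (0 <= g z)%R by rewrite mulr_ge0 ?lam_ge0 ?survival_ge0.
pose I1 (f : Y * R -> \bar R) := \int[P]_(w in D `&` [set w | th w < +oo]) f (h w, fine (th w)).
pose I2 (f : Y * R -> \bar R) := \int[P]_(w in D) \int[mu]_(s in `]0%R, +oo[) ((g (h w, s))%:E * f (h w, s)).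
have HI1 : integral_functional I1.
  apply: (@integral_functional_comp _ _ _ _ _ _
    (fun (f : Y * R -> \bar R) w => f (h w, fine (th w)))).
  + exact: integral_functional_integral.
  + by move=> w; exact: integral_functional_eval.
  + by move=> k [mk _]; apply: (measurableT_comp mk); exact: measurable_fun_pair.
have HI2 : integral_functional I2 by exact: integral_functional_path.
suff : I1 f = I2 f by [].
apply: integral_functional_ext_prod => //.
  rewrite /I1 integral_cst// mul1e.
  by rewrite (le_lt_trans (probability_le1 _ _))// ltry.
move=> E F mE mF.
have mhE : measurable (h @^-1` E) by rewrite -[X in measurable X]setTI; exact: mh.
have mDE : measurable (D `&` h @^-1` E) by exact: measurableI.
pose C (k : R -> \bar R) (z : Y * R) := (\1_E z.1)%:E * k z.2.
have nC k : nnmeas k -> nnmeas (C k).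
  move=> [mk k0]; apply: nnmeasM; last by split => //; exact: measurableT_comp.
  split; last by move=> z; rewrite lee_fin.
  by apply/measurable_EFinP; apply: measurableT_comp => //; exact: measurable_indic.
have HC z : integral_functional (fun k => C k z).
  by apply: integral_functionalZ => //; exact: integral_functional_eval.
have -> : (fun z : Y * R => (\1_(E `*` F) z)%:E) = C (fun s => (\1_F s)%:E).
  by apply/funext => z; rewrite /C indic_setX.
apply: (@integral_functional_ext_ray _ (fun k => I1 (C k)) (fun k => I2 (C k))).
- by apply: integral_functional_comp => // k /nC[].
- by apply: integral_functional_comp => // k /nC[].
- apply: (@le_lt_trans _ _ (I1 (fun=> 1))).
    have [I1le _ _ _] := HI1; apply: I1le; [exact/nC/nnmeas_cst|exact: nnmeas_cst|].
    by move=> z; rewrite /C mule1 lee_fin indicE lern1 leq_b1.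
  rewrite /I1 integral_cst// mul1e.
  by rewrite (le_lt_trans (probability_le1 _ _))// ltry.
- move=> v.
  (* Holding times are positive, so both sides vanish for v <= 0. *)
  have [v0|v0] := leP v 0%R.
    rewrite /I1 /I2 !integral0_eq//.
      move=> w Dw; apply: integral0_eq => s /=; rewrite in_itv/= andbT => s0.
      by rewrite /C/= (_ : \1_`]-oo, v[%classic s = 0%R) ?mule0// indicE memNset//= in_itv/= ltNge (le_trans v0 (ltW s0)).
    move=> w [Dw /= thoo]; rewrite /C/= (_ : \1_`]-oo, v[%classic _ = 0%R) ?mule0//.
    by rewrite indicE memNset//= in_itv/= ltNge (le_trans v0)// fine_ge0// ltW.
  pose a := \int[P]_(w in D `&` h @^-1` E) (survival (h w, v))%:E.
  have afin : a \is a fin_num.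
    rewrite /a -law//; last exact: ltW.
    by apply: fin_num_measure; apply: measurableI => //; exact: measurable_gets.
  (* [a] is the probability, on [D] with history in [E], of holding at least until v. Being finite,
     it can be added to both sides and cancelled. *)
  suff [h1 h2] : I1 (C (fun z => (\1_`]-oo, v[ z)%:E)) + a = P (D `&` h @^-1` E) /\
     I2 (C (fun z => (\1_`]-oo, v[ z)%:E)) + a = P (D `&` h @^-1` E).
    by rewrite -[LHS](addeK _ afin) h1 -h2 addeK.
  split.
  + have mtv : measurable [set w | th w < v%:E].
      by rewrite -[X in measurable X]setTI; exact: measurable_lte.
    rewrite /a -law// ?ltW//.
    have -> : I1 (C (fun z => (\1_`]-oo, v[ z)%:E)) = P (D `&` h @^-1` E `&` [set w | th w < v%:E]).
      rewrite /I1 (_ : D `&` h @^-1` E `&` [set w | th w < v%:E] =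
        (h @^-1` E `&` [set w | th w < v%:E]) `&` (D `&` [set w | th w < +oo])); last first.
        apply/seteqP; split => w /=; last by move=> [[? ?] [? ?]].
        by move=> [[? ?] tv]; split => //; split => //; rewrite (lt_trans tv)// ltry.
      rewrite -integral_indic//; last exact: measurableI.
      apply: eq_integral => w; rewrite inE => -[Dw /= thoo].
      rewrite /C/= -EFinM !indicE in_setI -natrM mulnb; congr ((_ && _)%:R%:E).
      apply/idP/idP; rewrite !inE/= in_itv/=.
        by rewrite -lte_fin fineK// ge0_fin_numE// ltW.
      by rewrite -lte_fin fineK// ge0_fin_numE// ltW.
    rewrite -measureU//; [| exact: measurableI| |].
    * congr (P _); rewrite -setIUr (_ : _ `|` _ = setT) ?setIT//.
      by apply/seteqP; split => // w _ /=; case: ltP; auto.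
    * by apply: measurableI => //; exact: measurable_gets.
    * by apply/seteqP; split => // w [[_ /= h1] [_ /=]]; rewrite leNgt h1.
  + have -> : I2 (C (fun z => (\1_`]-oo, v[ z)%:E)) =
      \int[P]_(w in D `&` h @^-1` E) (1 - survival (h w, v))%:E.
      rewrite [RHS]integral_mkcondr; apply: eq_integral => w _.
      rewrite epatch_indic.
      have /= <- := @integral_hazard_density _ (fun s => lam (h w, s)) (K (h w)) v
        (mlam1 (h w)) (fun u => lamK (h w) u) _ (ltW v0); last first.
        exact: (measurable_fun_pair2 (h w) measurable_hazard).
      rewrite muleC -ge0_integralZl_EFin//=; last 2 first.
      * by move=> s _; rewrite lee_fin g0.
      * apply/measurable_EFinP/measurable_funTS.
        exact: (measurable_fun_pair2 (h w) mg).
      rewrite integral_mkcond [RHS]integral_mkcond.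
      apply: eq_integral => s _; rewrite /patch !mem_setE !in_itv/= andbT.
      have [s0|s0] := ltP 0%R s => /=; last by [].
      rewrite /C/= (_ : \1_`]-oo, v[%classic s = (s < v)%R%:R); last first.
        by rewrite indicE mem_setE in_itv.
      by case: ifP => sv; rewrite ?mule1 ?mule0// muleC.
    rewrite /a -ge0_integralD//=.
    * by under eq_integral do rewrite -EFinD subrK; rewrite integral_cst// mul1e.
    * by move=> w _; rewrite lee_fin subr_ge0 survival_le1.
    * apply/measurable_EFinP/measurable_funTS/measurable_funB => //.
      apply: (measurableT_comp measurable_survival); exact: measurable_fun_pair.
    * by move=> w _; rewrite lee_fin survival_ge0.
    * apply/measurable_EFinP/measurable_funTS.
      apply: (measurableT_comp measurable_survival); exact: measurable_fun_pair.
- exact: nnmeas_indic.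
Qed.

End one_step.

(** * Measurable retractions of the real line onto Borel spaces *)

Section bit_encoding.
Context {R : realType}.

(* Digits 0 and 1 in base 3, so that distinct bit sequences have distinct codes. *)
Definition bit_partial (b : nat -> bool) (n : nat) : R :=
  \sum_(0 <= i < n) (b i)%:R / 3 ^+ i.+1.

Definition bit_encode (b : nat -> bool) : R := limn (bit_partial b).

(** Every code is at most 1/2, the value when all bits are 1. A code with first bit 0 is thus at
    most 1/6, one with first bit 1 at least 1/3; subtracting the bit from 3t leaves the code of the
    remaining bits. *)
Fixpoint bit_decode (t : R) (n : nat) : bool :=
  if n is m.+1 then bit_decode (3 * t - ((3 : R)^-1 <= t)%R%:R) m else (3 : R)^-1 <= t.

Lemma bit_partialS b n : bit_partial b n.+1 =
  3^-1 * ((b 0)%:R + bit_partial (fun i => b i.+1) n).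
Proof.
rewrite /bit_partial big_nat_recl// mulrDr expr1 mulrC; congr (_ + _).
rewrite big_distrr/=; apply: eq_bigr => i _.
by rewrite [3 ^+ i.+2]exprS invfM mulrCA.
Qed.

Lemma bit_partial_bound b n : 0 <= bit_partial b n <= 2^-1.
Proof.
elim: n b => [|n IH] b.
  by rewrite /bit_partial big_geq// lexx invr_ge0 ler0n.
rewrite bit_partialS; have := IH (fun i => b i.+1).
by case: (b 0) => /= /andP[? ?]; apply/andP; split; lra.
Qed.

Lemma is_cvg_bit_partial b : cvgn (bit_partial b).
Proof.
apply: nondecreasing_is_cvgn.
  apply/nondecreasing_seqP => n; rewrite /bit_partial big_nat_recr//= lerDl.
  by rewrite divr_ge0// exprn_ge0.
by exists 2^-1 => _ [n _ <-]; have /andP[] := bit_partial_bound b n.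
Qed.

Lemma bit_encodeS b :
  bit_encode b = 3^-1 * ((b 0)%:R + bit_encode (fun i => b i.+1)).
Proof.
apply/cvg_lim => //; rewrite -(cvg_shiftS (bit_partial b)).
rewrite (_ : [sequence _]_n = fun n => 3^-1 * ((b 0)%:R + bit_partial (fun i => b i.+1) n)); last first.
  by apply/funext => n; rewrite /= bit_partialS.
by apply: cvgMr; apply: cvgD; [exact: cvg_cst|exact: is_cvg_bit_partial].
Qed.

Lemma bit_encode_bound b : 0 <= bit_encode b <= 2^-1.
Proof.
apply/andP; split.
  apply: limr_ge; first exact: is_cvg_bit_partial.
  by apply: nearW => n; have /andP[] := bit_partial_bound b n.
apply: limr_le; first exact: is_cvg_bit_partial.
by apply: nearW => n; have /andP[] := bit_partial_bound b n.
Qed.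

Lemma bit_encodeK b : bit_decode (bit_encode b) = b.
Proof.
have first_bit c : ((3 : R)^-1 <= bit_encode c) = c 0.
  rewrite bit_encodeS; have := bit_encode_bound (fun i => c i.+1).
  move: (bit_encode _) => z; case: (c 0) => /= /andP[? ?].
    by apply/idP; lra.
  by apply/negbTE; rewrite -ltNge; lra.
apply/funext => n; elim: n b => [|n IH] b /=; first exact: first_bit.
rewrite -[RHS](IH (fun i => b i.+1)); congr bit_decode.
rewrite first_bit [in LHS]bit_encodeS mulrA mulfV ?mul1r ?pnatr_eq0//.
by rewrite addrAC subrr add0r.
Qed.

Lemma measurable_bit_decode n :
  measurable_fun setT (fun t : R => bit_decode t n).
Proof.
have m3 : measurable_fun setT (fun t : R => (3 : R)^-1 <= t).
  exact: measurable_fun_ler.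
elim: n => [|n IH]//=.
apply: (measurableT_comp IH); apply: measurable_funB.
  exact: measurable_funM.
rewrite (_ : (fun t : R => _) = fun t => if (3 : R)^-1 <= t then 1 else 0); last first.
  by apply/funext => t; case: ifP.
exact: measurable_fun_ifT.
Qed.

Lemma measurable_bit_encode d (T : measurableType d) (b : T -> nat -> bool) :
  (forall n, measurable_fun setT (fun t => b t n)) ->
  measurable_fun setT (fun t => bit_encode (b t)).
Proof.
move=> mb; apply: (@measurable_fun_cvg _ _ _ _ (fun n t => bit_partial (b t) n)).
  move=> n; apply: measurable_sum => i; apply: measurable_funM => //.
  rewrite (_ : (fun t : T => _) = fun t => if b t i then 1 else 0); last first.
    by apply/funext => t; case: ifP.
  exact: measurable_fun_ifT.
by move=> t _; exact: is_cvg_bit_partial.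
Qed.

End bit_encoding.

(** * Measurable choice of the first true bit *)

Section first_index.
Context d (T : measurableType d).

Definition first_index (b : nat -> bool) : nat :=
  if pselect (exists i, b i) is left e then ex_minn e else 0.

Lemma first_indexP (b : nat -> bool) : (exists i, b i) -> b (first_index b).
Proof.
by move=> e; rewrite /first_index; case: pselect => // e'; case: ex_minnP.
Qed.

Lemma measurable_first_index (b : T -> nat -> bool) (B : set nat) :
  (forall n, measurable_fun setT (fun t => b t n)) ->
  measurable [set t | B (first_index (b t))].
Proof.
move=> mb.
have mbt n : measurable [set t | b t n].
  by rewrite -[X in measurable X]setTI; exact: (mb n measurableT [set true]).
have mbf n : measurable [set t | ~ b t n] by exact: measurableC (mbt n).
(* [E i] says that the first true bit is at i, [N] that there is none; on [N] the index defaults to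
   0. *)
pose E i := [set t | b t i] `&` \bigcap_(j in `I_i) [set t | ~ b t j].
pose N := \bigcap_j [set t | ~ b t j].
have -> : [set t | B (first_index (b t))] =
    (\bigcup_(i in B) E i) `|` (if `[<B 0>] then N else set0).
  apply/seteqP; split => t /=.
    rewrite /first_index; case: pselect => [e|ne]/=.
      case: ex_minnP => m bm mmin Bm; left; exists m => //; split => // j /= jm bj.
      by have := mmin _ bj; rewrite leqNgt jm.
    by move=> B0; right; rewrite asboolT// => j _ /= bj; apply: ne; exists j.
  move=> [[i Bi [bi ni]]|].
    rewrite /first_index; case: pselect => [e|[]]; last by exists i.
    case: ex_minnP => m bm mmin; suff -> : m = i by [].
    apply/eqP; rewrite eqn_leq mmin// leqNgt; apply/negP => mi.
    exact: (ni m mi).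
  case: asboolP => // B0 Nt; rewrite /first_index; case: pselect => // -[i bi].
  by have := Nt i Logic.I bi.
apply: measurableU.
  apply: bigcup_measurable => i _; apply: measurableI => //.
  by apply: bigcap_measurableType.
by case: ifP => // _; apply: bigcap_measurable => //; exists 0.
Qed.

End first_index.

(** * Measurability of pointwise limits in a complete separable space *)

Section measurable_limits.
Context {R : realType} d (T : measurableType d) (M : completePseudoMetricType R).
Variables (D : nat -> M) (y : nat -> T -> M).
(** [B] is an arbitrary set: the sequences in view run through the points of [D] along a measurable
    index, so every preimage is measurable. *)
Hypothesis (Dd : closure (range D) = setT)
  (my : forall k (B : set M), measurable [set t | B (y k t)]).

Let L : set T := [set t | cvgn (fun k => y k t)].

Let measurable_eventually (B : set M) (k0 : nat) :
  measurable [set t | forall k, (k0 <= k)%N -> B (y k t)].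
Proof.
rewrite (_ : [set t | _] = \bigcap_(k in [set k | (k0 <= k)%N]) [set t | B (y k t)]).
  by apply: bigcap_measurable; [exists k0 => /=|move=> k _; exact: my].
by apply/seteqP; split => t /=.
Qed.

Lemma dense_ball (x : M) (e : R) : 0 < e -> exists i, ball x e (D i).
Proof.
move=> e0; have : closure (range D) x by rewrite Dd.
move=> /(_ (ball x e)) [|_ [[i _ <-] xi]]; first exact: nbhsx_ballx.
by exists i.
Qed.

Lemma measurable_cvg_set : measurable L.
Proof.
(* Cauchy criterion with centres taken from the dense sequence, which makes every union countable;
   completeness gives the converse. *)
rewrite (_ : L = \bigcap_m \bigcup_i \bigcup_k0
   [set t | forall k, (k0 <= k)%N -> ball (D i) m.+1%:R^-1 (y k t)]); last first.
  apply/seteqP; split => t.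
    move=> ct m _.
    have m2 : 0 < (m.+1%:R^-1 / 2 : R) by rewrite divr_gt0// invr_gt0.
    have [i xi] := dense_ball (limn (fun k => y k t)) m2.
    have [k0 _ Hk0] := cvg_ball ct m2.
    exists i => //; exists k0 => // k /= k0k.
    rewrite [m.+1%:R^-1]splitr; apply: ball_triangle (Hk0 k k0k).
    exact: ball_sym.
  move=> Lt; apply/cauchy_cvgP; apply: cauchy_exP => e e0.
  have [m me] : exists m, m.+1%:R^-1 < e :> R.
    exists (Num.trunc e^-1); rewrite invf_plt ?posrE//; exact: truncnS_gt.
  have [i _ [k0 _ Hk]] := Lt m Logic.I.
  exists (D i); exists k0 => // k /= k0k.
  by apply: (@le_ball _ _ _ m.+1%:R^-1); [exact: ltW|exact: Hk].
apply: bigcap_measurable; first by exists 0.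
move=> m _; apply: bigcup_measurable => i _; apply: bigcup_measurable => k0 _.
exact: measurable_eventually.
Qed.

(** For a convergent sequence, the limit lies in an open V exactly when, for one radius 1/(m+1), the
    balls around all late terms are contained in V; this is a condition on the terms only. *)
Lemma measurable_lim_open (V : set M) : open V ->
  measurable [set t | L t /\ V (limn (fun k => y k t))].
Proof.
move=> oV.
rewrite (_ : [set t | _] = L `&` \bigcup_m \bigcup_k0
   [set t | forall k, (k0 <= k)%N -> ball (y k t) m.+1%:R^-1 `<=` V]); last first.
  apply/seteqP; split => t.
    move=> [ct Vt]; split => //.
    have /nbhs_ballP[e /= e0 eV] : nbhs (limn (fun k => y k t)) V by exact: open_nbhs_nbhs.
    have [m me] : exists m, m.+1%:R^-1 < e / 2 :> R.
      exists (Num.trunc (e / 2)^-1); rewrite invf_plt ?posrE ?divr_gt0//; exact: truncnS_gt.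
    have m2 : 0 < (m.+1%:R^-1 : R) by rewrite invr_gt0.
    have [k0 _ Hk0] := cvg_ball ct m2.
    exists m => //; exists k0 => // k /= k0k z yz; apply: eV.
    rewrite [e]splitr; apply: ball_triangle.
      by apply: le_ball (Hk0 k k0k); exact: ltW.
    by apply: le_ball yz; exact: ltW.
  move=> [ct [m _ [k0 _ Hk]]]; split => //.
  have m2 : 0 < (m.+1%:R^-1 : R) by rewrite invr_gt0.
  have [k1 _ Hk1] := cvg_ball ct m2.
  apply: (Hk (maxn k0 k1)); first exact: leq_maxl.
  apply: ball_sym; apply: Hk1; exact: leq_maxr.
apply: measurableI; first exact: measurable_cvg_set.
apply: bigcup_measurable => m _; apply: bigcup_measurable => k0 _.
exact: (@measurable_eventually [set z | ball z m.+1%:R^-1 `<=` V]).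
Qed.

Lemma measurable_lim_borel (B : set M) : <<s @open M >> B ->
  measurable [set t | L t /\ B (limn (fun k => y k t))].
Proof.
move=> mB; have : measurable_fun L (fun t => limn (fun k => y k t) : g_sigma_algebraType (@open M)).
  apply: (@measurability _ _ _ (g_sigma_algebraType (@open M)) _ _ (@open M)) => // _ [V oV <-].
  exact: measurable_lim_open.
by move=> /(_ measurable_cvg_set B mB).
Qed.

End measurable_limits.

(** * Consequences of the Borel embedding *)

Section borel_spaces.
Context {R : realType}.

Lemma BorelSpace_dense (T : ptopologicalType) : BorelSpace R T ->
  exists (M : completePseudoMetricType R) (f : T -> M) (D : nat -> M),
  [/\ hausdorff_space M, closure (range D) = setT, injective f, continuous f &
      (forall U : set T, open U ->
            exists V : set M, open V /\ f @` U = range f `&` V) ]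
    /\ <<s @open M >> (range f).
Proof.
move=> [M [f [[hM [D [cD dD]] fi cf fo] mf]]].
have [D0|[g]] := pfcard_geP cD.
  have : closure D point by rewrite dD.
  by rewrite D0 closure0.
exists M, f, g; split=> //; split => //.
by rewrite -dD; congr closure; exact: surj_image_eq.
Qed.

(** Balls are only neighbourhoods of their centres, so the open sets used below are interiors of
    balls; halving the radius leaves room for this. *)
Lemma dense_interior_ball (M : completePseudoMetricType R) (D : nat -> M) (x : M) (e : R) :
  closure (range D) = setT -> 0 < e -> exists i, (ball (D i) e)^° x.
Proof.
move=> Dd e0; have e2 : 0 < e / 2 by rewrite divr_gt0.
have [i xi] := dense_ball Dd x e2; exists i.
apply/nbhs_ballP; exists (e / 2) => //= z xz; rewrite [e]splitr.
by apply: ball_triangle xz; exact: ball_sym.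
Qed.

(** The base consists of pullbacks of interiors of balls with dense centres and radii 1/(m+1),
    indexed by coded pairs. *)
Lemma BorelSpace_base (T : ptopologicalType) : BorelSpace R T ->
  exists B : nat -> set T, (forall i, open (B i)) /\
    forall x U, open U -> U x -> exists2 i, B i x & B i `<=` U.
Proof.
move=> /BorelSpace_dense[M [f [D [[hM Dd fi cf fo] _]]]].
pose W (p : nat * nat) := f @^-1` (ball (D p.2) p.1.+1%:R^-1)^°.
exists (fun j => if unpickle j is Some p then W p else set0); split.
  move=> j; case: unpickle => [p|]; last exact: open0.
  by apply: open_comp => [x _|]; [exact: cf|exact: open_interior].
move=> x U oU Ux; have [V [oV fUV]] := fo _ oU.
have Vfx : V (f x).
  have : (f @` U) (f x) by exists x.
  by rewrite fUV => -[].
have /nbhs_ballP[e /= e0 eV] : nbhs (f x) V by exact: open_nbhs_nbhs.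
have [m me] : exists m, m.+1%:R^-1 < e / 2 :> R.
  exists (Num.trunc (e / 2)^-1); rewrite invf_plt ?posrE ?divr_gt0//; exact: truncnS_gt.
have m0 : 0 < m.+1%:R^-1 :> R by rewrite invr_gt0.
have [i xi] := dense_interior_ball (f x) Dd m0.
exists (pickle (m, i)); rewrite pickleK// => z /interior_subset zi.
have : (range f `&` V) (f z).
  split; first by exists z.
  apply: eV; rewrite [e]splitr; apply: (@ball_triangle _ _ (D i)).
    by apply/ball_sym; apply: le_ball (ltW me) _ (interior_subset xi).
  exact: le_ball (ltW me) _ zi.
by rewrite -fUV => -[u Uu /fi <-].
Qed.

(** Continuity in Condition 1 refers to the product topology, measurability to the product
    sigma-algebra; countable bases reconcile them by making W a countable union of rectangles. *)
Lemma open_prod_measurable (S A : ptopologicalType) :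
  BorelSpace R S -> BorelSpace R A -> forall W : set (S * A), open W ->
  measurable (W : set (borel S * borel A)).
Proof.
move=> /BorelSpace_base[B [oB hB]] /BorelSpace_base[C [oC hC]] W oW.
have -> : W = \bigcup_(i in setT) \bigcup_(j in [set j | B i `*` C j `<=` W]) (B i `*` C j).
  apply/seteqP; split => [[x a] Wxa|z [i _ [j Wij]]]; last exact: Wij.
  have [[P Q] /= [nP nQ] PQ] : nbhs (x, a) W by exact: open_nbhs_nbhs.
  move: nP nQ; rewrite !nbhsE => -[P' [oP' P'x] P'P] [Q' [oQ' Q'a] Q'Q].
  have [i Bx BP] := hB _ _ oP' P'x; have [j Ca CQ] := hC _ _ oQ' Q'a.
  exists i => //; exists j => //= -[u v] [/= /BP/P'P Pu /CQ/Q'Q Qv].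
  exact: (PQ (u, v)).
apply: bigcup_measurable => i _; apply: bigcup_measurable => j _.
by apply: measurableX; apply: sub_sigma_algebra.
Qed.

Lemma continuous_prod_measurable (S A : ptopologicalType) (f : S * A -> R) :
  BorelSpace R S -> BorelSpace R A -> continuous f ->
  measurable_fun setT (f : borel S * borel A -> R).
Proof.
move=> HS HA /continuousP cf.
apply: (measurability _ (RGenOpens.measurableE R)) => //.
by move=> _ [_ [a [b ->] <-]]; rewrite setTI; apply: open_prod_measurable => //; exact: cf.
Qed.

Lemma borel_measurable_set1 (S : ptopologicalType) (x : S) :
  BorelSpace R S -> measurable ([set x] : set (borel S)).
Proof.
move=> [M [f [[hM _ fi cf fo] _]]].
rewrite -[X in measurable X]setCK; apply: measurableC.
apply: sub_sigma_algebra; rewrite openC.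
rewrite (_ : [set x] = f @^-1` [set f x]); last first.
  by apply/seteqP; split => z /= => [->//|/fi].
apply: closed_comp => [z _|]; first exact: cf.
exact/accessible_closed_set1/hausdorff_accessible.
Qed.

(* [s] codes the bits of membership in countably many balls; [r] is the limit of centres
   selected by these bits, and constant where it fails to exist or leaves the image of [A]. *)
Lemma BorelSpace_retract (A : ptopologicalType) : BorelSpace R A ->
  exists (s : borel A -> R) (r : R -> borel A),
    [/\ measurable_fun setT s, measurable_fun setT r, cancel s r &
        forall a, 0 <= s a <= 1].
Proof.
move=> /BorelSpace_dense[M [f [D [[hM Dd fi cf fo] mrf]]]].
pose W (p : nat * nat) := f @^-1` (ball (D p.2) p.1.+1%:R^-1)^°.
pose b (a : borel A) (j : nat) : bool :=
  if unpickle j is Some p then `[<W p a>] else false.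
have mb j : measurable_fun setT (fun a => b a j).
  rewrite /b; case: unpickle => [p|//].
  apply: (@measurable_fun_bool _ _ _ _ true); rewrite setTI.
  rewrite (_ : _ @^-1` _ = W p); last first.
    by apply/seteqP; split => a /= /asboolP.
  apply: sub_sigma_algebra; apply: open_comp => [x _|]; first exact: cf.
  exact: open_interior.
(* Centre of the first ball of radius 1/(k+1) whose bit is set. If t is the code of a, this ball
   contains [f a], so the centres converge to [f a]. *)
pose y (k : nat) (t : R) := D (first_index (fun i => bit_decode t (pickle (k, i)))).
have my k (B : set M) : measurable [set t | B (y k t)].
  apply: (@measurable_first_index _ _
    (fun t i => bit_decode t (pickle (k, i))) [set i | B (D i)]) => n.
  exact: measurable_bit_decode.
pose l (t : R) := limn (fun k => y k t).
pose L : set R := [set t | cvgn (fun k => y k t) /\ range f (l t)].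
pose r (t : R) : borel A := if pselect (L t) is left h then
  sval (cid2 h.2) else point.
have mL : measurable L by exact: (measurable_lim_borel Dd my mrf).
exists (fun a => bit_encode (b a)), r; split.
- exact: measurable_bit_encode.
- apply: (@measurability _ _ _ (borel A) _ _ (@open A)) => // _ [U oU <-]; rewrite setTI.
  have [V [oV fUV]] := fo _ oU.
  have mfU : <<s @open M >> (f @` U).
    rewrite fUV; apply: (@measurableI _ (g_sigma_algebraType (@open M))) => //.
    exact: sub_sigma_algebra.
  have := measurable_lim_borel Dd my mfU; set E := [set t | _] => mE.
  (* Where the limit exists in the image, [r] inverts [f]; elsewhere it is constantly [point], so
     the complement of [L] contributes all or nothing. *)
  rewrite (_ : r @^-1` U = E `|` (if `[<U point>] then ~` L else set0)).
    by apply: measurableU => //; case: ifP => // _; exact: measurableC.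
  apply/seteqP; split => t /=.
    rewrite /r; case: pselect => [h|nL].
      case: cid2 => a /= _ fal Ua; left; split; first by case: h.
      by exists a.
    by move=> Up; right; rewrite asboolT.
  rewrite /r; case: pselect => [h|nL] [].
  + move=> [_ [u Uu ful]]; case: cid2 => a /= _ fal.
    by rewrite (_ : a = u)//; apply: fi; rewrite fal.
  + by case: ifP => // _ /(_ h).
  + by move=> [ct [u _ ful]]; exfalso; apply: nL; split => //; exists u.
  + by case: asboolP.
- move=> a.
  have yE k : ball (y k (bit_encode (b a))) k.+1%:R^-1 (f a).
    apply: interior_subset.
    have : exists i : nat, bit_decode (bit_encode (b a) : R) (pickle (k, i)).
      have k0 : 0 < k.+1%:R^-1 :> R by rewrite invr_gt0.
      have [i xi] := dense_interior_ball (f a) Dd k0; exists i.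
      by rewrite bit_encodeK /b pickleK; apply/asboolP.
    move=> /first_indexP; rewrite {1}bit_encodeK /b pickleK => /asboolP.
    by [].
  have cy : (fun k => y k (bit_encode (b a))) @ \oo --> f a.
    apply/cvg_ballP => e e0.
    have [m me] : exists m, m.+1%:R^-1 < e :> R.
      exists (Num.trunc e^-1); rewrite invf_plt ?posrE//; exact: truncnS_gt.
    exists m => // k /= mk; apply: ball_sym.
    apply: le_ball (yE k); apply: le_trans (ltW me).
    by rewrite lef_pV2 ?posrE// ler_nat ltnS.
  have lE : l (bit_encode (b a)) = f a by apply/cvg_lim.
  rewrite /r; case: pselect => [h|[]].
    by case: cid2 => a' /= _; rewrite lE => /fi.
  split; first by apply/cvg_ex; exists (f a).
  by exists a.
- move=> a; have /andP[-> /le_trans] := @bit_encode_bound R (b a); apply.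
  by rewrite invf_le1// ler1n.
Qed.

End borel_spaces.

(** * Disintegration *)

Section disintegration.
Local Open Scope ereal_scope.
Context {R : realType}.
Notation mu := (@lebesgue_measure R).

Section finite_copy.
Context d (Y : measurableType d) (m : {measure set Y -> \bar R}).

Definition finite_copy (fm : fin_num_fun m) : set Y -> \bar R := m.

Hypothesis fm : fin_num_fun m.

HB.instance Definition _ := Measure.copy (finite_copy fm) m.
HB.instance Definition _ := Measure_isFinite.Build _ _ _ (finite_copy fm) fm.

End finite_copy.

Lemma density_exists d (Y : measurableType d) (m nu : {measure set Y -> \bar R}) :
  m setT < +oo -> (forall E, measurable E -> nu E <= m E) ->
  exists f : Y -> \bar R, [/\ forall y, 0 <= f y, m.-integrable setT f &
    forall E, measurable E -> nu E = \int[m]_(y in E) f y].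
Proof.
move=> moo num.
have fin (k : {measure set Y -> \bar R}) : k setT < +oo -> fin_num_fun k.
  move=> koo E mE; rewrite ge0_fin_numE//; apply: le_lt_trans koo.
  by apply: le_measure; rewrite ?inE.
have nuoo : nu setT < +oo by apply: le_lt_trans moo; exact: num.
pose m' : {finite_measure set Y -> \bar R} := finite_copy (fin _ moo).
pose nu' : {finite_measure set Y -> \bar R} := finite_copy (fin _ nuoo).
have dom : nu' `<< m'.
  apply/null_content_dominatesP => E mE mE0.
  by apply/eqP; rewrite eq_le measure_ge0 andbT -mE0; exact: num.
by have [f [f0 fi fE]] := radon_nikodym_finite dom; exists f.
Qed.

(** On the set where g < f the integral of f - g is both nonnegative and nonpositive, hence f = g
    almost everywhere there, and that set is null. *)
Lemma ae_le_integral d (Y : measurableType d) (m : {measure set Y -> \bar R})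
    (f g : Y -> \bar R) : m.-integrable setT f -> m.-integrable setT g ->
  (forall E, measurable E -> \int[m]_(y in E) f y <= \int[m]_(y in E) g y) ->
  {ae m, forall y, f y <= g y}.
Proof.
move=> fi gi fg.
have mf := measurable_int _ fi; have mg := measurable_int _ gi.
pose E := [set y | g y < f y].
have mE : measurable E by rewrite -[E]setTI; exact: measurable_lte.
have fiE := integrableS measurableT mE (@subsetT _ _) fi.
have giE := integrableS measurableT mE (@subsetT _ _) gi.
have d0 y : E y -> 0 <= f y - g y.
  move=> Ey; have [gy|gy] := boolP (g y \is a fin_num).
    by rewrite sube_ge0 ?gy ?orbT// ltW.
  move: Ey gy; rewrite /E/=; case: (g y) => // [|fy _]; first by rewrite ltNge leey.
  by move: fy; case: (f y) => [x| |]//= _; exact: leey.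
have : \int[m]_(y in E) `|f y - g y| = 0.
  rewrite (eq_integral (fun y => f y - g y)); last first.
    by move=> y /set_mem Ey; rewrite gee0_abs// d0.
  apply/eqP; rewrite eq_le integral_ge0// andbT integralB//.
  by rewrite sube_le0; exact: fg.
move=> /(ae_eq_integral_abs m mE (emeasurable_funB (measurable_funTS mf) (measurable_funTS mg))) h0.
have hf := integrable_ae measurableT fi; have hg := integrable_ae measurableT gi.
apply: filterS3 h0 hf hg => y h0 /(_ Logic.I) ff /(_ Logic.I) gf.
rewrite leNgt; apply/negP => gltf; have := h0 gltf.
by move=> /eqP; rewrite sube_eq ?gf// add0e => /eqP fge; rewrite fge ltxx in gltf.
Qed.

Section uniform_image.
Context d d' (Z : measurableType d) (B : measurableType d') (G : Z * R -> B).

(** The law of [G (z, U)] for U uniform on [0,1]. Any jointly measurable G gives in this way a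
    probability kernel, with no null set of exceptional z. *)
Definition uniform_image (mG : measurable_fun setT G) (z : Z) (C : set B) : \bar R :=
  mu (`[0%R, 1%R] `&` [set u | C (G (z, u))]).

Hypothesis mG : measurable_fun setT G.

Lemma measurable_uniform_preimage z C : measurable C ->
  measurable (`[0%R, 1%R] `&` [set u : R | C (G (z, u))]).
Proof.
move=> mC; apply: measurableI => //.
by have := measurable_fun_pair2 z mG measurableT mC; rewrite setTI.
Qed.

Let uniform_image0 z : uniform_image mG z set0 = 0.
Proof. by rewrite /uniform_image (_ : [set u | set0 (G (z, u))] = set0)// setI0 measure0. Qed.

Let uniform_image_ge0 z C : 0 <= uniform_image mG z C.
Proof. exact: measure_ge0. Qed.

Let uniform_image_sigma_additive z : semi_sigma_additive (uniform_image mG z).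
Proof.
move=> F mF tF mUF.
rewrite /uniform_image (_ : _ `&` _ =
  \bigcup_n (`[0%R, 1%R] `&` [set u : R | F n (G (z, u))])); last first.
  by rewrite -setI_bigcupr.
apply: (@measure_semi_sigma_additive _ _ _ mu
   (fun n => `[0%R, 1%R] `&` [set u : R | F n (G (z, u))])).
- by move=> n; exact: measurable_uniform_preimage.
- apply/trivIsetP => i j _ _ ij; apply/seteqP; split => // u [[_ Fi] [_ Fj]].
  by move/trivIsetP : tF => /(_ i j Logic.I Logic.I ij)/seteqP[/(_ (G (z, u))) + _]; apply.
- by apply: bigcup_measurable => n _; exact: measurable_uniform_preimage.
Qed.

HB.instance Definition _ z := isMeasure.Build _ _ _ (uniform_image mG z)
  (uniform_image0 z) (uniform_image_ge0 z) (@uniform_image_sigma_additive z).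

Definition uniform_image_kernel (z : Z) : {measure set B -> \bar R} :=
  uniform_image mG z.

Lemma uniform_imageE z C : measurable C -> uniform_image mG z C =
  \int[mu]_(u in `[0%R, 1%R]) (\1_C (G (z, u)))%:E.
Proof.
move=> mC; rewrite (_ : (fun u => _) = fun u => (\1_[set u : R | C (G (z, u))] u)%:E)//.
rewrite integral_indic// 1?setIC//.
by have := measurable_fun_pair2 z mG measurableT mC; rewrite setTI.
Qed.

Let measurable_uniform_image_kernel C : measurable C ->
  measurable_fun setT (uniform_image_kernel ^~ C).
Proof.
move=> mC; rewrite (_ : (fun z => _) = fun z =>
  \int[mu]_(u in `[0%R, 1%R]) (\1_C (G (z, u)))%:E); last first.
  by apply/funext => z; exact: uniform_imageE.
apply: (@measurable_integral_snd _ _ _ _ (fun z => (\1_C (G z))%:E)) => //.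
by apply: (nnmeas_comp (nnmeas_indic mC)).
Qed.

HB.instance Definition _ := isKernel.Build _ _ _ _ _ uniform_image_kernel
  measurable_uniform_image_kernel.

Let uniform_image_kernel_prob z : uniform_image_kernel z [set: B] = 1.
Proof.
rewrite /uniform_image_kernel/= /uniform_image (_ : [set u | setT (G (z, u))] = setT)// setIT.
by rewrite lebesgue_measure_itv/= lte_fin ltr01 -EFinB subr0.
Qed.

HB.instance Definition _ := Kernel_isProbability.Build _ _ _ _ _
  uniform_image_kernel uniform_image_kernel_prob.

Definition uniform_image_pker : R.-pker Z ~> B := uniform_image_kernel.

End uniform_image.

(** Q is the running maximum of the rationals below v in an enumeration, started at 0. *)
Lemma rat_seq_lt (v : R) : (0 < v)%R -> exists Q : nat -> rat,
  [/\ forall n, (0 <= Q n)%R /\ (ratr (Q n) < v)%R,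
      forall n, (Q n <= Q n.+1)%R &
      forall p : rat, (ratr p < v)%R -> exists n, (p <= Q n)%R].
Proof.
move=> v0.
pose st n (q : rat) := if unpickle n is Some p then
  (if (ratr p < v)%R then Num.max q p else q) else q.
pose Q := fix Q n : rat := if n is m.+1 then st m (Q m) else 0%R.
exists Q; split.
- elim=> [|n [IH1 IH2]]; first by rewrite /= lexx rmorph0.
  rewrite /= /st; case: unpickle => [p|//]; case: ifP => // pv.
  by rewrite le_max IH1; split => //; rewrite /Num.max; case: ifP.
- move=> n; rewrite /= /st; case: unpickle => [p|//]; case: ifP => // pv.
  by rewrite le_max lexx.
- move=> p pv; exists (pickle p).+1; rewrite /= /st pickleK pv.
  by rewrite le_max lexx orbT.
Qed.

(** Conditional quantiles: only countably many densities are chosen, one for each rational, so the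
    relations expected between them hold together off a single null set. *)
Lemma disintegration_real d (Y : measurableType d)
    (M : {measure set (Y * R) -> \bar R}) : M setT < +oo ->
  M [set z | ~ (0 <= z.2 <= 1)%R] = 0 ->
  exists g : Y * R -> R, measurable_fun setT g /\
  forall E C, measurable E -> measurable C ->
    M (E `*` C) =
    \int[M]_(z in E `*` setT) mu (`[0%R, 1%R] `&` [set u | C (g (z.1, u))]).
Proof.
move=> Moo M01.
have mT1 E : measurable E -> measurable (E `*` [set: R]) by move=> mE; exact: measurableX.
(* The first marginal of M on the strip over B: B = R gives the reference measure [m], B = ]-oo,q]
   the measure whose density is [f q]. *)
have marginal (B : set R) : measurable B -> exists m : {measure set Y -> \bar R},
    forall (E : set Y) k, measurable E -> nnmeas k ->
      \int[M]_(z in E `*` B) k z.1 = \int[m]_(y in E) k y.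
  move=> mB.
  have HI : integral_functional (fun k : Y -> \bar R => \int[M]_(z in setT `*` B) k z.1).
    apply: (@integral_functional_comp _ _ _ _ _ _ (fun k z => k z.1)).
    - by apply: integral_functional_integral; exact: measurableX.
    - by move=> z; exact: integral_functional_eval.
    - by move=> k [mk _]; exact: measurableT_comp.
  have [m hm] := integral_functional_measure HI; exists m => E k mE nk.
  rewrite [RHS]integral_indicl -(hm (fun y => (\1_E y)%:E * k y)); last first.
    by apply: nnmeasM => //; exact: nnmeas_indic.
  rewrite integral_indicl [RHS]integral_indicl; apply: eq_integral => z _.
  by rewrite !indic_setX indicT mul1r EFinM -muleA muleCA.
have [m hm] := marginal setT measurableT.
have mE E : measurable E -> m E = M (E `*` setT).
  move=> mE; have := hm E (cst 1) mE (nnmeas_cst _ lee01).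
  by rewrite !integral_cst ?mul1e//; exact: mT1.
have moo : m setT < +oo by rewrite mE// setXTT.
have HF (q : rat) : exists f : Y -> \bar R, [/\ forall y, 0 <= f y, m.-integrable setT f &
    forall E, measurable E -> M (E `*` `]-oo, ratr q]%classic) = \int[m]_(y in E) f y].
  have [nu hnu] := marginal `]-oo, ratr q]%classic (measurable_itv _).
  have nuE E : measurable E -> nu E = M (E `*` `]-oo, ratr q]%classic).
    move=> mE'; have := hnu E (cst 1) mE' (nnmeas_cst _ lee01).
    by rewrite !integral_cst ?mul1e//; exact: measurableX.
  have [|f [f0 fi fE]] := @density_exists _ _ m nu moo.
    move=> E mE'; rewrite nuE// mE//; apply: le_measure; rewrite ?inE.
    - exact: measurableX.
    - exact: mT1.
    - by move=> z [].
  by exists f; split => // E mE'; rewrite -nuE// fE.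
have [f fP] := choice HF.
have f0 q y : 0 <= f q y by have [] := fP q.
have fi q : m.-integrable setT (f q) by have [] := fP q.
have fE q E : measurable E -> M (E `*` `]-oo, ratr q]%classic) = \int[m]_(y in E) f q y.
  by have [_ _] := fP q; exact.
have mf q : measurable_fun setT (f q) by exact: measurable_int (fi q).
(* [f q] is a version of the conditional distribution function at [q], and [g] the
   associated quantile function, which maps Lebesgue measure to the conditional law. *)
pose W (z : Y * R) : set R :=
  [set 1%R] `|` [set ratr q | q in [set q | (0 <= q)%R /\ z.2%:E <= f q z.1]].
pose g (z : Y * R) : R := inf (W z).
(* The point 1 makes [W z] nonempty and the condition q >= 0 bounds it below by 0; the quantiles
   thus stay in [0,1], where M is concentrated. *)
have W0 z : W z !=set0 by exists 1%R; left.
have Wlb z : has_lbound (W z).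
  by exists 0%R => x [->//|[q [q0 _] <-]]; rewrite ler0q.
(* An infimum is below v exactly when some element is; this writes {g < v} as a countable union and
   yields measurability of [g]. *)
have gltP (v : R) z : (g z < v)%R <->
    (1 < v)%R \/ exists q, [/\ (0 <= q)%R, (ratr q < v)%R & z.2%:E <= f q z.1].
  split=> [/(inf_lt (W0 z))[x [->|[q [q0 fq] <-]] xv]|].
  - by left.
  - by right; exists q.
  - case=> [v1|[q [q0 qv fq]]].
      by apply: le_lt_trans v1; apply: ge_inf => //; left.
    by apply: le_lt_trans qv; apply: ge_inf => //; right; exists q.
have mg : measurable_fun setT g.
  apply: (measurability _ (RGenInftyO.measurableE R)) => // _ [_ [v ->] <-]; rewrite setTI.
  rewrite (_ : _ @^-1` _ = (if (1 < v)%R then setT else set0) `|`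
    \bigcup_q (if (0 <= q)%R && (ratr q < v)%R then [set z : Y * R | z.2%:E <= f q z.1] else set0)).
    apply: measurableU; first by case: ifP.
    apply: bigcupT_measurable_rat => q; case: ifP => // _.
    rewrite -[X in measurable X]setTI; apply: measurable_lee => //.
      exact/measurable_EFinP.
    exact: measurableT_comp.
  apply/seteqP; split => z /=; rewrite in_itv/=.
    move=> /gltP[->|[q [q0 qv fq]]]; first by left.
    by right; exists q => //; rewrite q0 qv.
  case=> [|[q _]]; last first.
    by case: ifP => // /andP[q0 qv] fq; apply/gltP; right; exists q.
  by case: ifP => // v1 _; apply/gltP; left.
exists g; split => // E C mE' mC.
pose I (k : R -> \bar R) := \int[M]_(z in E `*` setT) k z.2.
pose J (k : R -> \bar R) :=
  \int[M]_(z in E `*` setT) \int[mu]_(u in `[0%R, 1%R]) k (g (z.1, u)).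
have IE B : measurable B -> I (fun x => (\1_B x)%:E) = M (E `*` B).
  move=> mB; rewrite /I (_ : (fun z => _) = fun z => (\1_(setT `*` B) z)%:E).
    rewrite integral_indic//; [|exact: mT1|exact: measurableX].
    by rewrite -setXI setTI setIT.
  by apply/funext => z; rewrite indic_setX indicT mul1r.
have JE B : measurable B -> J (fun x => (\1_B x)%:E) =
    \int[M]_(z in E `*` setT) uniform_image mg z.1 B.
  by move=> mB; apply: eq_integral => z _; rewrite uniform_imageE.
rewrite -IE// -[RHS]JE//.
have HI : integral_functional I.
  apply: (@integral_functional_comp _ _ _ _ _ _ (fun (k : R -> \bar R) (z : Y * R) => k z.2)).
  - by apply: integral_functional_integral; exact: mT1.
  - by move=> z; exact: integral_functional_eval.
  - by move=> k [mk _]; exact: measurableT_comp.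
have HJ : integral_functional J.
  apply: (@integral_functional_comp _ _ _ _ _ _ (fun (k : R -> \bar R) (z : Y * R) =>
    \int[mu]_(u in `[0%R, 1%R]) k (g (z.1, u)))).
  - by apply: integral_functional_integral; exact: mT1.
  - move=> z; apply: (@integral_functional_comp _ _ _ _ _ _ (fun (k : R -> \bar R) u => k (g (z.1, u)))).
    + exact: integral_functional_lebesgue.
    + by move=> u; exact: integral_functional_eval.
    + by move=> k [mk _]; apply: (measurableT_comp mk); exact: measurable_fun_pair2.
  - move=> k nk.
    apply: (@measurable_integral_snd _ _ _ _ (fun p : (Y * R) * R => k (g (p.1.1, p.2)))) => //.
    apply: (nnmeas_comp nk); apply: (measurableT_comp mg).
    by apply: measurable_fun_pair => //; exact: measurableT_comp.
apply: integral_functional_ext_ray => //; last exact: nnmeas_indic.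
  rewrite /I integral_cst//; last exact: mT1.
  rewrite mul1e; apply: le_lt_trans Moo; apply: le_measure; rewrite ?inE//.
  exact: mT1.
move=> v; rewrite IE// JE//.
have mbad : measurable [set z : Y * R | ~ (0 <= z.2 <= 1)%R].
  rewrite (_ : [set z | _] = ~` (setT `*` `[0%R, 1%R]%classic)).
    by apply: measurableC; exact: measurableX.
  by apply/seteqP; split => z /=; rewrite in_itv/= => h; [case|move=> ?; apply: h].
have le_null A B : measurable A -> measurable B ->
    A `<=` B `|` [set z : Y * R | ~ (0 <= z.2 <= 1)%R] -> M A <= M B.
  move=> mA mB AB; rewrite -[leRHS]adde0 -M01.
  apply: (@le_trans _ _ (M (B `|` [set z : Y * R | ~ (0 <= z.2 <= 1)%R]))).
    by apply: le_measure; rewrite ?inE//; exact: measurableU.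
  exact: measureU2.
have mEv : measurable (E `*` `]-oo, v[%classic) by exact: measurableX.
(* For v > 1 the half-line carries all of M, for v <= 0 none of it; the substance is 0 < v <= 1. *)
have [v1|v1] := ltP 1%R v.
  transitivity (M (E `*` setT)).
    apply/eqP; rewrite eq_le; apply/andP; split.
      by apply: le_measure; rewrite ?inE//; [exact: mT1|move=> z []].
    apply: le_null => //; first exact: mT1.
    move=> z [Ez _]; have [/andP[z0 z1]|] := pselect (0 <= z.2 <= 1)%R; last by right.
    by left; split => //=; rewrite in_itv/= (le_lt_trans z1).
  rewrite -[LHS]mul1e -integral_cst; last exact: mT1.
  apply: eq_integral => z _; rewrite /uniform_image (_ : [set u | _ (g (z.1, u))] = setT).
    by rewrite setIT lebesgue_measure_itv/= lte_fin ltr01 -EFinB subr0.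
  by apply/seteqP; split => // u _ /=; rewrite in_itv/=; apply/gltP; left.
have [v0|v0] := leP v 0%R.
  transitivity (0 : \bar R).
    apply/eqP; rewrite eq_le measure_ge0 andbT -[leRHS](measure0 M).
    apply: le_null => // z [_ /=]; rewrite in_itv/= => zv; right => /= /andP[z0 _].
    by have := lt_le_trans zv (le_trans v0 z0); rewrite ltxx.
  apply/esym; apply: integral0_eq => z _; rewrite /uniform_image (_ : [set u | _ (g (z.1, u))] = set0).
    by rewrite setI0 measure0.
  apply/seteqP; split => // u /=; rewrite in_itv/= => /gltP[|[q [q0 qv _]]].
    by rewrite ltNge v1.
  by have := lt_le_trans qv v0; rewrite ltrq0 ltNge q0.
have [Q [Q0 Qnd Qcof]] := rat_seq_lt v0.
rewrite (hm E (fun y => uniform_image mg y `]-oo, v[%classic))//; last first.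
  split; last by move=> y; exact: measure_ge0.
  exact: (measurable_kernel (uniform_image_pker mg)).
have fle p q : (p <= q)%R -> {ae m, forall y, f p y <= f q y}.
  move=> pq; apply: ae_le_integral => // F mF; rewrite -!fE//.
  apply: le_measure; rewrite ?inE//; [exact: measurableX..|].
  by move=> z [Fz /=]; rewrite in_itv/= => zp; split => //=; rewrite ?in_itv/= (le_trans zp)// ler_rat.
have i1 : m.-integrable setT (cst 1).
  apply/integrableP; split => //.
  rewrite (eq_integral (cst 1)) => [|y _]; last by rewrite gee0_abs//; exact: lee01.
  by rewrite integral_cst// mul1e.
have fle1 q : {ae m, forall y, f q y <= 1}.
  apply: (@ae_le_integral _ _ m (f q) (cst 1)) => // F mF; rewrite -fE// integral_cst// mul1e mE//.
  apply: le_measure; rewrite ?inE//; [exact: measurableX|exact: mT1|].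
  by move=> z [].
(* Off a null set the values [f (Q n) y] increase, stay at most 1 and eventually dominate each
   [f p y] with p < v, so {u in [0,1] : g (y, u) < v} is the union of the intervals
   [0, f (Q n) y]. *)
have good : {ae m, forall y, f (Q n) y @[n --> \oo] --> uniform_image mg y `]-oo, v[%classic}.
  have h1 : {ae m, forall y, forall n, f (Q n) y <= f (Q n.+1) y}.
    by apply: ae_foralln => n; exact: fle.
  have h2 : {ae m, forall y, forall n, f (Q n) y <= 1} by exact: ae_foralln.
  have h3 : {ae m, forall y, forall j : nat, if unpickle j is Some p then
      (ratr p < v)%R -> exists n, f p y <= f (Q n) y else True}.
    apply: ae_foralln => j; case: unpickle => [p|]; last exact: filterS filterT.
    have [pv|pv] := boolP (ratr p < v)%R; last by apply: filterS filterT.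
    have [n pn] := Qcof p pv.
    by apply: filterS (fle _ _ pn) => y h _; exists n.
  apply: filterS3 h1 h2 h3 => y h1 h2 h3.
  have fQ n : f (Q n) y \is a fin_num.
    by rewrite ge0_fin_numE//; apply: le_lt_trans (h2 n) _; exact: ltry.
  pose F n := `[0%R, fine (f (Q n) y)]%classic.
  have FE n : mu (F n) = f (Q n) y.
    rewrite /F lebesgue_measure_itv/= fineK// sube0.
    by case: ltP => // h; apply/esym/eqP; rewrite eq_le h f0.
  rewrite (_ : (fun n => f (Q n) y) = mu \o F); last by apply/funext => n /=; rewrite FE.
  rewrite (_ : uniform_image _ _ _ = mu (\bigcup_n F n)).
    apply: nondecreasing_cvg_mu => //.
    - by move=> n; exact: measurable_itv.
    - by apply: bigcup_measurable => n _; exact: measurable_itv.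
    - apply/nondecreasing_seqP => n; apply/subsetPset => u; rewrite /F/= !in_itv/= => /andP[-> un]/=.
      by rewrite (le_trans un)// fine_le.
  congr (mu _); apply/seteqP; split => u.
    move=> [/=]; rewrite !in_itv/= => /andP[u0 _] /gltP[|[q [q0 qv uq]]].
      by rewrite ltNge v1.
    have := h3 (pickle q); rewrite pickleK => /(_ qv)[n qn].
    exists n => //; rewrite /F/= in_itv/= u0/= -lee_fin fineK//.
    exact: le_trans uq qn.
  move=> [n _]; rewrite /F/= in_itv/= => /andP[u0 un]; split => /=; rewrite in_itv/=.
    by rewrite u0/= (le_trans un)// -lee_fin fineK.
  apply/gltP; right; exists (Q n); have [Qn0 Qnv] := Q0 n; split => //=.
  by rewrite -(fineK (fQ n)) lee_fin.
have good' : {ae m, forall y, E y -> f (Q n) y @[n --> \oo] --> uniform_image mg y `]-oo, v[%classic}.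
  by apply: filterS good.
have bd : {ae m, forall y, forall n, E y -> `|f (Q n) y| <= cst 1 y}.
  apply: ae_foralln => n; apply: filterS (fle1 (Q n)) => y h _.
  by rewrite gee0_abs.
have mui : measurable_fun E (fun y => uniform_image mg y `]-oo, v[%classic).
  apply: measurable_funTS; exact: (measurable_kernel (uniform_image_pker mg)).
(* M(E x ]-oo, Q n]) is the integral of [f (Q n)] over E; its limit is computed by dominated
   convergence and again by continuity of M from below. *)
have [_ _ cvgJ] := dominated_convergence mE' (fun n => measurable_funTS (mf (Q n))) mui
  good' (integrableS measurableT mE' (@subsetT _ _) i1) bd.
have cvgI : (fun n => M (E `*` `]-oo, ratr (Q n)]%classic)) @ \oo --> M (E `*` `]-oo, v[%classic).
  rewrite (_ : E `*` `]-oo, v[%classic = \bigcup_n (E `*` `]-oo, ratr (Q n)]%classic)).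
    apply: nondecreasing_cvg_mu.
    - by move=> n; exact: measurableX.
    - by apply: bigcup_measurable => n _; exact: measurableX.
    - apply/nondecreasing_seqP => n; apply/subsetPset => z [Ez /=]; rewrite in_itv/= => zn.
      by split => //=; rewrite in_itv/= (le_trans zn)// ler_rat.
  apply/seteqP; split => z.
    move=> [Ez /=]; rewrite in_itv/= => /rat_in_itvoo[q]; rewrite in_itv/= => /andP[zq qv].
    have [n qn] := Qcof q qv; exists n => //; split => //=; rewrite in_itv/=.
    by rewrite (le_trans (ltW zq))// ler_rat.
  move=> [n _ [Ez /=]]; rewrite in_itv/= => zn; split => //=; rewrite in_itv/=.
  by have [_ /(le_lt_trans zn)] := Q0 n.
apply: (cvg_unique _ cvgI) => //.
rewrite /mkset (_ : (fun n => M _) = fun n => \int[m]_(y in E) f (Q n) y)//.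
by apply/funext => n; rewrite fE.
Qed.

(** The map [s] carries M to Y x R and the retraction [r] carries the quantile map back; as [r]
    undoes [s], the preimage of r^-1 C under [s] is C. *)
Lemma disintegration d (Y : measurableType d) (A : ptopologicalType)
    (M : {measure set (Y * borel A) -> \bar R}) : BorelSpace R A -> M setT < +oo ->
  exists G : Y * R -> borel A, measurable_fun setT G /\
  forall E C, measurable E -> measurable C ->
    M (E `*` C) =
    \int[M]_(z in E `*` setT) mu (`[0%R, 1%R] `&` [set u | C (G (z.1, u))]).
Proof.
move=> /BorelSpace_retract[s [r [ms mr sK s01]]] Moo.
pose phi (z : Y * borel A) : Y * R := (z.1, s z.2).
have mphi : measurable_fun setT phi.
  by apply: measurable_fun_pair => //; exact: measurableT_comp.
have HI : integral_functional (fun f : Y * R -> \bar R => \int[M]_z f (phi z)).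
  apply: (@integral_functional_comp _ _ _ _ _ _ (fun f z => f (phi z))).
  - exact: integral_functional_integral.
  - by move=> z; exact: integral_functional_eval.
  - by move=> f [mf _]; exact: measurableT_comp.
have [N hN] := integral_functional_measure HI.
have NE D : measurable D -> N D = M (phi @^-1` D).
  move=> mD; have := hN _ (nnmeas_indic mD).
  rewrite integral_indic// setIT => <-.
  rewrite (_ : (fun z => _) = fun z => (\1_(phi @^-1` D) z)%:E)//.
  rewrite integral_indic// ?setIT//.
  by rewrite -[X in measurable X]setTI; exact: mphi.
have [||g [mg gE]] := @disintegration_real _ _ N.
- by rewrite NE.
- rewrite NE.
    rewrite (_ : _ @^-1` _ = set0) ?measure0//.
    by apply/seteqP; split => // z /=; rewrite s01.
  rewrite (_ : [set z | _] = ~` (setT `*` `[0%R, 1%R]%classic)).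
    by apply: measurableC; exact: measurableX.
  by apply/seteqP; split => z /=; rewrite in_itv/= => h; [case|move=> ?; apply: h].
exists (r \o g); split; first exact: measurableT_comp.
move=> E C mE mC.
have mrC : measurable (r @^-1` C) by rewrite -[X in measurable X]setTI; exact: mr.
transitivity (N (E `*` (r @^-1` C))).
  rewrite NE; last exact: measurableX.
  by congr (M _); apply/seteqP; split => z /=; rewrite sK.
rewrite gE// [LHS]integral_indicl [RHS]integral_indicl.
pose F (z : Y * R) := (\1_(E `*` [set: R]) z)%:E * uniform_image mg z.1 (r @^-1` C).
transitivity (\int[N]_z F z) => //; rewrite -hN.
  by apply: eq_integral => z _; rewrite /F !indic_setX.
apply: nnmeasM; first by apply: nnmeas_indic; exact: measurableX.
split=> [|z]; last exact: measure_ge0.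
apply: (measurableT_comp (f := fun y => uniform_image mg y (r @^-1` C))) => //.
exact: (measurable_kernel (uniform_image_pker mg)).
Qed.

End disintegration.

(** * The continuous-time model *)

Section extended_state_space.
Context d (S : measurableType d).

Lemma measurable_Sinf_image (B : set S) : measurable B ->
  measurable (Some @` B : set (Sinf S)).
Proof. by move=> mB; apply: sub_sigma_algebra; left; exists B. Qed.

Lemma measurable_Sinf_None : measurable ([set None] : set (Sinf S)).
Proof. by apply: sub_sigma_algebra; right. Qed.

Lemma measurable_Sinf (G : set (Sinf S)) :
  measurable ([set y | G (Some y)] : set S) -> measurable G.
Proof.
move=> mG.
rewrite (_ : G = Some @` [set y | G (Some y)] `|` (if `[<G None>] then [set None] else set0)).
  apply: measurableU; first exact: measurable_Sinf_image.
  by case: ifP => // _; exact: measurable_Sinf_None.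
apply/seteqP; split => [[y|] Gy|y [[z Gz <-]//|]].
- by left; exists y.
- by right; rewrite asboolT.
- by case: asboolP => // GN ->.
Qed.

Lemma measurable_odflt (s0 : S) : measurable_fun setT (odflt s0 : Sinf S -> S).
Proof. by move=> _ B mB; rewrite setTI; exact: measurable_Sinf. Qed.

End extended_state_space.

(** * Translation invariance and auxiliary integration facts *)

Section lebesgue_translation.
Local Open Scope ereal_scope.
Context {R : realType}.
Notation mu := (@lebesgue_measure R).

(** The translated functional is represented by a measure with the right values on half-open
    intervals, and these determine Lebesgue measure. *)
Lemma lebesgue_translation (a : R) (f : R -> \bar R) : nnmeas f ->
  \int[mu]_t f (t - a)%R = \int[mu]_t f t.
Proof.
have mB : measurable_fun setT (fun t : R => (t - a)%R) by exact: measurable_funB.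
have HI : integral_functional (fun f : R -> \bar R => \int[mu]_t f (t - a)%R).
  apply: (@integral_functional_comp _ _ _ _ _
    (fun g : R -> \bar R => \int[mu]_t g t) (fun (f : R -> \bar R) t => f (t - a)%R)).
  + exact: (integral_functional_lebesgue measurableT).
  + by move=> t; exact: integral_functional_eval.
  + by move=> k [mk _]; exact: measurableT_comp.
apply: (@integral_functional_ext _ _ _ (fun f : R -> \bar R => \int[mu]_t f (t - a)%R)).
- exact: HI.
- exact: (integral_functional_lebesgue measurableT).
move=> E mE.
have HI' : @integral_functional R _ (measurableTypeR R)
  (fun f : R -> \bar R => \int[mu]_t f (t - a)%R) by exact: HI.
have [nu hnu] := integral_functional_measure HI'.
have nuE B : measurable B -> nu B = mu [set t : R | B (t - a)%R].
  move=> mB'; have := hnu _ (nnmeas_indic mB').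
  rewrite integral_indic// setIT => <-.
  rewrite (_ : (fun t => _) = fun t => (\1_[set t : R | B (t - a)%R] t)%:E)//.
  by rewrite integral_indic// ?setIT//; have := mB measurableT _ mB'; rewrite setTI.
rewrite (hnu (fun t => (\1_E t)%:E)); last exact: nnmeas_indic.
rewrite !integral_indic// !setIT; apply/esym.
have ocE (X : set R) : ocitv X -> mu X = nu X.
  move=> [[u v] _ <-]; rewrite nuE//=.
  rewrite (_ : [set t | `]u, v]%classic (t - a)%R] = `]u + a, v + a]%classic)%R; last first.
    by apply/seteqP; split => t /=; rewrite !in_itv/= ltrBrDr lerBlDr.
  rewrite !lebesgue_measure_itv/= !lte_fin ltrD2r.
  by case: ifP => // _; rewrite -!EFinB opprD addrACA subrr addr0.
exact: (@lebesgue_measure_unique R nu ocE E mE).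
Qed.

Lemma nneseries_single (u : nat -> \bar R) (n : nat) :
  (forall k, 0 <= u k) -> (forall k, k != n -> u k = 0) ->
  \sum_(k <oo) u k = u n.
Proof.
move=> u0 un; rewrite (nneseries_split 0 n.+1)// add0n.
rewrite [X in _ + X]eseries0 ?adde0; last first.
  by move=> k nk _; rewrite un// gtn_eqF.
rewrite big_nat_recr//= big_nat big1 ?add0e// => k kn.
by rewrite un// ltn_eqF.
Qed.

Lemma measurable_inv : measurable_fun setT (fun x : R => x^-1%R).
Proof.
rewrite -(setUv [set 0%R : R]); apply/measurable_funU => //; first exact: measurableC.
split; first exact: measurable_fun_set1.
apply: open_continuous_measurable_fun.
  by rewrite openC; exact: closed_eq.
by move=> x; rewrite inE => /= /eqP x0; exact: inv_continuous.
Qed.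

Lemma ge0_subset_integral_nm d (T : measurableType d)
    (m : {measure set T -> \bar R}) (B C : set T) (f : T -> \bar R) :
  (forall x, 0 <= f x) -> B `<=` C ->
  \int[m]_(x in B) f x <= \int[m]_(x in C) f x.
Proof.
move=> f0 BC; rewrite integral_mkcond [leRHS]integral_mkcond.
apply: le_ge0_integral => x _; first by rewrite patchE; case: ifP.
rewrite !patchE; case: ifPn => [/set_mem/BC/mem_set ->//|_].
by case: ifP.
Qed.

End lebesgue_translation.

(** * Transition rates and jump probabilities *)

Section transition_rates.
Local Open Scope ereal_scope.
Context {R : realType} (S A : ptopologicalType).
Variables (q : S * A -> {charge set borel S -> \bar R})
  (qtm : S * A -> {measure set borel S -> \bar R}).
Hypotheses (HS : BorelSpace R S) (HA : BorelSpace R A)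
  (Hq_meas : forall G : set (borel S), measurable G ->
     measurable_fun setT (fun z : borel S * borel A => q z G))
  (Hqtm : forall (z : S * A) (G : set (borel S)), measurable G ->
     qtm z G = q z (G `\ z.1))
  (Hq_cons : forall z : S * A, q z setT = 0%E)
  (C1c : continuous (fun z : S * A => qx q z.1 z.2)).

(** Compensating for the atom at x replaces the set G minus {x}, which moves with x, by the fixed
    set G; measurability in (x,a) can then be read off. *)
Lemma qtmE z (G : set (borel S)) : measurable G ->
  qtm z G = q z G + (\1_G z.1 * qx q z.1 z.2)%:E.
Proof.
move=> mG; have m1 := borel_measurable_set1 z.1 HS.
rewrite Hqtm// chargeD//; congr (_ + _).
rewrite indicE; case: (boolP (z.1 \in G)) => zG.
  rewrite mul1r /qx -surjective_pairing EFinN fineK ?fin_num_measure//; congr (- q z _).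
  by apply/setIidPr => y ->; exact: set_mem.
rewrite mul0r (_ : G `&` [set z.1] = set0) ?charge0 ?oppe0//.
by apply/seteqP; split => // y [Gy yz]; rewrite yz in Gy; move: zG; rewrite mem_set.
Qed.

Lemma qtm_setT z : qtm z setT = (qx q z.1 z.2)%:E.
Proof. by rewrite qtmE// Hq_cons add0e indicT mul1r. Qed.

Lemma qx_ge0 x a : (0 <= qx q x a)%R.
Proof. by rewrite -lee_fin -(qtm_setT (x, a)). Qed.

Lemma qtm_le z (G : set (borel S)) : measurable G -> qtm z G <= (qx q z.1 z.2)%:E.
Proof. by move=> mG; rewrite -qtm_setT; apply: le_measure; rewrite ?inE. Qed.

Lemma qtm_fin_num z (G : set (borel S)) : measurable G -> qtm z G \is a fin_num.
Proof.
move=> mG; rewrite ge0_fin_numE//; apply: le_lt_trans (qtm_le z mG) _.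
exact: ltry.
Qed.

Lemma measurable_qx : measurable_fun setT (fun z : borel S * borel A => qx q z.1 z.2).
Proof. exact: (continuous_prod_measurable HS HA C1c). Qed.

Lemma nnmeas_qx : nnmeas (fun z : borel S * borel A => (qx q z.1 z.2)%:E).
Proof.
split; first by apply/measurable_EFinP; exact: measurable_qx.
by move=> z; rewrite lee_fin qx_ge0.
Qed.

Lemma nnmeas_qtm (G : set (borel S)) : measurable G ->
  nnmeas (fun z : borel S * borel A => qtm z G).
Proof.
move=> mG; split; last by move=> z; exact: measure_ge0.
under eq_fun do rewrite qtmE//.
apply: emeasurable_funD; first exact: Hq_meas.
apply/measurable_EFinP; apply: measurable_funM; last exact: measurable_qx.
by apply: (measurableT_comp (measurable_indic mG)).
Qed.

Lemma pS_ge0 x a G : (0 <= pS q qtm x a G)%R.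
Proof. by rewrite divr_ge0 ?qx_ge0// fine_ge0. Qed.

(** If q_x(a) = 0 the quotient is 0 by convention, and [qtm] vanishes as well because it is at most
    q_x(a). *)
Lemma pS_qx z (G : set (borel S)) : measurable G ->
  (pS q qtm z.1 z.2 G * qx q z.1 z.2)%:E = qtm z G.
Proof.
move=> mG; rewrite /pS -surjective_pairing.
have [q0|q0] := eqVneq (qx q z.1 z.2) 0%R.
  rewrite q0 mulr0; apply/eqP; rewrite eq_le measure_ge0/=.
  by rewrite -q0 qtm_le.
by rewrite mulrAC -mulrA mulfV// mulr1 fineK// qtm_fin_num.
Qed.

Lemma nnmeas_pS (G : set (borel S)) : measurable G ->
  nnmeas (fun z : borel S * borel A => (pS q qtm z.1 z.2 G)%:E).
Proof.
move=> mG; split; last by move=> z; rewrite lee_fin pS_ge0.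
apply/measurable_EFinP; rewrite /pS; apply: measurable_funM.
  apply: (measurableT_comp (fine_measurable measurableT)).
  rewrite (_ : (fun z => _) = fun z => qtm z G); first by case: (nnmeas_qtm mG).
  by apply/funext => z; rewrite -surjective_pairing.
exact: (measurableT_comp measurable_inv measurable_qx).
Qed.

End transition_rates.

(** * Sample paths and integration over one holding interval *)

Section paths.
Local Open Scope ereal_scope.
Context {R : realType} (S A : ptopologicalType).
Notation mu := (@lebesgue_measure R).
Context (dO : measure_display) (O : measurableType dO).
Variables (x : nat -> O -> Sinf (borel S)) (th : nat -> O -> \bar R).
Hypotheses (mx : forall n, measurable_fun setT (x n))
  (mth : forall n, measurable_fun setT (th n : O -> \bar R))
  (x0 : forall w, x 0 w <> None)
  (xth : forall n w, [/\ 0 < th n.+1 w, th n.+1 w = +oo <-> x n.+1 w = None &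
                      x n w = None -> th n.+1 w = +oo]).

Lemma measurable_alive n : measurable (alive x n).
Proof.
rewrite (_ : alive x n = x n @^-1` (~` [set None])).
  rewrite -[X in measurable X]setTI; apply: mx => //.
  by apply: measurableC; exact: measurable_Sinf_None.
by apply/seteqP; split.
Qed.

Lemma measurable_hist_of n : measurable_fun setT (hist_of x th n).
Proof.
apply: measurable_fun_pair; first exact: (measurableT_comp (measurable_odflt _)).
apply/measurable_fun_tnthP => i.
rewrite (_ : _ \o _ = fun w => (fine (th i.+1 w), odflt point (x i.+1 w))); last first.
  by apply/funext => w /=; rewrite tnth_mktuple.
apply: measurable_fun_pair; last exact: (measurableT_comp (measurable_odflt _)).
exact: (measurableT_comp (fine_measurable measurableT)).
Qed.

Lemma hlast_recr n (h : hist R S n.+1) : hlast h = (tnth h.2 ord_max).2.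
Proof.
rewrite /hlast (last_nth (point : S)) size_map size_tuple/= (nth_map (point : R * borel S)).
  by rewrite (tnth_nth point).
by rewrite size_tuple.
Qed.

Lemma hlast_hist_of n w : hlast (hist_of x th n w) = odflt point (x n w).
Proof.
case: n => [|n]; last by rewrite hlast_recr tnth_mktuple.
by rewrite /hlast (tuple0 (hist_of x th 0 w).2).
Qed.

Lemma measurable_hlast n : measurable_fun setT (@hlast R S n : hist R S n -> borel S).
Proof.
case: n => [|n].
  rewrite (_ : @hlast R S 0 = fst); first exact: measurable_fst.
  by apply/funext => -[y t]; rewrite /hlast/= (tuple0 t).
rewrite (_ : @hlast R S n.+1 = fun h => (tnth h.2 ord_max).2); last first.
  by apply/funext => h; exact: hlast_recr.
apply: (measurableT_comp measurable_snd).
apply: (measurableT_comp (measurable_tnth ord_max)); exact: measurable_snd.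
Qed.

Lemma aliveS n w : alive x n.+1 w <-> alive x n w /\ th n.+1 w < +oo.
Proof.
have [_ thx xth'] := xth n w; rewrite /alive/=; split.
  move=> xS; split; first by move=> /xth'/thx.
  by rewrite ltey; apply/eqP => /thx.
by move=> [_]; rewrite ltey => /eqP thoo /thx.
Qed.

Lemma tnS n w : tn th n.+1 w = tn th n w + th n.+1 w.
Proof. by rewrite /tn big_nat_recr. Qed.

Lemma th_ge0 n w : 0 <= th n.+1 w.
Proof. by have [/ltW] := xth n w. Qed.

Lemma tn_le m n w : (m <= n)%N -> tn th m w <= tn th n w.
Proof.
move=> /subnK <-; elim: (n - m)%N => [//|k IH].
by rewrite addSn tnS (le_trans IH)// leeDl// th_ge0.
Qed.

Lemma tn_ge0 n w : 0 <= tn th n w.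
Proof. by apply: le_trans (tn_le w (leq0n n)); rewrite /tn big_geq. Qed.

Lemma tn_alive n w : alive x n w -> tn th n w \is a fin_num.
Proof.
elim: n => [|n IH]; first by rewrite /tn big_geq.
move=> /aliveS[/IH h thoo]; rewrite tnS fin_numD h/= ge0_fin_numE//.
exact: th_ge0.
Qed.

Lemma tn_dead n w : ~ alive x n w -> tn th n w = +oo.
Proof.
elim: n => [|n IH]; first by move=> /contrapT/x0.
rewrite tnS => nS; have [a|na] := pselect (alive x n w); last first.
  by rewrite IH// addye// gt_eqF// (lt_le_trans _ (th_ge0 n w))// ltNyr.
rewrite (_ : th n.+1 w = +oo) ?addey ?gt_eqF// ?(lt_le_trans _ (tn_ge0 n w))//.
by apply/eqP; rewrite -leye_eq leNgt; apply/negP => thoo; apply: nS; apply/aliveS.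
Qed.

Variable (pol : ctpolicy R S A).

(** The state is read from the history by [hlast], so that the value is a jointly measurable
    function of history and elapsed time. *)
Definition policy_integral n (f : borel S * borel A -> \bar R)
    (z : hist R S n * R) : \bar R := \int[pol n z]_a f (hlast z.1 : borel S, a).

Lemma nnmeas_policy_integral n f : nnmeas f -> nnmeas (@policy_integral n f).
Proof.
move=> [mf f0]; split; last by move=> z; apply: integral_ge0.
apply: (@measurable_kfcomp _ _ _ _ _ (pol n)
   (fun p : (hist R S n * R) * borel A => f (hlast p.1.1 : borel S, p.2))) => //.
apply: (measurableT_comp mf); apply: measurable_fun_pair => //.
apply: (measurableT_comp (@measurable_hlast n)).
exact: (measurableT_comp measurable_fst).
Qed.

Lemma path_int_ge0 F w t : (forall y a, 0 <= F y a) -> 0 <= path_int x th pol F w t.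
Proof.
move=> F0; apply: nneseries_ge0 => n _ _; apply: nneseries_ge0 => m _ _.
by rewrite !mule_ge0 ?lee_fin// integral_ge0.
Qed.

(** State and policy use intervals closed at opposite ends; strictly inside a holding interval both
    series reduce to the term n. *)
Lemma path_intE (F : S -> A -> \bar R) n w (t : R) : (forall y a, 0 <= F y a) ->
  tn th n w < t%:E < tn th n.+1 w ->
  path_int x th pol F w t = policy_integral (fun z => F z.1 z.2)
     (hist_of x th n w, (t - fine (tn th n w))%R).
Proof.
move=> F0 /andP[nt tn1].
rewrite /path_int (@nneseries_single _ _ n); first last.
- move=> k kn; apply: eseries0 => m _ _.
  rewrite [X in X%:E * _ * _](_ : _ = 0%R) ?mul0e// indicE memNset//= => /andP[k1 k2].
  move: kn; rewrite neq_ltn => /orP[kn|nk].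
    by have := lt_trans (lt_le_trans k2 (tn_le w kn)) nt; rewrite ltxx.
  by have := lt_le_trans tn1 (le_trans (tn_le w nk) k1); rewrite ltxx.
- by move=> k; apply: nneseries_ge0 => m _ _; rewrite !mule_ge0 ?lee_fin// integral_ge0.
rewrite (@nneseries_single _ _ n); first last.
- move=> k kn.
  rewrite [X in _ * X%:E * _](_ : _ = 0%R) ?mule0 ?mul0e// indicE memNset//= => /andP[k1 k2].
  move: kn; rewrite neq_ltn => /orP[kn|nk].
    by have := le_lt_trans (le_trans k2 (tn_le w kn)) nt; rewrite ltxx.
  by have := lt_trans tn1 (le_lt_trans (tn_le w nk) k1); rewrite ltxx.
- by move=> m; rewrite !mule_ge0 ?lee_fin// integral_ge0.
rewrite !indicE !mem_set/= ?nt ?tn1 ?(ltW nt) ?(ltW tn1)// !mul1e.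
by rewrite /policy_integral/= hlast_hist_of.
Qed.

(** Translation by t_n moves the holding interval to the origin; its end points are
    Lebesgue-null. *)
Lemma integral_path_int (F : S -> A -> \bar R) n w :
  nnmeas (fun z : borel S * borel A => F z.1 z.2) -> alive x n w ->
  \int[mu]_(t in [set t : R | (tn th n w <= t%:E < tn th n.+1 w)%E])
     path_int x th pol F w t =
  \int[mu]_(s in `]0%R, +oo[) ((\1_[set s : R | (s%:E <= th n.+1 w)%E] s)%:E *
     policy_integral (fun z => F z.1 z.2) (hist_of x th n w, s)).
Proof.
move=> nF aw; have tfin := tn_alive aw.
have F0 y a : 0 <= F y a by have [_ /(_ (y, a))] := nF.
set a := fine (tn th n w); have aE : tn th n w = a%:E by rewrite fineK.
pose g s := policy_integral (fun z => F z.1 z.2) (hist_of x th n w, s).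
have [mg g0] : nnmeas g.
  have [m1 m2] := @nnmeas_policy_integral n _ nF.
  by split => [|s]; [exact: (measurable_fun_pair2 (hist_of x th n w) m1)|exact: m2].
pose T := [set s : R | 0 < s%:E < th n.+1 w].
have mT : measurable T.
  rewrite (_ : T = [set s : R | 0 < s%:E] `&` [set s : R | s%:E < th n.+1 w]); last first.
    by apply/seteqP; split => s /= /andP.
  by apply: measurableI; rewrite -[X in measurable X]setTI; apply: measurable_lte => //;
    exact/measurable_EFinP.
set D := [set t | _]; have DE : D `\ a = [set t | T (t - a)%R].
  apply/seteqP; split => t; rewrite /D /T/= aE tnS aE lee_fin lte_fin subr_gt0.
    move=> [/andP[at_ tb] /eqP ta]; rewrite lt_neqAle eq_sym ta at_/=.
    by move: tb; case: (th n.+1 w) => [r| |]//=; rewrite ?ltry// -EFinD !lte_fin ltrBlDl.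
  move=> /andP[at_ tb]; split; last by apply/eqP; rewrite gt_eqF.
  rewrite (ltW at_)/=; move: tb.
  by case: (th n.+1 w) => [r| |]//=; rewrite -?EFinD ?addey ?ltry// !lte_fin ltrBlDl.
have mD : measurable (D `\ a).
  rewrite DE; have : measurable_fun setT (fun t : R => (t - a)%R) by exact: measurable_funB.
  by move=> /(_ measurableT _ mT); rewrite setTI.
have pE t : (D `\ a) t -> path_int x th pol F w t = g (t - a)%R.
  rewrite DE => /= /andP[t0 t1]; rewrite (@path_intE F n)// aE lte_fin -subr_gt0.
  move: t0; rewrite lte_fin => -> /=; rewrite tnS aE.
  move: t1; case: (th n.+1 w) => [r| |]//=; first by rewrite -EFinD !lte_fin ltrBlDl.
  by move=> _; rewrite addey// ltry.
have mga : measurable_fun (D `\ a) (fun t => g (t - a)%R).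
  apply: measurable_funTS; apply: (measurableT_comp mg); exact: measurable_funB.
(* At t = t_n the state is already x_n but the policy kernel is not yet that of stage n; this single
   point is discarded. *)
rewrite -(@integral_setD1 _ _ a)//; last first.
  by apply: eq_measurable_fun mga => t /set_mem /pE.
transitivity (\int[mu]_(t in D `\ a) g (t - a)%R).
  by apply: eq_integral => t /set_mem /pE.
rewrite integral_indicl.
transitivity (\int[mu]_t ((\1_T (t - a)%R)%:E * g (t - a)%R)).
  by apply: eq_integral => t _; rewrite DE.
rewrite (@lebesgue_translation _ a (fun s => (\1_T s)%:E * g s)); last first.
  by apply: nnmeasM => //; exact: nnmeas_indic.
rewrite -integral_indicl -/g.
(* The right end point is put back to match the event theta >= s in the law of the holding time; it
   exists only if theta is finite. *)
pose T' := [set s : R | 0 < s%:E <= th n.+1 w].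
transitivity (\int[mu]_(s in T') g s); last first.
  rewrite integral_indicl [RHS]integral_indicl; apply: eq_integral => s _.
  rewrite muleA -EFinM; congr (_%:E * _).
  rewrite !indicE -natrM mulnb; congr (_%:R); congr nat_of_bool.
  apply/idP/idP => [/set_mem/andP[s0 sth]|/andP[/set_mem s0 /set_mem sth]].
    by rewrite !mem_set//= in_itv/= andbT -lte_fin.
  by rewrite mem_set// /T'/= sth andbT lte_fin; move: s0; rewrite /= in_itv/= andbT.
have [thoo|thfin] := eqVneq (th n.+1 w) +oo.
  rewrite (_ : T' = T)//; apply/seteqP; split => s; rewrite /T /T'/= thoo => /andP[-> _]/=.
    exact: ltry.
  exact: leey.
have thE : th n.+1 w = (fine (th n.+1 w))%:E.
  by rewrite fineK// ge0_fin_numE ?th_ge0// ltey.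
have TE : T = T' `\ fine (th n.+1 w).
  apply/seteqP; split => s; rewrite /T /T'/= thE !lte_fin lee_fin/=.
    by move=> /andP[-> sth]; rewrite ltW//; split => //; apply/eqP; rewrite lt_eqF.
  by move=> [/andP[-> sth] /eqP sn]; rewrite lt_neqAle sn.
by rewrite TE integral_setD1// -TE//; exact: measurable_funTS.
Qed.

Lemma integral_path_int_dead (F : S -> A -> \bar R) n w : ~ alive x n w ->
  \int[mu]_(t in [set t : R | (tn th n w <= t%:E < tn th n.+1 w)%E])
     path_int x th pol F w t = 0.
Proof.
move=> na; rewrite (_ : [set t | _] = set0) ?integral_set0//.
by apply/seteqP; split => // t /=; rewrite tn_dead// => /andP[]; rewrite leye_eq.
Qed.

End paths.

(** * Occupancy measures, and finiteness of holding times off S_2 *)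

Section continuous_time.
Local Open Scope ereal_scope.
Context {R : realType} (S A : ptopologicalType).
Notation mu := (@lebesgue_measure R).
Variables (q : S * A -> {charge set borel S -> \bar R})
  (qtm : S * A -> {measure set borel S -> \bar R}).
Hypotheses (HS : BorelSpace R S) (HA : BorelSpace R A)
  (Hq_meas : forall G : set (borel S), measurable G ->
     measurable_fun setT (fun z : borel S * borel A => q z G))
  (Hqtm : forall (z : S * A) (G : set (borel S)), measurable G ->
     qtm z G = q z (G `\ z.1))
  (Hq_cons : forall z : S * A, q z setT = 0%E)
  (Hq_bdd : forall x : S, exists M : R, forall a : A, (qx q x a <= M)%R)
  (C1c : continuous (fun z : S * A => qx q z.1 z.2)).
Variables (N : nat) (c : nat -> S * A -> R).
Hypotheses (Hc_meas : forall i, (i <= N)%N ->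
     measurable_fun setT (fun z : borel S * borel A => c i z))
  (Hc_ge0 : forall i z, (i <= N)%N -> (0 <= c i z)%R).
Variable (fstar : S -> A).
Hypotheses (Hfstar_meas : measurable_fun setT (fun x : borel S => (fstar x : borel A)))
  (Hfstar : forall x, S2 q c N x ->
     (\sum_(i < N.+1) c i (x, fstar x) + qx q x (fstar x) = 0)%R).
Variable (pol : ctpolicy R S A).
Hypothesis (Hpol : forall n (h : hist R S n) (s : R), (0 < s)%R -> S2 q c N (hlast h) ->
     forall C : set (borel A), measurable C ->
       pol n (h, s) C = \d_(fstar (hlast h) : borel A) C).
Context (dO : measure_display) (O : measurableType dO) (P : probability O R).
Variables (x : nat -> O -> Sinf (borel S)) (th : nat -> O -> \bar R)
  (gamma : probability (borel S) R).
Hypothesis (Hlaw : ct_law x th gamma q qtm pol P).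

Let mx n : measurable_fun setT (x n). Proof. by have [[]] := Hlaw. Qed.
Let mth n : measurable_fun setT (th n : O -> \bar R). Proof. by have [[]] := Hlaw. Qed.
Let x0 w : x 0 w <> None. Proof. by have [_ []] := Hlaw. Qed.
Let xth n w : [/\ 0 < th n.+1 w, th n.+1 w = +oo <-> x n.+1 w = None &
                      x n w = None -> th n.+1 w = +oo].
Proof. by have [_ [_]] := Hlaw. Qed.
Let lawt := let: And5 _ _ _ h _ := Hlaw in h.
Let lawx := let: And5 _ _ _ _ h := Hlaw in h.

Let qz (z : borel S * borel A) : \bar R := (qx q z.1 z.2)%:E.
Let nqz : nnmeas qz. Proof. exact: (nnmeas_qx HS HA Hqtm Hq_cons C1c). Qed.
Let q0 y a : (0 <= qx q y a)%R. Proof. exact: (qx_ge0 HS Hqtm Hq_cons). Qed.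

Let malive n : measurable (alive x n). Proof. exact: measurable_alive. Qed.
Let mhist n : measurable_fun setT (hist_of x th n).
Proof. exact: measurable_hist_of. Qed.

Definition rate n (z : hist R S n * R) : R := fine (policy_integral pol qz z).

Let Kq (y : S) : R := sval (cid (Hq_bdd y)).
Let KqP y a : (qx q y a <= Kq y)%R.
Proof. by rewrite /Kq; case: cid. Qed.

Lemma policy_integral_le n (f : borel S * borel A -> \bar R) (z : hist R S n * R) :
  nnmeas f -> (forall a, f (hlast z.1, a) <= (Kq (hlast z.1))%:E) ->
  0 <= policy_integral pol f z <= (Kq (hlast z.1))%:E.
Proof.
move=> [mf f0] fK; rewrite integral_ge0//=.
have K0 : 0 <= (Kq (hlast z.1))%:E by exact: le_trans (f0 _) (fK point).
rewrite -[leRHS]mule1 -(@prob_kernel _ _ _ _ _ (pol n) z) -integral_cst//.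
apply: ge0_le_integral => //.
exact: (measurable_fun_pair2 (hlast z.1 : borel S) mf).
Qed.

Lemma policy_integral_fin_num n (f : borel S * borel A -> \bar R) (z : hist R S n * R) :
  nnmeas f -> (forall a, f (hlast z.1, a) <= (Kq (hlast z.1))%:E) ->
  policy_integral pol f z \is a fin_num.
Proof.
move=> nf fK; have /andP[h0 hK] := policy_integral_le nf fK.
by rewrite ge0_fin_numE//; apply: le_lt_trans hK _; exact: ltry.
Qed.

Lemma rateE n z : (@rate n z)%:E = policy_integral pol qz z.
Proof. by rewrite fineK// policy_integral_fin_num// => a; rewrite lee_fin KqP. Qed.

Lemma rate_bound n h s : (0 <= @rate n (h, s) <= Kq (hlast h))%R.
Proof.
by rewrite -!lee_fin rateE; apply: policy_integral_le => // a; rewrite lee_fin KqP.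
Qed.

Lemma measurable_rate n : measurable_fun setT (@rate n).
Proof.
apply: (measurableT_comp (fine_measurable measurableT)).
by have [] := @nnmeas_policy_integral _ _ _ pol n _ nqz.
Qed.

Notation sv n := (survival (@rate n)).
Notation ho n := (hist_of x th n).

Lemma holding_law n (H : set (hist R S n)) (t : R) : measurable H -> (0 <= t)%R ->
  P (alive x n `&` ho n @^-1` H `&` [set w | t%:E <= th n.+1 w]) =
  \int[P]_(w in alive x n `&` ho n @^-1` H) (sv n (ho n w, t))%:E.
Proof.
move=> mH t0; rewrite lawt//; apply: eq_integral => w _.
rewrite /survival /hazard /cumulative_hazard/=.
have -> : \int[mu]_(s in [set s : R | (0 <= s <= t)%R])
    \int[pol n (ho n w, s)]_a (qx q (odflt point (x n w)) a)%:E =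
  \int[mu]_(s in `[0%R, t]) (@rate n (ho n w, s))%:E.
  rewrite set_itvcc; apply: eq_integral => s _; rewrite rateE /policy_integral/=.
  by rewrite hlast_hist_of.
rewrite -[X in expeR (- X)]fineK//.
apply: integral_itv_fin_num t0; last by move=> s; exact: rate_bound.
by apply: (measurableT_comp (@measurable_rate n)); exact: pair1_measurable.
Qed.

Let th0 n w : 0 < th n.+1 w. Proof. by have [] := xth n w. Qed.

Let surv n := occupation_survival (@malive n) (@mhist n) (@mth n.+1) (@measurable_rate n)
  (@rate_bound n) (@holding_law n).
Let jump n := integral_jump (@malive n) (@mhist n) (@mth n.+1) (@th0 n) (@measurable_rate n)
  (@rate_bound n) (@holding_law n).

(* The integral of [f] against the n-th occupancy measure, with the holding time integrated out:
   the state is still occupied at time [s] with conditional probability [sv n (ho n w, s)]. *)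
Definition occ n (f : borel S * borel A -> \bar R) : \bar R :=
  \int[P]_(w in alive x n) \int[mu]_(s in `]0%R, +oo[)
    ((sv n (ho n w, s))%:E * policy_integral pol (fun z => qz z * f z) (ho n w, s)).

Let msv n : measurable_fun setT (sv n).
Proof. exact: (measurable_survival (@measurable_rate n) (@rate_bound n)). Qed.

Let sv0 n z : (0 <= sv n z)%R. Proof. exact: survival_ge0. Qed.

Let nqf f : nnmeas f -> nnmeas (fun z => qz z * f z).
Proof. by move=> nf; exact: nnmeasM. Qed.

Lemma integral_functional_occ n : integral_functional (occ n).
Proof.
apply: (@integral_functional_comp _ _ _ _ _
  (fun f : hist R S n * R -> \bar R => \int[P]_(w in alive x n) \int[mu]_(s in `]0%R, +oo[)
    ((sv n (ho n w, s))%:E * f (ho n w, s)))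
  (fun f => policy_integral pol (fun z => qz z * f z))).
- exact: (integral_functional_path P (@malive n) (@mhist n) (measurable_itv _) (@msv n) (@sv0 n)).
- move=> z; apply: (@integral_functional_comp _ _ _ _ _ _
    (fun (f : borel S * borel A -> \bar R) a => qz (hlast z.1 : borel S, a) * f (hlast z.1 : borel S, a))).
  + exact: integral_functional_integral.
  + by move=> a; apply: integral_functionalZ => //; exact: integral_functional_eval.
  + move=> f nf; have [m _] := nqf nf.
    exact: (measurable_fun_pair2 (hlast z.1 : borel S) m).
- by move=> f /nqf nf; have [] := @nnmeas_policy_integral _ _ _ pol n _ nf.
Qed.

Lemma ct_occE n (GS : set (borel S)) (GA : set (borel A)) :
  measurable GS -> measurable GA ->
  ct_occ x th P q pol n GS GA = occ n (fun z => (\1_(GS `*` GA) z)%:E).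
Proof.
move=> mGS mGA.
pose F (y : S) (a : A) : \bar R := (\1_GS y * \1_GA a * qx q y a)%:E.
rewrite (_ : ct_occ _ _ _ _ _ _ _ _ = \int[P]_w
  \int[mu]_(t in [set t : R | (tn th n w <= t%:E < tn th n.+1 w)%E])
    path_int x th pol F w t)// /occ.
have FE : (fun z : borel S * borel A => F z.1 z.2) = fun z => qz z * (\1_(GS `*` GA) z)%:E.
  by apply/funext => z; rewrite /F /qz indic_setX -EFinM mulrC.
have nF : nnmeas (fun z : borel S * borel A => F z.1 z.2).
  by rewrite FE; apply: nqf; apply: nnmeas_indic; exact: measurableX.
rewrite -FE -surv; last exact: nnmeas_policy_integral.
rewrite [RHS]integral_mkcond; apply: eq_integral => w _; rewrite patchE.
case: ifPn => [/set_mem aw|/negP aw]; first exact: integral_path_int.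
by rewrite integral_path_int_dead// => aw'; apply: aw; rewrite mem_set.
Qed.

Lemma nnmeas_qtm' G : measurable G -> nnmeas (fun z : borel S * borel A => qtm z G).
Proof. exact: (nnmeas_qtm HS HA Hq_meas Hqtm C1c). Qed.

(** The jump law is the quotient of the averages of [qtm] and of the rate, and the density of the
    holding time has the rate as a factor; the product leaves the average of [qtm], which is q_x
    times p. *)
Lemma occ_next n (G : set (borel S)) : measurable G ->
  P (x n.+1 @^-1` (Some @` G)) = occ n (fun z => (pS q qtm z.1 z.2 G)%:E).
Proof.
move=> mG; have nq := nnmeas_qtm' mG.
have qle a y : qtm (y, a) G <= (Kq y)%:E.
  apply: le_trans (qtm_le HS Hqtm Hq_cons _ mG) _.
  by rewrite lee_fin KqP.
pose phi (z : hist R S n * R) : \bar R :=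
  (fine (policy_integral pol (fun z => qtm z G) z) / @rate n z)%:E.
have nphi : nnmeas phi.
  split; last first.
    by move=> z; rewrite lee_fin divr_ge0// fine_ge0// integral_ge0// => a _; rewrite lee_fin.
  apply/measurable_EFinP; apply: measurable_funM.
    apply: (measurableT_comp (fine_measurable measurableT)).
    by have [] := @nnmeas_policy_integral _ _ _ pol n _ nq.
  exact: (measurableT_comp measurable_inv (@measurable_rate n)).
transitivity (\int[P]_(w in alive x n `&` [set w | th n.+1 w < +oo])
    phi (ho n w, fine (th n.+1 w))).
  have := @lawx n setT setT G measurableT measurableT mG.
  rewrite preimage_setT setIT.
  have -> : alive x n `&` th n.+1 @^-1` (EFin @` setT) =
      alive x n `&` [set w | th n.+1 w < +oo].
    apply/seteqP; split => w [aw]; first by move=> [r _ /= rE]; split => //=; rewrite -rE ltry.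
    move=> /= thoo; split => //; exists (fine (th n.+1 w)) => //.
    by rewrite fineK// ge0_fin_numE// ltW.
  (* A state x_{n+1} in S forces stage n to be reached and the holding time to be finite, so the
     conditioning event is automatic. *)
  have -> : alive x n `&` [set w | th n.+1 w < +oo] `&` x n.+1 @^-1` (Some @` G) =
      x n.+1 @^-1` (Some @` G).
    apply/setIidPr => w [y Gy /= yE].
    by apply/(aliveS xth); rewrite /alive/= -yE.
  move=> ->; apply: eq_integral => w _.
  by rewrite /phi /rate /policy_integral/= hlast_hist_of.
rewrite jump// /occ; apply: eq_integral => w _; apply: eq_integral => s _.
rewrite mulrC EFinM -muleA; congr (_ * _); rewrite /phi -EFinM.
set z := (ho n w, s).
have -> : policy_integral pol (fun z => qz z * (pS q qtm z.1 z.2 G)%:E) z =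
          policy_integral pol (fun z => qtm z G) z.
  apply: eq_integral => a _; rewrite /qz -EFinM mulrC.
  exact: (pS_qx HS Hqtm Hq_cons _ mG).
have pfin : policy_integral pol (fun z => qtm z G) z \is a fin_num.
  by apply: policy_integral_fin_num => // a; exact: qle.
(* At rate 0 the quotient is 0 by convention, and the average of [qtm], bounded by the rate, is 0
   too. *)
have [r0|r0] := eqVneq (rate z) 0%R; last first.
  by rewrite mulrCA mulfV// mulr1 fineK.
rewrite r0 mul0r; apply/esym/eqP; rewrite eq_le integral_ge0// andbT.
rewrite -r0 rateE; apply: ge0_le_integral => //.
- exact: (measurable_fun_pair2 (hlast z.1 : borel S) nq.1).
- exact: (measurable_fun_pair2 (hlast z.1 : borel S) nqz.1).
- by move=> a _; exact: (qtm_le HS Hqtm Hq_cons _ mG).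
Qed.

(** This is [integral_jump] for a function of x_n alone: the factor [rate] in the density is the
    integral of q_x over actions that [occ] performs. *)
Lemma occ_marginal n (E : set (borel S)) : measurable E ->
  occ n (fun z => (\1_(E `*` [set: borel A]) z)%:E) =
  P (alive x n `&` [set w | E (odflt point (x n w))] `&` [set w | th n.+1 w < +oo]).
Proof.
move=> mE.
pose f (z : hist R S n * R) : \bar R := (\1_E (hlast z.1 : borel S))%:E.
have nf : nnmeas f.
  apply: (nnmeas_comp (nnmeas_indic mE)).
  by apply: (measurableT_comp (@measurable_hlast _ _ n)).
transitivity (\int[P]_(w in alive x n `&` [set w | th n.+1 w < +oo])
    f (ho n w, fine (th n.+1 w))).
  rewrite jump// /occ; apply: eq_integral => w _; apply: eq_integral => s _.
  rewrite mulrC EFinM -muleA; congr (_ * _); rewrite rateE /f /policy_integral/= muleC.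
  rewrite -ge0_integralZl_EFin//; last 2 first.
  - by move=> a _; rewrite lee_fin.
  - exact: (measurable_fun_pair2 (hlast (ho n w) : borel S) nqz.1).
  by apply: eq_integral => a _; rewrite indic_setX/= indicT mulr1 muleC.
have mEx : measurable [set w | E (odflt point (x n w))].
  rewrite -[X in measurable X]setTI.
  exact: (measurableT_comp (measurable_odflt (point : borel S)) (@mx n)).
rewrite (_ : (fun w => _) = fun w => (\1_[set w | E (odflt point (x n w))] w)%:E); last first.
  by apply/funext => w; rewrite /f/= hlast_hist_of.
rewrite integral_indic//; last first.
  by apply: measurableI => //; rewrite -[X in measurable X]setTI; exact: measurable_lte.
by congr (P _); rewrite setIA (setIC _ (alive x n)).
Qed.

(** The infimum over A is replaced by an equation for [fstar], from which measurability of S_2 is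
    immediate. *)
Lemma S2E : S2 q c N =
  [set y | (\sum_(i < N.+1) c i (y, fstar y) + qx q y (fstar y) = 0)%R].
Proof.
apply/seteqP; split => y; first exact: Hfstar.
move=> /= h; rewrite /S2/=; apply/eqP; rewrite eq_le; apply/andP; split.
  by apply: ereal_inf_lbound; exists (fstar y) => //; rewrite addrC h.
apply: le_ereal_inf_tmp => _ [a _ <-]; rewrite lee_fin addr_ge0// sumr_ge0// => i _.
by apply: Hc_ge0; rewrite -ltnS.
Qed.

Lemma measurable_S2 : measurable (S2 q c N : set (borel S)).
Proof.
rewrite S2E -[X in measurable X]setTI.
have mp : measurable_fun setT (fun y : borel S => (y, fstar y) : borel S * borel A).
  exact: measurable_fun_pair.
pose F (y : borel S) : R := (\sum_(i < N.+1) c i (y, fstar y) + qx q y (fstar y))%R.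
suff mF : measurable_fun setT F by exact: (mF measurableT [set 0%R]).
apply: measurable_funD; last exact: (measurableT_comp (measurable_qx HS HA C1c) mp).
apply: measurable_sum => i; apply: (measurableT_comp _ mp); apply: Hc_meas.
by rewrite -ltnS.
Qed.

Lemma qx_S2 y : S2 q c N y -> qx q y (fstar y) = 0%R.
Proof.
move=> /Hfstar; move/eqP; rewrite paddr_eq0// => [/andP[_ /eqP//]|].
by rewrite sumr_ge0// => i _; apply: Hc_ge0; rewrite -ltnS.
Qed.

(** The policy is prescribed on S_2 only for positive elapsed time, hence the condition on z.2; the
    integrals in [occ] run over s > 0. *)
Lemma policy_integral_S2 n f (z : hist R S n * R) : nnmeas f -> (0 < z.2)%R ->
  S2 q c N (hlast z.1) -> policy_integral pol (fun z => qz z * f z) z = 0.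
Proof.
move=> nf z2 zS; rewrite /policy_integral.
rewrite (@eq_measure_integral _ _ _ _ (\d_(fstar (hlast z.1) : borel A))); last first.
  by move=> C mC _; case: z z2 zS => h s /= *; exact: Hpol.
rewrite integral_dirac//; last exact: (measurable_fun_pair2 (hlast z.1 : borel S) (nqf nf).1).
by rewrite /qz/= qx_S2// mul0e mule0.
Qed.

Lemma occ_off_S2 n (f g : borel S * borel A -> \bar R) : nnmeas f -> nnmeas g ->
  (forall z : borel S * borel A, ~ S2 q c N z.1 -> f z = g z) -> occ n f = occ n g.
Proof.
move=> nf ng fg; apply: eq_integral => w _; apply: eq_integral => s.
rewrite inE/= in_itv/= andbT => s0; congr (_ * _).
have [zS|zS] := pselect (S2 q c N (hlast (ho n w))).
  by rewrite !policy_integral_S2.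
by apply: eq_integral => a _; rewrite fg.
Qed.

Hypothesis (Hcost : forall i, (i <= N)%N ->
  ct_cost x th P pol (fun y a => (c i (y, a))%:E) < +oo).

Let ci i (z : borel S * borel A) : \bar R := (c i z)%:E.

Let nci i : (i <= N)%N -> nnmeas (ci i).
Proof.
move=> iN; split; first by apply/measurable_EFinP; exact: Hc_meas.
by move=> z; rewrite lee_fin Hc_ge0.
Qed.

(** The holding time is not integrated out here, since finiteness of the cost is needed on
    individual paths where that time is infinite. *)
Let stage_cost n i w := \int[mu]_(s in `]0%R, +oo[)
  ((\1_[set s : R | (s%:E <= th n.+1 w)%E] s)%:E * policy_integral pol (ci i) (ho n w, s)).

Lemma nnmeas_stage_cost n i : (i <= N)%N -> nnmeas (stage_cost n i).
Proof.
move=> iN; have nc := @nnmeas_policy_integral _ _ _ pol n _ (nci iN).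
have nF : nnmeas (fun z : O * R => (\1_[set z : O * R | (z.2%:E <= th n.+1 z.1)%E] z)%:E *
    policy_integral pol (ci i) (ho n z.1, z.2)).
  apply: nnmeasM.
    apply: nnmeas_indic; rewrite -[X in measurable X]setTI.
    apply: measurable_lee => //; first exact/measurable_EFinP.
    exact: (measurableT_comp (@mth n.+1)).
  apply: (nnmeas_comp nc); apply: measurable_fun_pair => //.
  exact: (measurableT_comp (@mhist n)).
split; first exact: (measurable_integral_snd (measurable_itv _) nF).
by move=> w; apply: integral_ge0 => s _; exact: (nF.2 (w, s)).
Qed.

(** The cost of one stage is at most that of the whole path, whose expectation is finite. *)
Lemma stage_cost_ae n : {ae P, forall w, forall i, (i <= N)%N -> alive x n w ->
  stage_cost n i w < +oo}.
Proof.
apply: ae_foralln => i; have [iN|iN] := boolP (i <= N)%N; last first.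
  by apply: filterS filterT => w _.
have [mW W0] := @nnmeas_stage_cost n i iN.
have Wi : P.-integrable (alive x n) (stage_cost n i).
  apply/integrableP; split; first exact: measurable_funTS.
  apply: le_lt_trans (Hcost iN).
  rewrite /ct_cost [leLHS]integral_mkcond; apply: le_ge0_integral => w _.
    by rewrite patchE; case: ifP.
  have p0 t : 0 <= path_int x th pol (fun y a => (c i (y, a))%:E) w t.
    by apply: path_int_ge0 => y a; rewrite lee_fin Hc_ge0.
  rewrite patchE; case: ifPn => [/set_mem aw|_]; last by apply: integral_ge0.
  rewrite gee0_abs// /stage_cost.
  have := @integral_path_int _ _ _ _ _ x th xth pol (fun y a => (c i (y, a))%:E) n w _ aw.
  rewrite (_ : (fun z => _) = ci i); last by apply/funext => -[].
  move=> <-; last exact: nci.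
  apply: ge0_subset_integral_nm => // t /= /andP[+ _].
  by rewrite -lee_fin; apply: le_trans; exact: (tn_ge0 xth).
have := integrable_ae (@malive n) Wi; apply: filterS => w h _ aw.
by have := h aw; rewrite ge0_fin_numE.
Qed.

(** The gap is the infimum defining S_2 itself: nonnegative, nonzero, and finite because A has a
    point. *)
Lemma S2_gap y : ~ S2 q c N y -> exists2 e : R, (0 < e)%R &
  forall a, (e <= qx q y a + \sum_(i < N.+1) c i (y, a))%R.
Proof.
move=> nS.
have pos : 0 < ereal_inf [set ((qx q y a + \sum_(i < N.+1) c i (y, a))%R)%:E | a in [set: A]].
  rewrite lt_neqAle; apply/andP; split; first by apply/eqP => /esym.
  apply: le_ereal_inf_tmp => _ [a _ <-]; rewrite lee_fin addr_ge0// sumr_ge0// => i _.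
  by apply: Hc_ge0; rewrite -ltnS.
have inf_le a : ereal_inf [set ((qx q y a + \sum_(i < N.+1) c i (y, a))%R)%:E | a in [set: A]]
   <= (qx q y a + \sum_(i < N.+1) c i (y, a))%:E.
  by apply: ereal_inf_lbound; exists a.
have fin : ereal_inf [set ((qx q y a + \sum_(i < N.+1) c i (y, a))%R)%:E | a in [set: A]] \is a fin_num.
  by rewrite ge0_fin_numE ?ltW// (le_lt_trans (inf_le point))// ltry.
exists (fine (ereal_inf [set ((qx q y a + \sum_(i < N.+1) c i (y, a))%R)%:E | a in [set: A]])).
  by rewrite fine_gt0// pos ltey_eq fin.
by move=> a; rewrite -lee_fin fineK.
Qed.

(** Over an infinite holding time the total hazard plus the stage costs is at least the integral of
    the gap over ]0,+oo[, hence infinite; the costs being finite, the hazard is not. *)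
Lemma hazard_diverges n w : ~ S2 q c N (odflt point (x n w)) -> th n.+1 w = +oo ->
  (forall i, (i <= N)%N -> stage_cost n i w < +oo) ->
  \int[mu]_(s in `]0%R, +oo[) (@rate n (ho n w, s))%:E = +oo.
Proof.
move=> nS thoo Woo; have [e e0 eq] := S2_gap nS.
have np f : nnmeas f -> nnmeas (fun s : R => policy_integral pol f (ho n w, s)).
  move=> nf; have := @nnmeas_policy_integral _ _ _ pol n _ nf.
  exact: (@nnmeas_pair R _ _ _ _ _ (ho n w)).
apply/eqP; rewrite -leye_eq leNgt; apply/negP => roo.
have Wsum : \sum_(i < N.+1) stage_cost n i w < +oo.
  by apply: lte_sum_pinfty => i _; apply: Woo; rewrite -ltnS.
suff : +oo <= \int[mu]_(s in `]0%R, +oo[) (@rate n (ho n w, s))%:E +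
    \sum_(i < N.+1) stage_cost n i w.
  by rewrite leye_eq => /eqP h; have := lte_add_pinfty roo Wsum; rewrite h ltxx.
have -> : \sum_(i < N.+1) stage_cost n i w =
    \int[mu]_(s in `]0%R, +oo[) \sum_(i < N.+1) policy_integral pol (ci i) (ho n w, s).
  rewrite ge0_integral_sum//.
  - apply: eq_bigr => i _; apply: eq_integral => s _.
    by rewrite indicE mem_set/= ?mul1e// thoo leey.
  - move=> i; apply: measurable_funTS; apply: (np _ _).1; apply: nci; by rewrite -ltnS.
  - by move=> i s _; apply: (np _ _).2; apply: nci; rewrite -ltnS.
rewrite -ge0_integralD//; last 4 first.
- by move=> s _; rewrite rateE; exact: (np _ nqz).2.
- apply: measurable_funTS; under eq_fun do rewrite rateE; exact: (np _ nqz).1.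
- by move=> s _; apply: sume_ge0 => i _; apply: (np _ _).2; apply: nci; rewrite -ltnS.
- apply: measurable_funTS; apply: emeasurable_sum => i; apply: (np _ _).1; apply: nci; by rewrite -ltnS.
have -> : +oo = \int[mu]_(s in `]0%R, +oo[) (e%:E : \bar R).
  transitivity (e%:E * mu `]0%R, +oo[); last by rewrite -integral_cst.
  by rewrite lebesgue_measure_itv/= ltry/= gt0_muley.
apply: le_ge0_integral => s _; first by rewrite lee_fin ltW.
rewrite rateE /policy_integral/= hlast_hist_of.
rewrite -ge0_integral_sum//; last 2 first.
- move=> i; apply: (measurable_fun_pair2 (odflt point (x n w) : borel S) (nci _).1).
  by rewrite -ltnS.
- by move=> i a _; apply: (nci _).2; rewrite -ltnS.
rewrite -ge0_integralD//; last 4 first.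
- by move=> a _; rewrite lee_fin.
- exact: (measurable_fun_pair2 (odflt point (x n w) : borel S) nqz.1).
- by move=> a _; apply: sume_ge0 => i _; apply: (nci _).2; rewrite -ltnS.
- apply: emeasurable_sum => i.
  apply: (measurable_fun_pair2 (odflt point (x n w) : borel S) (nci _).1); by rewrite -ltnS.
rewrite -[leLHS]mule1 -(@prob_kernel _ _ _ _ _ (pol n) (ho n w, s)) -integral_cst//.
apply: le_ge0_integral => a _; first by rewrite lee_fin ltW.
by rewrite /qz /ci/= sumEFin -EFinD lee_fin.
Qed.

Lemma survival_cvg0 n (h : hist R S n) :
  \int[mu]_(s in `]0%R, +oo[) (@rate n (h, s))%:E = +oo ->
  (sv n (h, k%:R))%:E @[k --> \oo] --> 0.
Proof.
move=> hoo.
have mr : measurable_fun setT (fun s => (@rate n (h, s))%:E).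
  apply/measurable_EFinP; apply: (@measurable_fun_pair2 _ _ _ _ _ _ (@rate n) h).
  exact: measurable_rate.
have r0 s : 0 <= (@rate n (h, s))%:E by rewrite lee_fin; have /andP[] := rate_bound h s.
have : (hazard (@rate n) (h, k%:R))%:E @[k --> \oo] --> +oo.
  rewrite -hoo integral_itv_obnd_cbnd; last exact: measurable_funTS.
  rewrite (_ : `[0%R, +oo[%classic = \bigcup_k `[0%R, k%:R]%classic); last first.
    apply/seteqP; split => s /=.
      rewrite in_itv/= andbT => s0; exists (Num.trunc s).+1 => //=.
      by rewrite in_itv/= s0 ltW// truncnS_gt.
    by move=> [k _ /=]; rewrite !in_itv/= => /andP[->].
  have := @ge0_nondecreasing_set_cvg_integral _ (measurableTypeR R) R
    (fun k : nat => `[0%R, (k%:R : R)]%classic)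
    (fun s => (@rate n (h, s))%:E) mu.
  rewrite (_ : (fun k => (hazard _ _)%:E) = fun k => \int[mu]_(s in `[0%R, k%:R]) (@rate n (h, s))%:E).
    apply=> //.
    - apply/nondecreasing_seqP => k; apply/subsetPset => s /=; rewrite !in_itv/=.
      by move=> /andP[-> sk]/=; rewrite (le_trans sk)// ler_nat.
    - by move=> k; exact: measurable_funTS.
  apply/funext => k; rewrite /hazard /cumulative_hazard fineK//.
  apply: (@integral_itv_fin_num _ _ (Kq (hlast h))) => //; first exact/measurable_EFinP.
  by move=> s; exact: rate_bound.
move=> /cvgeryP hz; apply/cvg_EFin; first by apply: nearW.
exact: (cvg_comp _ _ hz (@cvgr_expR R)).
Qed.

(** With infinite total hazard, P(theta >= k) is the mean of e^{-L(k)}, which tends to 0. With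
    finite total hazard, an infinite holding time would by [hazard_diverges] require an infinite
    stage cost, which is excluded almost surely. *)
Lemma holding_finite n :
  P.-negligible (alive x n `&` [set w | ~ S2 q c N (odflt point (x n w))] `&`
    [set w | th n.+1 w = +oo]).
Proof.
pose H := [set h : hist R S n | \int[mu]_(s in `]0%R, +oo[) (@rate n (h, s))%:E = +oo].
have mH : measurable H.
  have : measurable_fun setT (fun h : hist R S n => \int[mu]_(s in `]0%R, +oo[) (@rate n (h, s))%:E).
    apply: (@measurable_integral_snd _ _ _ _ (fun z => (@rate n z)%:E)) => //.
    split; first by apply/measurable_EFinP; exact: measurable_rate.
    by move=> [h s]; rewrite lee_fin; have /andP[] := rate_bound h s.
  by move=> /(_ measurableT _ (emeasurable_set1 +oo)); rewrite setTI.
have mDH : measurable (alive x n `&` ho n @^-1` H).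
  by apply: measurableI => //; rewrite -[X in measurable X]setTI; exact: (@mhist n).
have mthoo : measurable [set w | th n.+1 w = +oo].
  by rewrite -[X in measurable X]setTI; exact: (@mth n.+1 measurableT [set +oo]).
have N2 : P (alive x n `&` ho n @^-1` H `&` [set w | th n.+1 w = +oo]) = 0.
  apply/eqP; rewrite eq_le measure_ge0 andbT.
  have msvk (k : nat) : measurable_fun setT (fun w => (sv n (ho n w, k%:R))%:E).
    apply/measurable_EFinP; apply: (measurableT_comp (@msv n)).
    by apply: measurable_fun_pair; [exact: (@mhist n)|exact: measurable_cst].
  have i1 : P.-integrable (alive x n `&` ho n @^-1` H) (cst 1).
    apply/integrableP; split => //.
    rewrite (eq_integral (cst 1)) => [|w _]; last by rewrite gee0_abs//; exact: lee01.
    by rewrite integral_cst// mul1e (le_lt_trans (probability_le1 P _))// ltry.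
  have cv0 : {ae P, forall w, (alive x n `&` ho n @^-1` H) w ->
      (sv n (ho n w, k%:R))%:E @[k --> \oo] --> cst 0 w}.
    by apply: aeW => w [_ Hw]; exact: survival_cvg0.
  have bd : {ae P, forall w, forall k, (alive x n `&` ho n @^-1` H) w ->
      `|(sv n (ho n w, k%:R))%:E| <= cst 1 w}.
    apply: aeW => w k _; rewrite gee0_abs ?lee_fin ?sv0//.
    exact: (survival_le1 (@rate_bound n)).
  have [_ _] := dominated_convergence mDH (fun k => measurable_funTS (msvk k))
    (measurable_cst _) cv0 i1 bd.
  rewrite integral0 => cv; rewrite -(cvg_lim _ cv)//; apply: lime_ge.
    by apply/cvg_ex; exists 0.
  apply: nearW => k /=; rewrite -holding_law//; apply: le_measure; rewrite ?inE.
  - exact: measurableI.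
  - apply: measurableI => //; rewrite -[X in measurable X]setTI.
    exact: measurable_lee.
  - by move=> w [? /= thoo]; split => //=; rewrite thoo leey.
have := stage_cost_ae n; rewrite /almost_everywhere => N1.
apply: negligibleS (negligibleU N1 (_ : P.-negligible (alive x n `&` ho n @^-1` H `&` [set w | th n.+1 w = +oo]))).
  move=> w [[aw nS] thoo].
  have [ok|bad] := pselect (forall i, (i <= N)%N -> stage_cost n i w < +oo).
    by right; split => //; split => //; exact: hazard_diverges.
  by left => /= h; apply: bad => i iN; exact: h.
by apply/negligibleP => //; exact: measurableI.
Qed.

Lemma occ_marginal_off_S2 n (E : set (borel S)) : measurable E ->
  E `<=` ~` S2 q c N ->
  occ n (fun z => (\1_(E `*` [set: borel A]) z)%:E) = P (x n @^-1` (Some @` E)).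
Proof.
move=> mE ES; rewrite occ_marginal//.
have mX : measurable (x n @^-1` (Some @` E)).
  by rewrite -[X in measurable X]setTI; apply: (@mx n) => //; exact: measurable_Sinf_image.
have mthoo : measurable [set w | th n.+1 w = +oo].
  by rewrite -[X in measurable X]setTI; exact: (@mth n.+1 measurableT [set +oo]).
have -> : alive x n `&` [set w | E (odflt point (x n w))] = x n @^-1` (Some @` E).
  apply/seteqP; split => w; rewrite /alive/=.
    by case: (x n w) => [y|] [// _ Ey]; exists y.
  by move=> [y Ey <-].
have -> : [set w | th n.+1 w < +oo] = ~` [set w | th n.+1 w = +oo].
  by apply/seteqP; split => w /=; rewrite ltey => /eqP.
have null : P (x n @^-1` (Some @` E) `&` [set w | th n.+1 w = +oo]) = 0.
  apply/negligibleP; first exact: measurableI.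
  apply: negligibleS (holding_finite n) => w [[y Ey yE] thoo]; split => //; split.
    by rewrite /alive/= -yE.
  by rewrite /= -yE/=; exact: ES.
rewrite -setDE measureD//; first by rewrite [X in _ - X]null sube0.
by rewrite ltey_eq fin_num_measure.
Qed.

End continuous_time.

(** * The discrete-time model *)

Section discrete_time.
Local Open Scope ereal_scope.
Context {R : realType} (S A : ptopologicalType).
Notation mu := (@lebesgue_measure R).

Definition dhlast n (h : dhist S A n) : Sinf (borel S) :=
  last h.1 [seq p.2 | p <- (h.2 : seq _)].

Lemma dhlast_recr n (h : dhist S A n.+1) : dhlast h = (tnth h.2 ord_max).2.
Proof.
rewrite /dhlast (last_nth None) size_map size_tuple/=.
rewrite (nth_map ((point : borel A), (None : Sinf (borel S)))); last by rewrite size_tuple.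
by rewrite (tnth_nth ((point : borel A), (None : Sinf (borel S)))).
Qed.

Lemma measurable_dhlast n : measurable_fun setT (@dhlast n).
Proof.
case: n => [|n].
  rewrite (_ : @dhlast 0 = fst); first exact: measurable_fst.
  by apply/funext => -[y t]; rewrite /dhlast/= (tuple0 t).
rewrite (_ : @dhlast n.+1 = fun h => (tnth h.2 ord_max).2); last first.
  by apply/funext => h; exact: dhlast_recr.
apply: (measurableT_comp measurable_snd).
apply: (measurableT_comp (measurable_tnth ord_max)); exact: measurable_snd.
Qed.

Lemma dhlast_dhist_of d (Om : measurableType d) (X : nat -> Om -> Sinf (borel S))
  (Ac : nat -> Om -> borel A) n w : dhlast (dhist_of X Ac n w) = X n w.
Proof.
case: n => [|n]; last by rewrite dhlast_recr tnth_mktuple.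
by rewrite /dhlast (tuple0 (dhist_of X Ac 0 w).2).
Qed.

Lemma Sinf_preimage (Om : Type) (X : Om -> Sinf (borel S)) (E B : set (borel S)) :
  X @^-1` (Some @` (E `&` B)) =
  [set w | B (odflt point (X w))] `&` X @^-1` (Some @` E).
Proof.
apply/seteqP; split => w /=; first by move=> [y [Ey By] <-]; split => //; exists y.
by move=> [By [y Ey yE]]; exists y => //; split => //; rewrite -yE in By.
Qed.

(** The continuous-time side enters only through the measures [M n], the laws [m n] and the
    recursion linking them, with Z for S_2. Once X_n has law [m n], disintegration gives its joint
    law with the action off Z, and integrating the transition probability gives the law of
    X_{n+1}. *)
Lemma markov_realization (gamma : probability (borel S) R)
  (q : S * A -> {charge set borel S -> \bar R})
  (qtm : S * A -> {measure set borel S -> \bar R})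
  (Z : set (borel S)) (fstar : S -> A)
  (M : nat -> {measure set (borel S * borel A) -> \bar R})
  (m : nat -> set (borel S) -> \bar R) :
  BorelSpace R A -> measurable Z ->
  measurable_fun setT (fun x : borel S => (fstar x : borel A)) ->
  (forall G : set (borel S), measurable G ->
    nnmeas (fun z : borel S * borel A => (pS q qtm z.1 z.2 G)%:E)) ->
  (forall y, Z y -> qx q y (fstar y) = 0%R) ->
  (forall n, M n setT < +oo) -> (forall n, M n (Z `*` setT) = 0) ->
  (forall n (E : set (borel S)), measurable E -> E `<=` ~` Z -> M n (E `*` setT) = m n E) ->
  (forall G, measurable G -> m 0%N G = gamma G) ->
  (forall n G, measurable G ->
     m n.+1 G = \int[M n]_z (pS q qtm z.1 z.2 G)%:E) ->
  exists sig : nat -> R.-pker Sinf (borel S) ~> borel A,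
    (forall n (y : S), Z y -> forall C : set (borel A), measurable C ->
        sig n (Some y) C = \d_(fstar y : borel A) C) /\
    (forall (dQ : measure_display) (Om : measurableType dQ) (Q : probability Om R)
            (X : nat -> Om -> Sinf (borel S)) (Ac : nat -> Om -> borel A),
       dt_law X Ac gamma q qtm sig Q ->
       forall (n : nat) (GS : set (borel S)) (GA : set (borel A)),
         measurable GS -> GS `<=` ~` Z -> measurable GA ->
         M n (GS `*` GA) = Q (X n @^-1` (Some @` GS) `&` Ac n.+1 @^-1` GA)).
Proof.
move=> HA mZ mfs npS qfs Moo MZ Mm m0 mS.
have [G GP] := choice (fun n => disintegration HA (Moo n)).
have mG n : measurable_fun setT (G n) by have [] := GP n.
have GE n E C : measurable E -> measurable C -> M n (E `*` C) =
    \int[M n]_(z in E `*` setT) uniform_image (@mG n) z.1 C.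
  by have [_] := GP n; apply.
pose od : Sinf (borel S) -> borel S := odflt point.
have mod : measurable_fun setT od := measurable_odflt _.
(* The policy is the image of a uniform variable under [H]. At x_oo the state defaults to [point],
   an arbitrary choice. *)
pose H n (p : Sinf (borel S) * R) : borel A :=
  if `[<Z (od p.1)>] then fstar (od p.1) else G n (od p.1, p.2).
have mH n : measurable_fun setT (H n).
  have modp : measurable_fun setT (fun p : Sinf (borel S) * R => od p.1).
    exact: (measurableT_comp mod measurable_fst).
  apply: measurable_fun_ifT.
  - apply: (measurable_fun_bool true); rewrite setTI.
    rewrite (_ : _ @^-1` _ = (fun p : Sinf (borel S) * R => od p.1) @^-1` Z).
      by rewrite -[X in measurable X]setTI; exact: modp.
    by apply/seteqP; split => p /= /asboolP.
  - exact: (measurableT_comp mfs modp).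
  - apply: (measurableT_comp (@mG n)); exact: measurable_fun_pair.
have sigZ n (y : option S) C : Z (od y) ->
    uniform_image (@mH n) y C = (\1_C (fstar (od y) : borel A))%:E.
  move=> Zy; rewrite /uniform_image.
  rewrite (_ : [set u | _] = [set u : R | C (fstar (od y))]); last first.
    by apply/seteqP; split => u; rewrite /H/= asboolT.
  rewrite indicE; case: (boolP (_ \in C)) => hC.
    rewrite (_ : [set u : R | _] = setT) ?setIT; last first.
      by apply/seteqP; split => // u _; exact: set_mem.
    by rewrite lebesgue_measure_itv/= lte_fin ltr01 -EFinB subr0.
  rewrite (_ : [set u : R | _] = set0) ?setI0 ?measure0//.
  by apply/seteqP; split => // u /= hu; move: hC; rewrite mem_set.
have sigN n (y : option S) C : ~ Z (od y) ->
    uniform_image (@mH n) y C = uniform_image (@mG n) (od y) C.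
  move=> Zy; congr (mu (_ `&` _)).
  by apply/seteqP; split => u; rewrite /H/= asboolF.
exists (fun n => uniform_image_pker (@mH n)); split.
  by move=> n y Zy C mC; rewrite /= [LHS](sigZ n (Some y))// diracE indicE.
move=> dQ Om Q X Ac [[mX mAc] Q0 Q1 Q2].
have mXE n (E : set (borel S)) : measurable E -> measurable (X n @^-1` (Some @` E)).
  move=> mE; rewrite -[Y in measurable Y]setTI; apply: (mX n) => //.
  exact: measurable_Sinf_image.
have mAE n C : measurable C -> measurable (Ac n @^-1` C).
  by move=> mC; rewrite -[Y in measurable Y]setTI; exact: (mAc n).
have modX n : measurable_fun setT (fun w => od (X n w)).
  exact: (measurableT_comp mod (@mX n)).
have modXE n B : measurable B -> measurable [set w | B (od (X n w))].
  by move=> mB; rewrite -[Y in measurable Y]setTI; exact: (@modX n).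
have modA n : measurable_fun setT (fun w => (od (X n w), Ac n.+1 w)).
  by apply: measurable_fun_pair; [exact: modX|exact: mAc].
have step n (E : set (borel S)) C : measurable E -> measurable C ->
    Q (X n @^-1` (Some @` E) `&` Ac n.+1 @^-1` C) =
    \int[Q]_(w in X n @^-1` (Some @` E)) uniform_image (@mH n) (X n w) C.
  move=> mE mC.
  have mHE : measurable (@dhlast n @^-1` (Some @` E)).
    rewrite -[Y in measurable Y]setTI; apply: measurable_dhlast => //.
    exact: measurable_Sinf_image.
  have := Q1 n _ C mHE mC.
  rewrite (_ : dhist_of X Ac n @^-1` _ = X n @^-1` (Some @` E))//.
  by apply/seteqP; split => w; rewrite /= dhlast_dhist_of.
have pairE n (E B : set (borel S)) C : measurable E -> measurable B -> measurable C ->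
    \int[Q]_(w in X n @^-1` (Some @` E)) (\1_(B `*` C) (od (X n w), Ac n.+1 w))%:E =
    Q (X n @^-1` (Some @` (E `&` B)) `&` Ac n.+1 @^-1` C).
  move=> mE mB mC.
  rewrite (_ : (fun w => _) = fun w =>
    (\1_([set w | B (od (X n w))] `&` Ac n.+1 @^-1` C) w)%:E); last first.
    by apply/funext => w; rewrite indic_setX indicI.
  rewrite integral_indic//; [|exact: mXE|by apply: measurableI; [exact: modXE|exact: mAE]].
  by congr (Q _); rewrite Sinf_preimage setIAC.
have IF n (E : set (borel S)) : measurable E ->
    integral_functional (fun f : borel S * borel A -> \bar R =>
      \int[Q]_(w in X n @^-1` (Some @` E)) f (od (X n w), Ac n.+1 w)).
  move=> mE; apply: (@integral_functional_comp _ _ _ _ _ _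
    (fun (f : borel S * borel A -> \bar R) w => f (od (X n w), Ac n.+1 w))).
  - by apply: integral_functional_integral; exact: mXE.
  - by move=> w; exact: integral_functional_eval.
  - by move=> f [mf _]; exact: (measurableT_comp mf (@modA n)).
have IFoo n (E : set (borel S)) : measurable E ->
    \int[Q]_(w in X n @^-1` (Some @` E)) (cst 1 (od (X n w), Ac n.+1 w)) < +oo.
  move=> mE; rewrite integral_cst ?mul1e; last exact: mXE.
  by apply: le_lt_trans (probability_le1 Q _) _; [exact: mXE|exact: ltry].
have offZ n : (forall E, measurable E -> Q (X n @^-1` (Some @` E)) = m n E) ->
    forall E C, measurable E -> E `<=` ~` Z -> measurable C ->
    M n (E `*` C) = Q (X n @^-1` (Some @` E) `&` Ac n.+1 @^-1` C).
  move=> IH E C mE EZ mC; rewrite step// GE//.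
  rewrite [RHS](eq_integral (fun w => uniform_image (@mG n) (od (X n w)) C)); last first.
    by move=> w /set_mem[y Ey yE]; rewrite sigN// -yE/=; exact: EZ.
  (* X_n and the first marginal of [M n] have the same law off Z, by [IH] and [Mm], so a function of
     the state has equal integrals under both. *)
  suff key : forall k : borel S -> \bar R, nnmeas k ->
      \int[Q]_(w in X n @^-1` (Some @` E)) k (od (X n w)) = \int[M n]_(z in E `*` setT) k z.1.
    rewrite (key (fun y => uniform_image (@mG n) y C))//.
    split; last by move=> y; exact: measure_ge0.
    exact: (measurable_kernel (uniform_image_pker (@mG n))).
  apply: (@integral_functional_ext _ _ _
    (fun k => \int[Q]_(w in X n @^-1` (Some @` E)) k (od (X n w)))
    (fun k => \int[M n]_(z in E `*` setT) k z.1)).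
  - apply: (@integral_functional_comp _ _ _ _ _ _ (fun (k : borel S -> \bar R) w => k (od (X n w)))).
    + by apply: integral_functional_integral; exact: mXE.
    + by move=> w; exact: integral_functional_eval.
    + by move=> k [mk _]; exact: (measurableT_comp mk (@modX n)).
  - apply: (@integral_functional_comp _ _ _ _ _ _
      (fun (k : borel S -> \bar R) (z : borel S * borel A) => k z.1)).
    + by apply: integral_functional_integral; exact: measurableX.
    + by move=> z; exact: integral_functional_eval.
    + by move=> k [mk _]; exact: (measurableT_comp mk measurable_fst).
  - move=> B mB.
    rewrite (_ : (fun w => _) = fun w => (\1_[set w | B (od (X n w))] w)%:E)//.
    rewrite integral_indic//; [|exact: mXE|exact: modXE].
    transitivity (Q (X n @^-1` (Some @` (E `&` B)))); first by rewrite Sinf_preimage.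
    rewrite IH; last exact: measurableI.
    rewrite (_ : (fun z => _) = fun z : borel S * borel A => (\1_(B `*` setT) z)%:E); last first.
      by apply/funext => z; rewrite indic_setX indicT mulr1.
    rewrite integral_indic//; [|exact: measurableX|exact: measurableX].
    rewrite -setXI setTI setIC -Mm//; first exact: measurableI.
    by move=> y [_ /EZ].
suff law n E : measurable E -> Q (X n @^-1` (Some @` E)) = m n E.
  by move=> n E C mE EZ mC; apply: offZ => // B mB; exact: law.
elim: n E => [|n IH] E mE.
  rewrite Q0; last exact: measurable_Sinf_image.
  rewrite m0//; congr (gamma _); apply/seteqP; split => y /=; last by move=> Ey; exists y.
  by move=> [z Ez [<-]].
pose f (z : borel S * borel A) : \bar R := (pS q qtm z.1 z.2 E)%:E.
have nf : nnmeas f := npS _ mE.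
have := Q2 n setT setT (Some @` E) measurableT measurableT (measurable_Sinf_image mE).
rewrite !preimage_setT !setTI => ->.
have mZc : measurable (~` Z) by exact: measurableC.
(* x_oo is absorbing, so paths with X_n = x_oo do not reach E. *)
transitivity (\int[Q]_(w in X n @^-1` (Some @` setT)) f (od (X n w), Ac n.+1 w)).
  rewrite [RHS]integral_mkcond; apply: eq_integral => w _; rewrite patchE.
  have fNone : \1_(Some @` E) (None : option S) = 0%R :> R.
    by rewrite indicE memNset// => -[].
  case: ifPn => [/set_mem[y _ yE]|/negP nX].
    rewrite -yE /ptrans fNone mulr0 adde0 /f/=; congr (pS _ _ _ _ _)%:E.
    by apply/seteqP; split => u /=; [move=> [v Ev [<-]]|move=> Eu; exists u].
  case yE : (X n w) => [y|]; last by rewrite /ptrans fNone.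
  by exfalso; apply: nX; rewrite mem_set//; exists y.
rewrite -(setUv Z) image_setU preimage_setU ge0_integral_setU//=; first last.
- by apply/disj_setPS => w [/= [y Zy yE] [z nZ zE]]; move: zE; rewrite -yE => -[zy]; rewrite zy in nZ.
- by move=> w _; case: nf => _; apply.
- by apply: measurable_funTS; exact: (measurableT_comp nf.1 (@modA n)).
- exact: mXE.
- exact: mXE.
(* On Z the joint law of state and action is that of X_n with [fstar] applied to it, by comparison
   with [J] on rectangles. There q_x is 0, and [pS], a quotient with denominator 0, is 0. *)
have -> : \int[Q]_(w in X n @^-1` (Some @` Z)) f (od (X n w), Ac n.+1 w) = 0.
  pose J (f : borel S * borel A -> \bar R) :=
    \int[Q]_(w in X n @^-1` (Some @` Z)) f (od (X n w), fstar (od (X n w)) : borel A).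
  rewrite (@integral_functional_ext_prod _ _ _ _ _ _ J (IF n Z mZ) _ (IFoo n Z mZ) _ _ nf).
  - apply: integral0_eq => w [y Zy yE]; rewrite /f -yE/= /pS qfs// invr0 mulr0//.
  - apply: (@integral_functional_comp _ _ _ _ _ _
      (fun (f : borel S * borel A -> \bar R) w => f (od (X n w), fstar (od (X n w)) : borel A))).
    + by apply: integral_functional_integral; exact: mXE.
    + by move=> w; exact: integral_functional_eval.
    + move=> k [mk _]; apply: (measurableT_comp mk); apply: measurable_fun_pair => //.
      exact: (measurableT_comp mfs (@modX n)).
  - move=> B C mB mC; rewrite pairE// step//; last exact: measurableI.
    rewrite Sinf_preimage setIC /J [LHS]integral_mkcondr.
    apply: eq_integral => w /set_mem[y Zy yE].
    rewrite patchE indic_setX/= sigZ; last by rewrite -yE.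
    rewrite [\1_B _]indicE -(_ : (w \in [set w | B (od (X n w))]) = (od (X n w) \in B)); last first.
      by apply/idP/idP => /set_mem h; apply: mem_set.
    by case: ifP => _; rewrite ?mul1r ?mul0r.
(* Off Z the joint law of state and action is [M n], checked on rectangles by [offZ]; as [M n] does
   not charge Z, the integral over all states is recovered. *)
rewrite add0e (@integral_functional_ext_prod _ _ _ _ _ _
  (fun f => \int[M n]_(z in ~` Z `*` setT) f z) (IF n _ mZc) _ (IFoo n _ mZc) _ _ nf).
- rewrite mS// -/f [RHS](_ : _ = \int[M n]_(z in setT) f z)//.
  rewrite -(setUv (Z `*` [set: borel A])) ge0_integral_setU//=.
  + rewrite (_ : \int[M n]_(x in Z `*` setT) f x = 0); last first.
      rewrite -[RHS](@integral_abs_eq0 _ _ _ (M n) (Z `*` setT) f) ?MZ//; last 2 first.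
      + exact: measurableX.
      + by apply: measurable_funTS; case: nf.
      by apply: eq_integral => z _; rewrite gee0_abs//; exact: nf.2.
    rewrite add0e; congr (integral _ _ _).
    by apply/seteqP; split => z /=; [move=> [nZ _] []|move=> nZ; split => // Zz; apply: nZ].
  + exact: measurableX.
  + by apply: measurableC; exact: measurableX.
  + by apply: measurable_funTS; case: nf.
  + by move=> z _; case: nf => _; apply.
  + by apply/disj_setPS => z [].
- by apply: integral_functional_integral; exact: measurableX.
- move=> B C mB mC; rewrite pairE// -offZ//; last exact: measurableI.
  rewrite integral_indic//; [|exact: measurableX|exact: measurableX].
  by rewrite -setXI setIT setIC.
Qed.

End discrete_time.

(** * Assembly: the occupancy measures realized by a Markov policy *)

Theorem theorem4p1 (R : realType) (S A : ptopologicalType)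
  (* S and A are nonempty Borel spaces *)
  (HS : BorelSpace R S) (HA : BorelSpace R A)
  (* initial distribution *)
  (gamma : probability (borel S) R)
  (* transition rates: q(.|x,a) is a signed measure, qtm(.|x,a) = q(. \ {x}|x,a) *)
  (q : S * A -> {charge set borel S -> \bar R})
  (qtm : S * A -> {measure set borel S -> \bar R})
  (Hq_meas : forall G : set (borel S), measurable G ->
     measurable_fun setT (fun z : borel S * borel A => q z G))
  (Hqtm : forall (z : S * A) (G : set (borel S)), measurable G ->
     qtm z G = q z (G `\ z.1))
  (Hq_cons : forall z : S * A, q z setT = 0%E)
  (Hq_bdd : forall x : S, exists M : R, forall a : A, qx q x a <= M)
  (* costs and constraint constants *)
  (N : nat) (c : nat -> S * A -> R) (d : nat -> R)
  (Hc_meas : forall i, (i <= N)%N ->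
     measurable_fun setT (fun z : borel S * borel A => c i z))
  (Hc_ge0 : forall i z, (i <= N)%N -> 0 <= c i z)
  (Hd_ge0 : forall j, (1 <= j <= N)%N -> 0 <= d j)
  (* Condition 1 *)
  (C1a : compact [set: A])
  (C1b : forall f : S -> R, continuous f -> (exists M : R, forall y, `|f y| <= M) ->
     continuous (fun z : S * A => fine (\int[qtm z]_y (f y)%:E) / qx q z.1 z.2))
  (C1c : continuous (fun z : S * A => qx q z.1 z.2))
  (C1d : forall i, (i <= N)%N -> lower_semicontinuous (fun z : S * A => (c i z)%:E))
  (* the selector f^* *)
  (fstar : S -> A)
  (Hfstar_meas : measurable_fun setT (fun x : borel S => (fstar x : borel A)))
  (Hfstar : forall x, S2 q c N x ->
     \sum_(i < N.+1) c i (x, fstar x) + qx q x (fstar x) = 0)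
  (* the CTMDP policy pi (pol n = pi_{n+1}) *)
  (pol : ctpolicy R S A)
  (Hpol : forall n (h : hist R S n) (s : R), 0 < s -> S2 q c N (hlast h) ->
     forall C : set (borel A), measurable C ->
       pol n (h, s) C = \d_(fstar (hlast h) : borel A) C)
  (* P = P^pi_gamma on a sample space with coordinates x_n, theta_n *)
  (dO : measure_display) (O : measurableType dO) (P : probability O R)
  (x : nat -> O -> Sinf (borel S)) (th : nat -> O -> \bar R)
  (Hlaw : ct_law x th gamma q qtm pol P)
  (* pi is feasible with a finite value *)
  (Hfeas : forall j, (1 <= j <= N)%N ->
     (ct_cost x th P pol (fun y a => (c j (y, a))%:E) <= (d j)%:E)%E)
  (Hfinite : (ct_cost x th P pol (fun y a => (c 0 (y, a))%:E) < +oo)%E) :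
  exists sig : nat -> R.-pker Sinf (borel S) ~> borel A,
    (forall n (y : S), S2 q c N y -> forall C : set (borel A), measurable C ->
        sig n (Some y) C = \d_(fstar y : borel A) C) /\
    (forall (dQ : measure_display) (Om : measurableType dQ) (Q : probability Om R)
            (X : nat -> Om -> Sinf (borel S)) (Ac : nat -> Om -> borel A),
       dt_law X Ac gamma q qtm sig Q ->
       forall (n : nat) (GS : set (borel S)) (GA : set (borel A)),
         measurable GS -> GS `<=` ~` S2 q c N -> measurable GA ->
         ct_occ x th P q pol n GS GA =
         Q (X n @^-1` (Some @` GS) `&` Ac n.+1 @^-1` GA)).
Proof.
have Hcost i : (i <= N)%N -> (ct_cost x th P pol (fun y a => (c i (y, a))%:E) < +oo)%E.
  by case: i => [//|i] iN; exact: le_lt_trans (Hfeas i.+1 iN) (ltry _).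
have npS (G : set (borel S)) : measurable G ->
    nnmeas (fun z : borel S * borel A => (pS q qtm z.1 z.2 G)%:E).
  exact: (nnmeas_pS HS HA Hq_meas Hqtm Hq_cons C1c).
pose Oc n := occ q pol P x th n.
have HO n : integral_functional (Oc n).
  exact: (integral_functional_occ HS HA Hqtm Hq_cons Hq_bdd C1c Hlaw).
have [M MP] := choice (fun n => integral_functional_measure (HO n)).
have ME n (E : set (borel S * borel A)) : measurable E ->
    M n E = Oc n (fun z => (\1_E z)%:E).
  by move=> mE; rewrite MP ?integral_indic ?setIT//; exact: nnmeas_indic.
have mS2 : measurable (S2 q c N : set (borel S)).
  exact: (measurable_S2 HS HA Hqtm Hq_cons C1c Hc_meas Hc_ge0 Hfstar_meas Hfstar).
have qfs y : S2 q c N y -> qx q y (fstar y) = 0.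
  exact: (qx_S2 HS Hqtm Hq_cons Hc_ge0 Hfstar).
(* The total mass is the probability that stage n is reached and ends, hence at most 1. *)
have Moo n : (M n setT < +oo)%E.
  rewrite -setXTT ME; last exact: measurableX.
  rewrite [Oc n _](occ_marginal HS HA Hqtm Hq_cons Hq_bdd C1c Hlaw)//.
  have [[mx mth] _ _ _ _] := Hlaw.
  apply: le_lt_trans (probability_le1 P _) (ltry 1).
  apply: measurableI; first by rewrite setIT; exact: measurable_alive.
  rewrite -[X in measurable X]setTI.
  exact: (emeasurable_fun_infty_o measurableT (mth n.+1)).
(* [occ] depends on a function only through its values off S_2, so the indicator of S_2 x A may be
   replaced by 0. *)
have MS2 n : M n (S2 q c N `*` setT) = 0%E.
  rewrite ME; last exact: measurableX.
  rewrite -[RHS](integral_functional0 (HO n)).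
  apply: (occ_off_S2 HS HA Hqtm Hq_cons C1c Hc_ge0 Hfstar Hpol P x th n).
  - by apply: nnmeas_indic; exact: measurableX.
  - exact: nnmeas_cst.
  - by move=> z zS2; rewrite indicE memNset// => -[].
have Mm n (E : set (borel S)) : measurable E -> E `<=` ~` S2 q c N ->
    M n (E `*` setT) = P (x n @^-1` (Some @` E)).
  move=> mE ES2; rewrite ME; last exact: measurableX.
  exact: (occ_marginal_off_S2 HS HA Hqtm Hq_cons Hq_bdd C1c Hc_meas Hc_ge0 Hlaw Hcost).
have m0 (G : set (borel S)) : measurable G -> P (x 0 @^-1` (Some @` G)) = gamma G.
  by case: Hlaw => _ _ + _ _; apply.
have mS n (G : set (borel S)) : measurable G ->
    P (x n.+1 @^-1` (Some @` G)) = (\int[M n]_z (pS q qtm z.1 z.2 G)%:E)%E.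
  move=> mG; rewrite -MP; last exact: npS.
  exact: (occ_next HS HA Hq_meas Hqtm Hq_cons Hq_bdd C1c Hlaw).
have [sig [sigS sigQ]] := @markov_realization R S A gamma q qtm (S2 q c N) fstar M
  (fun n G => P (x n @^-1` (Some @` G))) HA mS2 Hfstar_meas npS qfs Moo MS2 Mm m0 mS.
exists sig; split => // dQ Om Q X Ac HQ n GS GA mGS GS2 mGA.
rewrite -(sigQ _ _ _ _ _ HQ)// ME; last exact: measurableX.
exact: (ct_occE HS HA Hqtm Hq_cons Hq_bdd C1c Hlaw).
Qed.
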